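(* Let $V$ be a finite-dimensional $\mathbb{C}$-vector space and let $A$ be an $\mathrm{End}_{\mathbb{C}}(V)$-valued rational one-form on $\mathbb{P}^1$ with pole at $\infty$ of order at most two. Label its poles in $\mathbb{A}^1$ as $t_i$, $i=1,2,\dots,m$, and put $x_i=x-t_i$. Assume that for any $i$ there exist $\hat g_i\in\mathrm{Aut}_{\mathbb{C}[[x_i]]}(V\otimes_{\mathbb{C}}\mathbb{C}[[x_i]])$ and a normal form $d-d\Lambda_i-L_i\,dx_i/x_i$ at $x=t_i$ such that $$\hat g_i^{-1}\circ(d-A)\circ\hat g_i=d-d\Lambda_i-L_i\,dx_i/x_i+F(x_i)\,dx_i$$ for some $F\in\mathrm{End}_{\mathbb{C}[[x_i]]}(V\otimes_{\mathbb{C}}\mathbb{C}[[x_i]])$. Assume further that for each $i$ the restriction $L^{(i)}_0$ of $L_i$ to the subspace $\mathrm{Ker}(\Lambda_i)\subset V$ (the set of $v\in V$ with $\Lambda_iv=0$ in $V\otimes x_i^{-1}\mathbb{C}[x_i^{-1}]$) satisfies $$\mathrm{Ker}\big(L^{(i)}_0(L^{(i)}_0+k)\big)=\mathrm{Ker}\,L^{(i)}_0\qquad(k\in\mathbb{Z}).$$ Let $(V,W;\gamma)=\kappa(V,A)$. Then the $\mathcal{D}_{\mathbb{A}^1}$-module $\mathcal{V}_\gamma$ is isomorphic to the minimal extension to $\mathbb{A}^1$ of the (generic) connection $(\mathbb{C}(x)\otimes_{\mathbb{C}}V,\,d-A)$.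
   Context: $x$ is the standard coordinate on $\mathbb{A}^1=\mathbb{P}^1\setminus\{\infty\}$. **Normal forms.** Fix a maximal torus $\mathfrak{t}\subset\mathfrak{gl}(V)$ (equivalently, the diagonal matrices in a fixed basis). A normal form at $x=t_i$ is a connection $d-d\Lambda_i-L_i\,dx_i/x_i$ with $\Lambda_i\in x_i^{-1}\mathfrak{t}[x_i^{-1}]$ and $L_i\in\mathfrak{gl}(V)$ commuting with $\Lambda_i$. **Canonical section $\kappa$.** Write $A=\big(A_0+\sum_{i=1}^m\sum_{j=1}^{k_i}A^{(i)}_jx_i^{-j}\big)dx$ with $k_i$ the pole order at $t_i$. Put $\mathcal{R}_i=\mathbb{C}[x_i]/(x_i^{k_i})$, $\hat A_i=\sum_jA^{(i)}_jx_i^{k_i-j}\in\mathrm{End}_{\mathcal{R}_i}(V\otimes\mathcal{R}_i)$, $W_i=(V\otimes\mathcal{R}_i)/\mathrm{Ker}\,\hat A_i$. Let $N_i$ be multiplication by $x_i$ on $W_i$, let $P_i:V\to W_i$ send $v$ to the class of $v\otimes1$, and let $Q_i:W_i\to V$ send $w$ to the coefficient of $x_i^{k_i-1}$ of its image under the injection $W_i\to V\otimes\mathcal{R}_i$ induced by $\hat A_i$. Set $W=\bigoplus_iW_i$, $S=A_0$, $T=\bigoplus_i(t_i1_{W_i}+N_i)$, $Q=(Q_1\cdots Q_m):W\to V$, $P={}^t(P_1\cdots P_m):V\to W$, $\gamma=\begin{pmatrix} S & Q \\ P & T \end{pmatrix}\in\mathrm{End}(V\oplus W)$, and $\kappa(V,A)=(V,W;\gamma)$.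 One has $A=(S+Q(x1_W-T)^{-1}P)dx$. **The module $\mathcal{V}_\gamma$.** It is the cokernel of the left $\mathcal{D}_{\mathbb{A}^1}$-module endomorphism $\varphi_\gamma$ of $\mathcal{D}_{\mathbb{A}^1}\otimes_{\mathbb{C}}(V\oplus W)$ given by $$f\begin{pmatrix} v \\ w \end{pmatrix}\mapsto f\begin{pmatrix} \partial_x+S & Q \\ -P & x-T \end{pmatrix}\begin{pmatrix} v \\ w \end{pmatrix}\quad(f\in\mathcal{D}_{\mathbb{A}^1},\ v\in V,\ w\in W).$$ **Minimal extension.** For a vector bundle with connection over the generic point of $\mathbb{A}^1$, choose a nonempty Zariski open $j:U\hookrightarrow\mathbb{A}^1$ on which it extends to an algebraic vector bundle with connection $\mathcal{V}$ (here $\mathcal{V}=\mathcal{O}_U\otimes V$ with $d-A$, $U=\mathbb{A}^1\setminus\{t_1,\dots,t_m\}$), regard it as a left $\mathcal{D}_U$-module and take $j_{!*}\mathcal{V}$: the holonomic $\mathcal{D}_{\mathbb{A}^1}$-module extending $\mathcal{V}$ with no nonzero submodule or quotient module supported on $\mathbb{A}^1\setminus U$. *)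

(* Defs.v *)
From HB Require Import structures.
From mathcomp Require Import all_boot all_order all_algebra.
From mathcomp Require Import ring.
From mathcomp Require Import boolp reals.
From mathcomp Require Import complex.

Set Implicit Arguments.
Unset Strict Implicit.
Unset Printing Implicit Defensive.

Import GRing.Theory.
Local Open Scope ring_scope.
Local Open Scope quotient_scope.

Record derivation (K : comNzRingType) := Derivation {
  der_fun :> K -> K;
  der_zmod : zmod_morphism der_fun;
  derM : forall a b, der_fun (a * b) = der_fun a * b + a * der_fun b }.

HB.instance Definition _ (K : comNzRingType) (d : derivation K) :=
  GRing.isZmodMorphism.Build K K d (der_zmod d).

Lemma der1 (K : comNzRingType) (d : derivation K) : d 1 = 0.
Proof.
by apply: (@addrI _ (d 1)); rewrite addr0 -[RHS](congr1 d (mulr1 1)) derM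
  mulr1 mul1r.
Qed.

(* [nabla d A] is the connection [d - A] on [K^n]. *)
Definition nabla (K : comNzRingType) (d : derivation K) (n : nat)
    (A : 'M[K]_n) (v : 'cV[K]_n) : 'cV[K]_n :=
  map_mx d v - A *m v.

(* [diffop d] is the Ore extension [K[d]]: the polynomial
   [\sum_i P`_i 'X^i] stands for [\sum_i P`_i d^i], coefficients on the left.
   A left module over it is a [K]-module with an additive [nab] satisfying
   [nab (a m) = d a m + a nab m]; the multiplication of [diffop d] itself is
   the instance where [nab] is left multiplication by [d]. *)
Definition dact (K : comNzRingType) (M : lmodType K) (nab : M -> M)
    (P : {poly K}) (m : M) : M :=
  \sum_(i < size P) P`_i *: iter i nab m.

Section Dact.
Variables (K : comNzRingType) (d : derivation K) (M : lmodType K).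
Variable nab : M -> M.
Hypothesis nabB : zmod_morphism nab.
Hypothesis nabZ : forall a m, nab (a *: m) = d a *: m + a *: nab m.

#[local] HB.instance Definition _ := GRing.isZmodMorphism.Build M M nab nabB.

Lemma dact_widen N (P : {poly K}) m : (size P <= N)%N ->
  dact nab P m = \sum_(i < N) P`_i *: iter i nab m.
Proof.
move=> le; rewrite /dact (big_ord_widen N (fun i => P`_i *: iter i nab m)) //.
rewrite big_mkcond; apply: eq_bigr => i _; case: ltnP => // le'.
by rewrite nth_default // scale0r.
Qed.

Lemma dactDl P Q m : dact nab (P + Q) m = dact nab P m + dact nab Q m.
Proof.
pose N := maxn (size (P + Q)) (maxn (size P) (size Q)).
rewrite !(@dact_widen N) ?leq_max ?leqnn ?orbT // -big_split /=.
by apply: eq_bigr => i _; rewrite coefD scalerDl.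
Qed.

Lemma dactZl a P m : dact nab (a *: P) m = a *: dact nab P m.
Proof.
rewrite !(@dact_widen (size P)) ?size_scale_leq // scaler_sumr.
by apply: eq_bigr => i _; rewrite coefZ scalerA.
Qed.

Lemma iter_nabD i m1 m2 :
  iter i nab (m1 + m2) = iter i nab m1 + iter i nab m2.
Proof. by elim: i => //= i ->; rewrite raddfD. Qed.

Lemma dactDr P m1 m2 : dact nab P (m1 + m2) = dact nab P m1 + dact nab P m2.
Proof.
by rewrite /dact -big_split; apply: eq_bigr => i _; rewrite iter_nabD scalerDr.
Qed.

Lemma dact_sum I (r : seq I) (F : I -> {poly K}) m :
  dact nab (\sum_(i <- r) F i) m = \sum_(i <- r) dact nab (F i) m.
Proof.
elim: r => [|x r IH]; last by rewrite !big_cons dactDl IH.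
by rewrite !big_nil /dact size_poly0 big_ord0.
Qed.

Lemma dact1 m : dact nab 1 m = m.
Proof. by rewrite /dact size_poly1 big_ord1 coef1 scale1r. Qed.

Definition dleft (Q : {poly K}) : {poly K} := Q * 'X + map_poly d Q.

Lemma dact_dleft Q m : dact nab (dleft Q) m = nab (dact nab Q m).
Proof.
have szd : (size (map_poly d Q) <= size Q)%N by apply: size_poly.
have szX : (size (Q * 'X)%R <= (size Q).+1)%N.
  by apply: leq_trans (size_polyMleq _ _) _; rewrite size_polyX addn2.
rewrite dactDl (dact_widen _ szX) (dact_widen _ szd) big_ord_recl.
rewrite coefMX /= scale0r add0r /dact raddf_sum -big_split /=.
by apply: eq_bigr => i _; rewrite coefMX coef_map nabZ addrC.
Qed.

End Dact.

Definition diffop (K : comNzRingType) (d : derivation K) : Type := {poly K}.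
Definition connmod (K : comNzRingType) (d : derivation K) (n : nat)
  (A : 'M[K]_n) : Type := 'cV[K]_n.

Section Diffop.
Variables (K : comNzRingType) (d : derivation K).
Local Notation diffop := (diffop d).

HB.instance Definition _ := GRing.Zmodule.on diffop.

Definition diffop_mul (P Q : diffop) : diffop := dact (dleft d) P Q.

Lemma dleftB : zmod_morphism (dleft d).
Proof. by move=> P Q; rewrite /dleft mulrBl raddfB /= opprD addrACA. Qed.

Lemma dleftZ a Q : dleft d (a *: Q) = d a *: Q + a *: dleft d Q.
Proof.
rewrite /dleft scalerDr -scalerAl addrCA; congr (_ + _).
by apply/polyP => i; rewrite coefD !coefZ !coef_map /= coefZ derM.
Qed.

Lemma dact_mul (M : lmodType K) (nab : M -> M) (P Q : {poly K}) m :
  zmod_morphism nab -> (forall a u, nab (a *: u) = d a *: u + a *: nab u) ->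
  dact nab (dact (dleft d) P Q) m = dact nab P (dact nab Q m).
Proof.
move=> nabB nabZ; rewrite /(dact (dleft d)) dact_sum.
apply: eq_bigr => i _; rewrite dactZl; congr (_ *: _).
by elim: (nat_of_ord i) => //= j <-; rewrite (dact_dleft nabB nabZ).
Qed.

Lemma diffop_mulA : associative diffop_mul.
Proof. by move=> P Q T; rewrite /diffop_mul (dact_mul _ _ _ dleftB dleftZ). Qed.

Lemma diffop_mul1l : left_id (1 : {poly K}) diffop_mul.
Proof. exact: dact1. Qed.

Lemma diffop_mulr1 : right_id (1 : {poly K}) diffop_mul.
Proof.
move=> P; rewrite /diffop_mul /dact -[RHS]coefK poly_def.
apply: eq_bigr => i _; congr (_ *: _).
elim: (nat_of_ord i) => //= j ->; rewrite /dleft -exprSr.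
rewrite [map_poly _ _](_ : _ = 0) ?addr0 //; apply/polyP => l.
by rewrite coef_map coefXn coef0; case: eqP => _ /=; rewrite ?der1 ?raddf0.
Qed.

Lemma diffop_mulDl : left_distributive diffop_mul +%R.
Proof. by move=> P Q T; apply: dactDl. Qed.

Lemma diffop_mulDr : right_distributive diffop_mul +%R.
Proof. by move=> P Q T; apply: dactDr dleftB _ _ _. Qed.

Lemma diffop_1neq0 : (1 : {poly K}) != 0.
Proof. exact: oner_neq0. Qed.

HB.instance Definition _ := GRing.Zmodule_isNzRing.Build diffop
  diffop_mulA diffop_mul1l diffop_mulr1 diffop_mulDl diffop_mulDr diffop_1neq0.

Definition dop_fun (a : K) : diffop := a%:P.
Definition dop_der : diffop := 'X.

(* [connmod d A] is [K^n] with the derivation acting by [d - A]. *)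
Section Connmod.
Variables (n : nat) (A : 'M[K]_n).
Local Notation connmod := (connmod d).
HB.instance Definition _ := GRing.Zmodule.on (connmod A).

Lemma nablaB : zmod_morphism (nabla d A).
Proof. by move=> u v; rewrite /nabla raddfB /= mulmxBr opprD opprK addrACA opprD opprK. Qed.

Lemma nablaZ a u : nabla d A (a *: u) = d a *: u + a *: nabla d A u.
Proof.
rewrite /nabla scalerBr -scalemxAr addrA; congr (_ - _).
by apply/matrixP => i j; rewrite !mxE derM.
Qed.

HB.instance Definition _ := GRing.Zmodule_isLmodule.Build diffop (connmod A)
  (fun P Q m => esym (dact_mul P Q m nablaB nablaZ))
  (dact1 (nabla d A)) (dactDr nablaB) (fun m P Q => dactDl (nabla d A) P Q m).
End Connmod.

End Diffop.

Section Cokernel.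
Variables (R : nzRingType) (M N : lmodType R) (phi : {linear M -> N}).

Definition im_pred : {pred N} := fun y => `[< exists x, y = phi x >].

Definition coker_eqv (x y : N) : bool := (x - y) \in im_pred.

Lemma coker_eqv_refl : reflexive coker_eqv.
Proof. by move=> x; apply/asboolP; exists 0; rewrite linear0 subrr. Qed.

Lemma coker_eqv_sym : symmetric coker_eqv.
Proof.
suff imp x y : coker_eqv x y -> coker_eqv y x.
  by move=> x y; apply/idP/idP; apply: imp.
by move=> /asboolP[z e]; apply/asboolP; exists (- z); rewrite linearN -e opprB.
Qed.

Lemma coker_eqv_trans : transitive coker_eqv.
Proof.
move=> y x z /asboolP[u eu] /asboolP[v ev]; apply/asboolP; exists (u + v).
by rewrite linearD -eu -ev addrA subrK.
Qed.

Canonical coker_eqv_equiv :=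
  EquivRel coker_eqv coker_eqv_refl coker_eqv_sym coker_eqv_trans.

Definition coker : Type := {eq_quot coker_eqv}.
HB.instance Definition _ := Choice.on coker.
HB.instance Definition _ : EqQuotient _ coker_eqv coker := EqQuotient.on coker.

Definition coker_pi (x : N) : coker := \pi_coker x.

Lemma coker_piP x y : reflect (exists z, x - y = phi z) (coker_pi x == coker_pi y).
Proof. by rewrite /coker_pi eqmodE; apply: asboolP. Qed.

Lemma coker_piW (P : coker -> Prop) : (forall x, P (coker_pi x)) -> forall x, P x.
Proof. by move=> H; elim/quotW. Qed.

Lemma coker_repr x : exists z, repr (coker_pi x) - x = phi z.
Proof. by apply/coker_piP; rewrite /coker_pi reprK. Qed.

Definition coker_add (x y : coker) : coker := coker_pi (repr x + repr y).
Definition coker_opp (x : coker) : coker := coker_pi (- repr x).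
Definition coker_scale (a : R) (x : coker) : coker := coker_pi (a *: repr x).

Lemma coker_pi_add x y : coker_add (coker_pi x) (coker_pi y) = coker_pi (x + y).
Proof.
apply/eqP/coker_piP; have [u eu] := coker_repr x; have [v ev] := coker_repr y.
by exists (u + v); rewrite linearD -eu -ev opprD addrACA.
Qed.

Lemma coker_pi_opp x : coker_opp (coker_pi x) = coker_pi (- x).
Proof.
apply/eqP/coker_piP; have [u eu] := coker_repr x.
by exists (- u); rewrite (linearN phi) -eu opprB opprK addrC.
Qed.

Lemma coker_pi_scale a x : coker_scale a (coker_pi x) = coker_pi (a *: x).
Proof.
apply/eqP/coker_piP; have [u eu] := coker_repr x.
by exists (a *: u); rewrite (linearZZ phi) -eu scalerBr.
Qed.

Lemma coker_addA : associative coker_add.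
Proof.
by elim/coker_piW=> x; elim/coker_piW=> y; elim/coker_piW=> z;
  rewrite !coker_pi_add addrA.
Qed.
Lemma coker_addC : commutative coker_add.
Proof. by move=> x y; rewrite /coker_add addrC. Qed.
Lemma coker_add0 : left_id (coker_pi 0) coker_add.
Proof. by elim/coker_piW=> x; rewrite coker_pi_add add0r. Qed.
Lemma coker_addN : left_inverse (coker_pi 0) coker_opp coker_add.
Proof. by elim/coker_piW=> x; rewrite coker_pi_opp coker_pi_add addNr. Qed.

HB.instance Definition _ := GRing.isZmodule.Build coker
  coker_addA coker_addC coker_add0 coker_addN.

Lemma coker_scaleA a b x : coker_scale a (coker_scale b x) = coker_scale (a * b) x.
Proof. by elim/coker_piW: x => x; rewrite !coker_pi_scale scalerA. Qed.
Lemma coker_scale1 : left_id 1 coker_scale.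
Proof. by elim/coker_piW=> x; rewrite coker_pi_scale scale1r. Qed.
Lemma coker_scaleDr : right_distributive coker_scale +%R.
Proof.
move=> a; elim/coker_piW=> x; elim/coker_piW=> y.
by rewrite [_ + _]coker_pi_add !coker_pi_scale [RHS]coker_pi_add scalerDr.
Qed.
Lemma coker_scaleDl x : {morph coker_scale^~ x : a b / a + b}.
Proof.
move=> a b; elim/coker_piW: x => x.
by rewrite !coker_pi_scale [RHS]coker_pi_add scalerDl.
Qed.

HB.instance Definition _ := GRing.Zmodule_isLmodule.Build R coker
  coker_scaleA coker_scale1 coker_scaleDr coker_scaleDl.

Lemma coker_pi_is_linear : linear coker_pi.
Proof.
move=> a x y; rewrite [_ *: coker_pi x]coker_pi_scale.
by rewrite [RHS]coker_pi_add.
Qed.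
HB.instance Definition _ :=
  GRing.isLinear.Build R N coker _ coker_pi coker_pi_is_linear.

End Cokernel.

Definition poly_der (C : fieldType) : derivation {poly C} :=
  @Derivation {poly C} (@deriv C) (fun p q => derivB p q) (@derivM C).

Section FracDer.
Variables (K : idomainType) (d : derivation K).
Local Notation F := {fraction K}.
Local Notation "x %:F" := (@FracField.tofrac K x).

Lemma fracE (f : F) : f = (\n_(repr f))%:F / (\d_(repr f))%:F.
Proof.
rewrite -[LHS]reprK -[X in \pi X]Ratio_numden.
set a := \n__; set b := \d__; have b0 : b != 0 by apply: denom_ratioP.
have b0F : b%:F != 0 by rewrite tofrac_eq0.
apply: (mulIf b0F); rewrite mulfVK //.
unlock FracField.tofrac; rewrite -[LHS]FracField.pi_mul.
apply/eqmodP; rewrite /= FracField.equivfE /FracField.mulf.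
by rewrite !numden_Ratio ?oner_eq0 ?mulr1 ?mulf_neq0 ?oner_eq0 // mulrC.
Qed.

Definition frac_der_fun (f : F) : F :=
  let n := \n_(repr f) in let m := \d_(repr f) in
  (d n * m - n * d m)%:F / (m ^+ 2)%:F.

Lemma frac_der_rel (f : F) n m : m != 0 -> f * m%:F = n%:F ->
  frac_der_fun f * m%:F = (d n)%:F - f * (d m)%:F.
Proof.
move=> m0 fm; rewrite /frac_der_fun; have fE := fracE f.
set a := \n__ in fE *; set b := \d__ in fE *.
have b0 : b%:F != 0 by rewrite tofrac_eq0 denom_ratioP.
have fb : f * b%:F = a%:F by rewrite fE mulfVK.
have e : n * b = a * m.
  by apply/eqP; rewrite -tofrac_eq !tofracM -fm -fb mulrAC.
have key (E : fieldType) (g y x n' y' a' x' : E) : x != 0 ->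
    n' * x + g * y * x' = a' * y + g * x * y' ->
    (a' * x - g * x * x') / x ^+ 2 * y = n' - g * y'.
  move=> x0 h; have -> : n' = (a' * y + g * x * y' - g * y * x') / x.
    by apply: (mulIf x0); rewrite mulfVK // -h addrK.
  by field.
rewrite tofracXn tofracB !tofracM -fb; apply: key => //.
by rewrite fm fb -!tofracM -!tofracD -!derM e.
Qed.

Lemma frac_repr (f : F) : exists n m, m != 0 /\ f * m%:F = n%:F.
Proof.
exists \n_(repr f), \d_(repr f); split; first exact: denom_ratioP.
by rewrite {1}[f]fracE mulfVK // tofrac_eq0 denom_ratioP.
Qed.

Lemma frac_der_zmod : zmod_morphism frac_der_fun.
Proof.
move=> f g; have [a [b [b0 fb]]] := frac_repr f.
have [x [y [y0 gy]]] := frac_repr g.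
have by0 : b * y != 0 by rewrite mulf_neq0.
have hF : (b * y)%:F != 0 by rewrite tofrac_eq0.
apply: (mulIf hF).
have e : (f - g) * (b * y)%:F = (a * y - x * b)%:F.
  rewrite tofracM tofracB !tofracM -fb -gy mulrBl mulrA; congr (_ - _).
  by rewrite [b%:F * _]mulrC mulrA.
rewrite (frac_der_rel by0 e).
have -> : (frac_der_fun f - frac_der_fun g) * (b * y)%:F =
   frac_der_fun f * b%:F * y%:F - frac_der_fun g * y%:F * b%:F.
  by rewrite tofracM; ring.
rewrite (frac_der_rel b0 fb) (frac_der_rel y0 gy).
rewrite raddfB /= !derM !(tofracN, tofracD, tofracM) -fb -gy.
by move: (d a)%:F (d b)%:F (d x)%:F (d y)%:F b%:F y%:F => *; ring.
Qed.

Lemma frac_derM f g :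
  frac_der_fun (f * g) = frac_der_fun f * g + f * frac_der_fun g.
Proof.
have [a [b [b0 fb]]] := frac_repr f.
have [x [y [y0 gy]]] := frac_repr g.
have by0 : b * y != 0 by rewrite mulf_neq0.
have hF : (b * y)%:F != 0 by rewrite tofrac_eq0.
apply: (mulIf hF).
have e : f * g * (b * y)%:F = (a * x)%:F by rewrite !tofracM -fb -gy; ring.
rewrite (frac_der_rel by0 e).
have -> : (frac_der_fun f * g + f * frac_der_fun g) * (b * y)%:F =
   frac_der_fun f * b%:F * (g * y%:F) + frac_der_fun g * y%:F * (f * b%:F).
  by rewrite tofracM; ring.
rewrite (frac_der_rel b0 fb) (frac_der_rel y0 gy).
rewrite !derM !(tofracD, tofracM) -fb -gy.
by move: (d a)%:F (d b)%:F (d x)%:F (d y)%:F b%:F y%:F => *; ring.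
Qed.

Definition frac_der : derivation F := Derivation frac_der_zmod frac_derM.

Lemma frac_der_div n m : m != 0 ->
  frac_der (n%:F / m%:F) = (d n * m - n * d m)%:F / (m ^+ 2)%:F.
Proof.
move=> m0; have mF : m%:F != 0 by rewrite tofrac_eq0.
have e : n%:F / m%:F * m%:F = n%:F by rewrite mulfVK.
have key (E : fieldType) (x y a b : E) :
    y != 0 -> a - x / y * b = (a * y - x * b) / y ^+ 2 * y.
  by move=> y0; field.
apply: (mulIf mF); rewrite tofracXn tofracB !tofracM -(key _ _ _ _ _ mF).
exact: frac_der_rel m0 e.
Qed.

End FracDer.

Section Fps.
Variable C : fieldType.

Record fps := Fps { fps_coef : nat -> C }.

Lemma fpsP f g : fps_coef f =1 fps_coef g -> f = g.
Proof. by case: f g => [f] [g] /= /funext ->. Qed.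

HB.instance Definition _ := gen_eqMixin fps.
HB.instance Definition _ := gen_choiceMixin fps.

Definition fps_add f g := Fps (fun n => fps_coef f n + fps_coef g n).
Definition fps_opp f := Fps (fun n => - fps_coef f n).
Definition fps_mul f g :=
  Fps (fun n => \sum_(i < n.+1) fps_coef f i * fps_coef g (n - i)).
Definition fps_const (c : C) := Fps (fun n => c *+ (n == 0)).

Lemma fps_addA : associative fps_add.
Proof. by move=> f g h; apply: fpsP => n /=; rewrite addrA. Qed.
Lemma fps_addC : commutative fps_add.
Proof. by move=> f g; apply: fpsP => n /=; rewrite addrC. Qed.
Lemma fps_add0 : left_id (fps_const 0) fps_add.
Proof. by move=> f; apply: fpsP => n /=; rewrite mul0rn add0r. Qed.
Lemma fps_addN : left_inverse (fps_const 0) fps_opp fps_add.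
Proof. by move=> f; apply: fpsP => n /=; rewrite mul0rn addNr. Qed.
HB.instance Definition _ := GRing.isZmodule.Build fps
  fps_addA fps_addC fps_add0 fps_addN.

Definition fps_trunc N f : {poly C} := \poly_(i < N.+1) fps_coef f i.

Lemma coef_trunc N f n : (n <= N)%N -> (fps_trunc N f)`_n = fps_coef f n.
Proof. by move=> le; rewrite coef_poly ltnS le. Qed.

Lemma coef_fps_mul N f g n : (n <= N)%N ->
  fps_coef (fps_mul f g) n = (fps_trunc N f * fps_trunc N g)`_n.
Proof.
move=> le; rewrite coefM; apply: eq_bigr => i _.
have iN : (i <= N)%N by apply: leq_trans le; rewrite -ltnS.
have jN : (n - i <= N)%N by apply: leq_trans le; apply: leq_subr.
by rewrite !coef_trunc.
Qed.

Lemma fps_mulC : commutative fps_mul.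
Proof.
by move=> f g; apply: fpsP => n; rewrite !(@coef_fps_mul n) // mulrC.
Qed.

Lemma fps_mulA : associative fps_mul.
Proof.
move=> f g h; apply: fpsP => n.
transitivity (fps_trunc n f * (fps_trunc n g * fps_trunc n h))`_n.
  rewrite coefM; apply: eq_bigr => i _.
  by rewrite (@coef_fps_mul n) ?leq_subr // coef_trunc // leq_ord.
rewrite mulrA coefM; apply: eq_bigr => i _.
have iN : (i <= n)%N by rewrite -ltnS.
by rewrite (@coef_fps_mul n f) // coef_trunc // leq_subr.
Qed.

Lemma fps_mul1 : left_id (fps_const 1) fps_mul.
Proof.
move=> f; apply: fpsP => n /=; rewrite big_ord_recl /= subn0 mul1r big1 ?addr0 //.
by move=> i _; rewrite mulr0n mul0r.
Qed.

Lemma fps_mulDl : left_distributive fps_mul fps_add.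
Proof.
move=> f g h; apply: fpsP => n /=; rewrite -big_split /=.
by apply: eq_bigr => i _; rewrite mulrDl.
Qed.

Lemma fps_1neq0 : fps_const 1 != fps_const 0.
Proof.
apply/eqP => /(congr1 (fun f => fps_coef f 0)) /= /eqP.
by rewrite mulr1n mul0rn oner_eq0.
Qed.

HB.instance Definition _ := GRing.Zmodule_isComNzRing.Build fps
  fps_mulA fps_mulC fps_mul1 fps_mulDl fps_1neq0.

Definition fps_unit : {pred fps} := fun f => `[< exists g, g * f = 1 >].
Definition fps_inv (f : fps) : fps :=
  if pselect (exists g, g * f = 1) is left e then projT1 (cid e) else f.

Lemma fps_mulVx : {in fps_unit, left_inverse 1 fps_inv *%R}.
Proof.
move=> f /asboolP uf; rewrite /fps_inv; case: pselect => // e.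
by case: (cid e).
Qed.
Lemma fps_unitPl f g : g * f = 1 -> fps_unit f.
Proof. by move=> e; apply/asboolP; exists g. Qed.
Lemma fps_invr_out : {in [predC fps_unit], fps_inv =1 id}.
Proof.
move=> f /negP nu; rewrite /fps_inv; case: pselect => // e.
by case: nu; apply/asboolP.
Qed.

HB.instance Definition _ := GRing.ComNzRing_hasMulInverse.Build fps
  fps_mulVx fps_unitPl fps_invr_out.

Lemma fps_idomain (f g : fps) : f * g = 0 -> (f == 0) || (g == 0).
Proof.
move=> fg; have ex (h : fps) : h != 0 -> exists n, fps_coef h n != 0.
  move=> h0; apply: contrapT => no; case/eqP: h0; apply: fpsP => n /=.
  by rewrite mul0rn; apply/eqP/negPn/negP => hn; apply: no; exists n.
apply/negPn/negP; rewrite negb_or => /andP[/ex f0 /ex g0].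
case: (ex_minnP f0) => a fa mina; case: (ex_minnP g0) => b gb minb.
have := congr1 (fun h => fps_coef h (a + b)) fg; rewrite /= mul0rn.
have lt : (a < (a + b).+1)%N by rewrite ltnS leq_addr.
rewrite (bigD1 (Ordinal lt)) //= addKn big1 ?addr0 => [/eqP|i ia].
  by rewrite mulf_eq0 (negPf fa) (negPf gb).
case: (ltngtP i a) => [lti|gti|eqi].
- have [->|/mina] := eqVneq (fps_coef f i) 0; first by rewrite mul0r.
  by rewrite leqNgt lti.
- have [->|/minb] := eqVneq (fps_coef g (a + b - i)) 0; first by rewrite mulr0.
  by rewrite leqNgt ltn_subLR ?ltn_add2r ?gti // -ltnS ltn_ord.
- by case/eqP: ia; apply: val_inj.
Qed.

HB.instance Definition _ := GRing.ComUnitRing_isIntegral.Build fps fps_idomain.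

Definition fps_der_fun (f : fps) : fps := Fps (fun n => fps_coef f n.+1 *+ n.+1).

Lemma fps_der_zmod : zmod_morphism fps_der_fun.
Proof. by move=> f g; apply: fpsP => n /=; rewrite mulrnBl. Qed.

Lemma fps_derM f g : fps_der_fun (f * g) = fps_der_fun f * g + f * fps_der_fun g.
Proof.
apply: fpsP => n; change (fps_coef (fps_mul f g) n.+1 *+ n.+1 =
  fps_coef (fps_mul (fps_der_fun f) g) n +
  fps_coef (fps_mul f (fps_der_fun g)) n).
rewrite (@coef_fps_mul n.+1) // -coef_deriv derivM coefD; congr (_ + _).
  rewrite coefM; apply: eq_bigr => i _; rewrite coef_deriv.
  have iN : (i <= n)%N by rewrite -ltnS.
  by rewrite !coef_trunc // (leq_trans (leq_subr _ _)).
rewrite coefM; apply: eq_bigr => i _; rewrite coef_deriv.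
have iN : (i <= n)%N by rewrite -ltnS.
by rewrite !coef_trunc // ?ltnS ?leq_subr // ltnW.
Qed.

Definition fps_der : derivation fps := Derivation fps_der_zmod fps_derM.

Definition fps_X : fps := Fps (fun n => (n == 1)%:R).

End Fps.

Notation laurent C := {fraction (fps C)}.

Section Regular.
Variables (C : fieldType) (s : seq C).
Local Notation F := {fraction {poly C}}.
Local Notation "p %:F" := (@FracField.tofrac {poly C} p).

(* With [U] the complement of [s] in [A^1]: [regular] is the ring [O_U],
   the localisation of [C[x]] at the powers of [hpoly], and
   [diffop reg_der] is [D_U]. *)
Definition hpoly : {poly C} := \prod_(c <- s) ('X - c%:P).

Lemma hpolyX_neq0 N : hpoly ^+ N != 0.
Proof. by rewrite expf_neq0 // monic_neq0 // monic_prod_XsubC. Qed.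

Definition regfun : {pred F} :=
  fun f => `[< exists p N, f = p%:F / (hpoly ^+ N)%:F >].

Lemma regfun_subring : subring_closed regfun.
Proof.
split.
- by apply/asboolP; exists 1, 0; rewrite expr0 !tofrac1 divr1.
- move=> f g /asboolP[p [N ->]] /asboolP[q [M ->]]; apply/asboolP.
  exists (p * hpoly ^+ M - q * hpoly ^+ N), (N + M)%N.
  have hN : (hpoly ^+ N)%:F != 0 by rewrite tofrac_eq0 hpolyX_neq0.
  have hM : (hpoly ^+ M)%:F != 0 by rewrite tofrac_eq0 hpolyX_neq0.
  have key (E : fieldType) (a b x y : E) : x != 0 -> y != 0 ->
      a / x - b / y = (a * y - b * x) / (x * y).
    by move=> x0 y0; rewrite -mulNr addf_div // mulNr.
  by rewrite (key _ _ _ _ _ hN hM) exprD tofracB !tofracM.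
- move=> f g /asboolP[p [N ->]] /asboolP[q [M ->]]; apply/asboolP.
  by exists (p * q), (N + M)%N; rewrite exprD !tofracM mulf_div.
Qed.

HB.instance Definition _ := GRing.isSubringClosed.Build F regfun regfun_subring.

Record regular := Regular { regval :> F; _ : regval \in regfun }.
HB.instance Definition _ := [isSub for regval].
HB.instance Definition _ := [Choice of regular by <:].
HB.instance Definition _ := [SubChoice_isSubComNzRing of regular by <:].

Lemma regfun_poly p : p%:F \in regfun.
Proof. by apply/asboolP; exists p, 0; rewrite expr0 tofrac1 divr1. Qed.
Definition reg_poly (p : {poly C}) : regular := Regular (regfun_poly p).

Lemma regfun_der (f : F) : f \in regfun -> frac_der (poly_der C) f \in regfun.
Proof.
move=> /asboolP[p [N ->]]; rewrite frac_der_div ?hpolyX_neq0 // -exprM.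
by apply/asboolP; eexists _, _.
Qed.

Definition reg_der_fun (f : regular) : regular := Regular (regfun_der (valP f)).
Lemma reg_der_zmod : zmod_morphism reg_der_fun.
Proof. by move=> f g; apply: val_inj; apply: frac_der_zmod. Qed.
Lemma reg_derM f g : reg_der_fun (f * g) = reg_der_fun f * g + f * reg_der_fun g.
Proof.
apply: val_inj; rewrite (rmorphD (val : regular -> F)).
rewrite !(rmorphM (val : regular -> F)) -frac_derM.
by rewrite -[RHS]/(frac_der_fun _ _) -(rmorphM (val : regular -> F)).
Qed.
Definition reg_der : derivation regular := Derivation reg_der_zmod reg_derM.

End Regular.

Notation weyl C := (diffop (poly_der C)).

Definition weyl_const (C : fieldType) (c : C) : weyl C := dop_fun (poly_der C) c%:P.
Definition weyl_x (C : fieldType) : weyl C := dop_fun (poly_der C) 'X.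
Definition weyl_d (C : fieldType) : weyl C := dop_der (poly_der C).

Definition weyl_res (C : fieldType) (s : seq C) (P : weyl C) :
    diffop (reg_der s) := map_poly (reg_poly s) P.

Section Dmodules.
Variable C : fieldType.

Definition dmod_iso (M N : lmodType (weyl C)) : Prop :=
  exists f : {linear M -> N}, bijective f.

(* [M] is finitely generated, and its dimension for the Bernstein filtration
   [B_p = span (x^a d^b, a + b <= p)] is at most 1: for some finite generating
   family [g], [dim_C (\sum_i B_p g_i)] is [O(p)]. *)
Definition holonomic (M : lmodType (weyl C)) : Prop :=
  exists (r : nat) (g : 'I_r -> M),
    (forall m, exists P : 'I_r -> weyl C, m = \sum_i P i *: g i) /\
    exists c : nat, forall p : nat, exists e : 'I_(c * p.+1) -> M,
      forall (a b : nat) (i : 'I_r), (a + b <= p)%N ->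
      exists z : 'I_(c * p.+1) -> C,
        (weyl_x C ^+ a * weyl_d C ^+ b) *: g i =
        \sum_l weyl_const (z l) *: e l.

Variable s : seq C.

(* The restriction of [M] to [U] vanishes. *)
Definition supported_on (M : lmodType (weyl C)) : Prop :=
  forall m : M, exists N, dop_fun (poly_der C) (hpoly s ^+ N) *: m = 0.

(* [V] is, through [u], the restriction to [U] of [M], that is the localisation
   of [M] at the powers of [hpoly s] (which act invertibly on [V]). *)
Definition restricts_to (M : lmodType (weyl C))
    (V : lmodType (diffop (reg_der s))) : Prop :=
  exists u : M -> V,
  [/\ forall P m1 m2, u (P *: m1 + m2) = weyl_res s P *: u m1 + u m2,
      forall m, u m = 0 ->
        exists N, dop_fun (poly_der C) (hpoly s ^+ N) *: m = 0
    & forall v, exists N m,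
        weyl_res s (dop_fun (poly_der C) (hpoly s ^+ N)) *: v = u m].

(* [M] is the minimal extension to [A^1] of the connection
   [(C(x)^n, d - A)], extended to [U] as [(O_U^n, d - AU)]. *)
Definition minimal_extension (n : nat) (A : 'M[{fraction {poly C}}]_n)
    (M : lmodType (weyl C)) : Prop :=
  [/\ holonomic M,
      exists AU : 'M[regular s]_n,
        map_mx (@regval C s) AU = A /\
        restricts_to M (connmod (reg_der s) AU),
      forall (N : lmodType (weyl C)) (f : {linear N -> M}),
        injective f -> supported_on N -> forall y : N, y = 0
    & forall (N : lmodType (weyl C)) (f : {linear M -> N}),
        (forall y, exists m, f m = y) -> supported_on N -> forall y : N, y = 0].

End Dmodules.

Section RationalForms.
Variables (C : fieldType) (n : nat).
Local Notation "p %:F" := (@FracField.tofrac _ p).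

(* As [dx] has a double pole at infinity, [A dx] has a pole of order at most
   two there when [A] is regular at infinity. *)
Definition pole_infty_le2 (A : 'M[{fraction {poly C}}]_n) : Prop :=
  forall i j, exists p q : {poly C},
    [/\ q != 0, (size p <= size q)%N & A i j = p%:F / q%:F].

Definition ratconst (c : C) : {fraction {poly C}} := (c%:P)%:F.

(* [B i j] is the coefficient of [(x - t_i)^-j], for [1 <= j <= k i]. *)
Definition partial_fractions (m : nat) (t : 'I_m -> C) (k : 'I_m -> nat)
    (A0 : 'M[C]_n) (B : 'I_m -> nat -> 'M[C]_n) : 'M[{fraction {poly C}}]_n :=
  map_mx ratconst A0 +
  \sum_(i < m) \sum_(1 <= j < (k i).+1)
    (('X - (t i)%:P)%:F ^- j) *: map_mx ratconst (B i j).

(* The embedding of [C(x)] in [C((x - c))]. *)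
Definition taylor (c : C) (p : {poly C}) : fps C :=
  Fps (fun j => (p \Po ('X + c%:P))`_j).
Definition laurent_at (c : C) (f : {fraction {poly C}}) : laurent C :=
  (taylor c \n_(repr f))%:F / (taylor c \d_(repr f))%:F.

Definition laurent_const (c : C) : laurent C := (fps_const c)%:F.
Definition laurent_x : laurent C := (fps_X C)%:F.
Definition laurent_der : derivation (laurent C) := frac_der (fps_der C).

(* [Lam] is a polynomial in the inverse of the local coordinate. *)
Definition is_normal_form (Lam : 'M[{poly C}]_n) (L : 'M[C]_n) : Prop :=
  [/\ is_diag_mx Lam, forall i j, (Lam i j)`_0 = 0
    & map_mx polyC L *m Lam = Lam *m map_mx polyC L].

Definition normal_form_mx (Lam : 'M[{poly C}]_n) (L : 'M[C]_n) :
    'M[laurent C]_n :=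
  map_mx laurent_der
    (map_mx (fun p => (map_poly laurent_const p).[laurent_x^-1]) Lam) +
  laurent_x^-1 *: map_mx laurent_const L.

(* [g^-1 \o (d - A) \o g = d - dLam - L dx/x + F dx] over [C((x - c))]. *)
Definition gauge_eq (c : C) (A : 'M[{fraction {poly C}}]_n)
    (g : 'M[fps C]_n) (Lam : 'M[{poly C}]_n) (L : 'M[C]_n)
    (F : 'M[fps C]_n) : Prop :=
  let G := map_mx (@FracField.tofrac (fps C)) g in
  forall v : 'cV[laurent C]_n,
    invmx G *m nabla laurent_der (map_mx (laurent_at c) A) (G *m v) =
    nabla laurent_der
      (normal_form_mx Lam L - map_mx (@FracField.tofrac (fps C)) F) v.

(* [Ker (L0 (L0 + k)) = Ker L0] for the restriction [L0] of [L] to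
   [Ker Lam], which [L] preserves since it commutes with [Lam]. *)
Definition nonresonant (Lam : 'M[{poly C}]_n) (L : 'M[C]_n) : Prop :=
  forall (k : int) (v : 'cV[C]_n), Lam *m map_mx polyC v = 0 ->
    (L *m ((L + k%:~R%:M) *m v) = 0 <-> L *m v = 0).

End RationalForms.

Section LocalData.
(* [B j] is the coefficient of [x^-j], for [1 <= j <= k]. *)
Variables (C : fieldType) (n k : nat) (B : nat -> 'M[C]_n).

(* [V (x) C[x]/(x^k)] is [C^(k n)], the block of index [a] being the
   coefficient of [x^a]. *)
Let kn := (\sum_(a < k) n)%N.

Definition hatA : 'M[C]_kn :=
  \mxblock_(a < k, b < k) (if (b <= a)%N then B (k - (a - b)) else 0).
Definition mul_x : 'M[C]_kn :=
  \mxblock_(a < k, b < k) (if a == b.+1 :> nat then 1%:M else 0 : 'M_n).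
Definition incl0 : 'M[C]_(kn, n) :=
  \mxcol_(a < k) (if a == 0 :> nat then 1%:M else 0 : 'M_n).
Definition coef_top : 'M[C]_(n, kn) :=
  \mxrow_(a < k) (if a.+1 == k then 1%:M else 0 : 'M_n).

(* [row_base hatA] is surjective with kernel [Ker hatA], hence realises the
   projection onto [W = C^(k n) / Ker hatA]; as
   [hatA = col_base hatA *m row_base hatA], the injection of [W] induced by
   [hatA] is [col_base hatA]. *)
Definition locW : nat := \rank hatA.
Definition locpi : 'M[C]_(locW, kn) := row_base hatA.

Lemma locpiK : locpi *m pinvmx locpi = 1%:M.
Proof. by rewrite mulmxVp // row_base_free. Qed.

Lemma ker_locpi (v : 'cV[C]_kn) : (locpi *m v == 0) = (hatA *m v == 0).
Proof.
rewrite -[in RHS](mulmx_base hatA) -mulmxA; apply/idP/idP => /eqP h.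
  by rewrite h mulmx0.
have full := col_base_full hatA.
by apply/eqP; apply: (row_full_inj full); rewrite mulmx0.
Qed.

Definition locN : 'M[C]_locW := locpi *m mul_x *m pinvmx locpi.
Definition locP : 'M[C]_(locW, n) := locpi *m incl0.
Definition locQ : 'M[C]_(n, locW) := coef_top *m col_base hatA.

End LocalData.

Section Kappa.
Variables (C : fieldType) (n m : nat).
Variables (A0 : 'M[C]_n) (t : 'I_m -> C) (k : 'I_m -> nat).
Variable B : 'I_m -> nat -> 'M[C]_n.

Definition kappa : 'M[C]_(n + \sum_(i < m) locW (k i) (B i)) :=
  block_mx A0 (\mxrow_(i < m) locQ (k i) (B i))
    (\mxcol_(i < m) locP (k i) (B i))
    (\mxdiag_(i < m) ((t i)%:M + locN (k i) (B i))).

End Kappa.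

Section Vgamma.
Variables (C : fieldType) (n w : nat) (gamma : 'M[C]_(n + w)).

Definition phi_mx : 'M[weyl C]_(n + w) :=
  block_mx ((weyl_d C)%:M + map_mx (@weyl_const C) (ulsubmx gamma))
           (map_mx (@weyl_const C) (ursubmx gamma))
           (- map_mx (@weyl_const C) (dlsubmx gamma))
           ((weyl_x C)%:M - map_mx (@weyl_const C) (drsubmx gamma)).

(* An element [\sum_j f_j (x) e_j] of [D (x) (V (+) W)] is the row [f]; its
   image [\sum_j f_j phi_mx e_j] has [i]-th coordinate
   [\sum_j f_j * phi_mx i j]. *)
Definition phi_gamma : {linear 'rV[weyl C]_(n + w) -> 'rV[weyl C]_(n + w)} :=
  mulmxr (phi_mx^T).

Definition Vgamma : lmodType (weyl C) := coker phi_gamma.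

End Vgamma.

(* Main.v *)
From HB Require Import structures.
Require Import Defs.
From mathcomp Require Import all_boot all_order all_algebra.
From mathcomp Require Import boolp reals.
From mathcomp Require Import complex.

Set Implicit Arguments.
Unset Strict Implicit.
Unset Printing Implicit Defensive.

Import GRing.Theory.
Local Open Scope ring_scope.

(** The module [V_gamma] is generated by classes [v] (for [v] in [V]) and [w]
(for [w] in [W]) with [d v = P v - S v] and [x w = T w - Q w].  Away from the
poles [x - T] is invertible, so [w = - Q (x - T)^-1 w] is redundant and the
first relation reads [d v = - A v]: the module restricts to the connection
([Vgamma_restricts]).  The generators [x^a v] and [d^b w] give the Bernstein
filtration linear growth ([Vgamma_holonomic]).  The whole content is thus that
[V_gamma] has neither torsion nor torsion quotients supported at the [t_i].

Both facts are one statement about a linear system.  A map from [V_gamma] to a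
torsion module [N] is a pair of maps [alpha : V -> N], [beta : W -> N] with
[d alpha = beta P - alpha S] and [x beta = beta T - alpha Q].  Dually, an
element killed by [x - t_i] lifts to the free module, and the witness [y] of
[(x - t_i) z = phi y] becomes, modulo the right ideal [(x - t_i) D], a
polynomial solution in [d] of the transposed system, in which [A] is replaced
by [- A^T] and [x - t_i] acts by differentiation ([symbol_vanish]).  So it
suffices to show that a solution on which some power of [X = x - t_i] vanishes
is zero ([system_vanish]), under hypotheses that hold for [A] and [- A^T].

The heart is [lower_order].  Suppose that [X^(p+1)] kills [alpha] and put
[sigma = X^p alpha].  The gauge equation enters only through polar parts:
[A g] and [g (dLam/dx + L/x)] have the same polar part at [t_i], and likewise
for the inverse transpose of [g] ([moment_normalisable]).  On the class of
[g v] in [W] one compares two computations of [X^(p+r+1) beta].  The relation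
[x beta = beta T - alpha Q] produces [sigma] of the leading polar coefficient of
[g (dLam/dx + L/x) v], of order [r + 1]; the relation for [d alpha] produces
[(p+1) sigma (g_0 v)] when [r = 0], and [0] when [r > 0], since differentiation
raises the order in [N] by one only.  Hence [sigma g_0] vanishes on the part of
[V] where [Lam] does not, and kills [(L - (p+1)) v] for [v] in [Ker Lam].
Nonresonance makes [L - (p+1)] invertible there, so [sigma = 0]; by induction
[alpha = 0], and then [beta = 0] because [W] is spanned by the [N^a P v].  The
transposed system has [- L^T] in place of [L], and needs that [L + (p+1)] is
invertible on [Ker Lam].

Minimal extensions are unique up to isomorphism ([minimal_extension_unique]):
without torsion submodules they embed in the connection on the complement of
the poles, and each of two of them is contained in the other, as the quotient
by the intersection is torsion. *)

(** * Systems at a singular point: decrease of the order *)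

(** The coefficient of [x^(-l-1)] in [dLam/dx + L/x]: the residue [L] for [l = 0],
and a diagonal matrix for [l > 0]. *)
Definition polar_coef (C : fieldType) n (L : 'M[C]_n) (mu : nat -> 'rV[C]_n)
    (l : nat) : 'M[C]_n :=
  if l is l'.+1 then diag_mx (mu l') else L.

(** [H l] stands for the coefficient of [x^(-l-1)] in a polar part.  The third
clause says that [H g] and [g (dLam/dx + L/x)] have the same polar part, for
[g = sum g_a x^a]; the last one is the consequence of nonresonance that is
needed, [L - (p+1)] being surjective on the common kernel of the diagonal parts.
It will be required of [A] and of [- A^T]. *)
Definition normalisable (C : fieldType) n (H : nat -> 'M[C]_n) : Prop :=
  exists (K : nat) (g : nat -> 'M[C]_n) (L : 'M[C]_n) (mu : nat -> 'rV[C]_n),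
  [/\ g 0%N \in unitmx,
      forall l, (K <= l)%N -> mu l = 0,
      forall s, \sum_(a < K.+1) H (s + a)%N *m g a =
                \sum_(a < K.+1) g a *m polar_coef L mu (s + a)
    & forall (p : nat) (v : 'cV[C]_n), (forall l, diag_mx (mu l) *m v = 0) ->
      exists2 u, forall l, diag_mx (mu l) *m u = 0
                & v = L *m u - p.+1%:R *: u].

Section Local.
Variables (C : fieldType) (N : lmodType C) (X D : {linear N -> N}).
Hypothesis commDX : forall z, D (X z) = X (D z) + z.

Lemma iter_lin a (c : C) y z :
  iter a X (c *: y + z) = c *: iter a X y + iter a X z.
Proof. by elim: a => //= a ->; rewrite linearP. Qed.

Lemma iter_add a y z : iter a X (y + z) = iter a X y + iter a X z.
Proof. by have := iter_lin a 1 y z; rewrite !scale1r. Qed.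

Lemma iter_0 a : iter a X 0 = 0.
Proof. by elim: a => //= a ->; rewrite linear0. Qed.

Lemma iter_opp a z : iter a X (- z) = - iter a X z.
Proof. by elim: a => //= a ->; rewrite linearN. Qed.

Lemma iter_sum a I (r : seq I) (B : pred I) (F : I -> N) :
  iter a X (\sum_(i <- r | B i) F i) = \sum_(i <- r | B i) iter a X (F i).
Proof. by elim: a => //= a ->; rewrite linear_sum. Qed.

Lemma iter_ge a b z : (a <= b)%N -> iter a X z = 0 -> iter b X z = 0.
Proof. by move=> /subnK <- h; rewrite iterD h iter_0. Qed.

(** Commuting [D] past [X^a]: in a torsion module this is what fixes the eigenvalues
of [X D] on elements of given order. *)
Lemma comm_iter a z : iter a X (D z) = D (iter a X z) - iter a.-1 X z *+ a.
Proof.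
elim: a => [|a IH] /=; first by rewrite mulr0n subr0.
rewrite IH linearB commDX linearMn mulrSr [in RHS]opprD.
rewrite -[in RHS]addrA [X in _ = _ + X]addrCA subrr addr0.
by congr (_ - _); case: a {IH}.
Qed.

Section OnePole.
Variables (n w : nat) (Nm : 'M[C]_w) (P : 'M[C]_(w, n)) (Q : 'M[C]_(n, w)).
Variables (alpha : {linear 'cV[C]_n -> N}) (beta : {linear 'cV[C]_w -> N}).
Hypothesis observable : forall y : 'cV_w, (forall a, Q *m Nm ^+ a *m y = 0) -> y = 0.
Hypothesis shift : forall y, X (beta y) = beta (Nm *m y) - alpha (Q *m y).
Hypothesis deriv_alpha : forall p, (forall v, iter p X (alpha v) = 0) ->
  forall v, iter p X (D (alpha v)) = iter p X (beta (P *m v)).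
Hypothesis nf : normalisable (fun l => Q *m Nm ^+ l *m P).

(** Unrolling [X beta = beta N - alpha Q]: once [X^(p+1)] kills [alpha], only the last
of the terms [X^(p+r-l) alpha (Q N^l y)], [l <= r], survives. *)
Lemma iter_shift p r y : (forall v, iter p.+1 X (alpha v) = 0) ->
  iter (p + r.+1) X (beta y) =
  iter p X (beta (Nm ^+ r.+1 *m y)) - iter p X (alpha (Q *m Nm ^+ r *m y)).
Proof.
move=> kill; elim: r y => [|r IH] y.
  by rewrite addn1 iterSr shift iter_add iter_opp expr1 expr0 mulmx1.
rewrite addnS iterSr shift iter_add iter_opp IH.
rewrite (@iter_ge p.+1 (p + r.+1) (alpha _)) ?kill ?addnS ?ltnS ?leq_addr //.
by rewrite subr0 !exprSr -!mulmxE !mulmxA.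
Qed.

(** The other computation of the same quantity: [X^a beta (P v)] is moved to
[X^a D alpha v], and [D] is then commuted to the left. *)
Lemma iter_beta p a v s : (forall v, iter p X (alpha v) = 0) -> (p <= s)%N ->
  iter s X (beta (Nm ^+ a *m (P *m v))) = - (iter (s + a).-1 X (alpha v) *+ (s + a)).
Proof.
move=> kill ps; have -> : iter s X (beta (Nm ^+ a *m (P *m v))) =
    iter (s + a) X (beta (P *m v)).
  elim: a s ps (P *m v) => [|a IH] s ps y; first by rewrite expr0 mul1mx addn0.
  rewrite addnS -addSn -(IH s.+1) ?leqW // iterSr shift iter_add iter_opp.
  by rewrite (iter_ge ps (kill _)) subr0 exprS mulmxA.
have pa : (p <= s + a)%N by apply: leq_trans ps (leq_addr _ _).
have key b : (p <= b)%N -> iter b X (D (alpha v)) = iter b X (beta (P *m v)).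
  by move=> /subnK <-; rewrite !iterD (deriv_alpha kill).
by rewrite -key // comm_iter (iter_ge pa) // linear0 sub0r.
Qed.

(** Comparing [iter_shift] and [iter_beta] on [w0 v], the class of [g v] in [W];
the [Q N^s w0 v] are the polar coefficients of [A g v]. *)
Lemma lower_order p : (forall v, iter p.+1 X (alpha v) = 0) ->
  forall v, iter p X (alpha v) = 0.
Proof.
move=> kill; case: nf => K [g [L [mu [g0 mu0 gH resL]]]].
(* [sig v] is the leading term of [alpha (g v)] at order [p + 1]. *)
pose sig v := iter p X (alpha (g 0%N *m v)).
have sigP c u v : sig (c *: u + v) = c *: sig u + sig v.
  by rewrite /sig mulmxDr -scalemxAr linearP iter_lin.
have sigX u a : iter (p + a.+1) X (alpha u) = 0.
  by apply: iter_ge (kill u); rewrite addnS ltnS leq_addr.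
pose w0 (v : 'cV_n) : 'cV_w := \sum_(a < K.+1) Nm ^+ a *m (P *m (g a *m v)).
have Qw0 s v : Q *m Nm ^+ s *m w0 v = \sum_(a < K.+1) g a *m polar_coef L mu (s + a) *m v.
  rewrite /w0 mulmx_sumr -mulmx_suml -gH mulmx_suml; apply: eq_bigr => a _.
  by rewrite exprD -mulmxE !mulmxA.
have main r v : (forall s, (r < s)%N -> polar_coef L mu s *m v = 0) ->
    sig (polar_coef L mu r *m v) = if r is 0 then sig v *+ p.+1 else 0.
  move=> tl; have N0 : Nm ^+ r.+1 *m w0 v = 0.
    apply: observable => a; rewrite mulmxA -(mulmxA Q) mulmxE -exprD Qw0.
    rewrite big1 // => b _; rewrite -mulmxA tl ?mulmx0 //.
    by rewrite -addnA addnCA addSn ltnS leq_addr.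
  have := iter_shift r (w0 v) kill; rewrite N0 linear0 iter_0 sub0r Qw0.
  rewrite big_ord_recl /= addn0 big1 => [|a _]; last first.
    by rewrite -mulmxA tl ?mulmx0 // addnS ltnS leq_addr.
  rewrite addr0 -mulmxA -/(sig _) => /eqP; rewrite -eqr_oppLR => /eqP <-.
  rewrite /w0 linear_sum iter_sum big_ord_recl /=.
  have ge : (p.+1 <= p + r.+1)%N by rewrite addnS ltnS leq_addr.
  rewrite (iter_beta _ _ kill ge) big1 ?addr0 => [|a _]; last first.
    rewrite (iter_beta _ _ kill ge) /bump leq0n add1n addnS /= -addnA addSn.
    by rewrite sigX mul0rn oppr0.
  rewrite opprK addn0; case: r {tl N0 ge} => [|r]; first by rewrite addn1.
  by rewrite addnS /= sigX mul0rn.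
have sig0 v : sig v = 0.
  have sig_irr (j : 'I_n) l : mu l 0 j != 0 -> sig (delta_mx j 0) = 0.
    move=> nz; have ex : exists l, mu l 0 j != 0 by exists l.
    have ub i : mu i 0 j != 0 -> (i <= K)%N.
      by apply: contraNT; rewrite -ltnNge => /ltnW /mu0 ->; rewrite mxE.
    (* The leading polar coefficient on the [j]-th basis vector. *)
    case: (ex_maxnP ex ub) => i nzi maxi.
    have dE s : diag_mx (mu s) *m delta_mx j 0 = mu s 0 j *: delta_mx j 0 :> 'cV_n.
      apply/colP => b; rewrite mul_diag_mx !mxE.
      by case: eqP => [->|]; rewrite ?mulr0.
    have := main i.+1 (delta_mx j 0); rewrite /= dE.
    have := sigP (mu i 0 j) (delta_mx j 0) 0.
    have -> : sig 0 = 0 by rewrite /sig mulmx0 linear0 iter_0.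
    rewrite !addr0 => -> h; apply: (scalerI nzi); rewrite scaler0; apply: h.
    case=> // s; rewrite ltnS => lt /=; rewrite dE.
    suff -> : mu s 0 j = 0 by rewrite scale0r.
    by apply/eqP; apply: contraTT lt => /maxi; rewrite -leqNgt.
  have sigM : {morph sig : u v / u + v}.
    by move=> u u'; have := sigP 1 u u'; rewrite !scale1r.
  have sig_ker u : (forall l, diag_mx (mu l) *m u = 0) -> sig u = 0.
    move=> /(resL p) [u' u'0 ->].
    have := main 0%N u'; rewrite /= => h.
    have := sigP (- p.+1%:R) u' (L *m u').
    rewrite h => [|[|s] //= _].
    by rewrite scaleNr [L *m u' - _]addrC -scaleNr => ->; rewrite scaleNr scaler_nat addNr.
  have sig_sum I (r : seq I) (F : I -> 'cV_n) :
      sig (\sum_(i <- r) F i) = \sum_(i <- r) sig (F i).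
    apply: (big_morph sig) => //.
    by rewrite /sig mulmx0 linear0 iter_0.
  have sigZ c u : sig (c *: u) = c *: sig u.
    by have := sigP c u 0; rewrite !addr0 => ->; rewrite /sig mulmx0 linear0 iter_0 addr0.
  have -> : v = \sum_j v j 0 *: delta_mx j 0.
    by rewrite [LHS]matrix_sum_delta; apply: eq_bigr => j _; rewrite big_ord1.
  rewrite sig_sum big1 // => j _; rewrite sigZ.
  have [[l nz]|no] := pselect (exists l, mu l 0 j != 0).
    by rewrite (sig_irr j l nz) scaler0.
  rewrite sig_ker ?scaler0 // => l; apply/colP => b; rewrite mul_diag_mx !mxE.
  case: eqP => [->|]; rewrite ?mulr0 //= mulr1.
  by apply/eqP/negPn/negP => nz; apply: no; exists l.
by move=> v; have := sig0 (invmx (g 0%N) *m v); rewrite /sig mulKVmx.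
Qed.

Lemma one_pole_vanish p : (forall v, iter p X (alpha v) = 0) ->
  forall v, alpha v = 0.
Proof. by elim: p => // p IH kill; apply: IH; apply: lower_order. Qed.

End OnePole.
End Local.

Lemma trmxX (C : fieldType) w (M : 'M[C]_w) l : (M ^+ l)^T = M^T ^+ l.
Proof.
elim: l => [|l IH]; first by rewrite !expr0 trmx1.
by rewrite exprS -mulmxE trmx_mul IH mulmxE -exprSr.
Qed.

(** Every vector is a combination of the [N^a P v], as in control theory; applied
to the transposes it says that [Q N^a y = 0] for all [a] forces [y = 0]. *)
Definition controllable (C : fieldType) n w (Nm : 'M[C]_w) (P : 'M[C]_(w, n)) :=
  forall y : 'cV[C]_w, exists (K : nat) (v : nat -> 'cV[C]_n),
    y = \sum_(a < K) Nm ^+ a *m (P *m v a).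

Lemma controllable_observable (C : fieldType) n w (Nm : 'M[C]_w)
    (Q : 'M[C]_(n, w)) :
  controllable Nm^T Q^T -> forall y : 'cV_w, (forall a, Q *m Nm ^+ a *m y = 0) -> y = 0.
Proof.
move=> ctr y Qy; apply: trmx_inj; apply/rowP => j.
have [K [v dj]] := ctr (delta_mx j 0).
have : y^T *m delta_mx j 0 = 0 :> 'M_1.
  rewrite dj mulmx_sumr big1 // => a _; apply: trmx_inj.
  rewrite !trmx_mul trmxK trmx0.
  by rewrite trmxX !trmxK -!mulmxA (mulmxA Q) Qy mulmx0.
by rewrite -colE => /matrixP/(_ 0 0); rewrite !mxE.
Qed.

Section Poles.
Variables (C : fieldType) (N : lmodType C) (X D : {linear N -> N}).
Hypothesis commDX : forall z, D (X z) = X (D z) + z.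
Variables (n m : nat) (w : 'I_m -> nat) (t : 'I_m -> C) (i : 'I_m).
Variables (S : 'M[C]_n) (Nm : forall j, 'M[C]_(w j)).
Variables (P : forall j, 'M[C]_(w j, n)) (Q : forall j, 'M[C]_(n, w j)).
Variables (alpha : {linear 'cV[C]_n -> N}).
Variables (beta : forall j, {linear 'cV[C]_(w j) -> N}).
Hypothesis t_inj : injective t.
Hypothesis nilp : forall j, exists k, Nm j ^+ k = 0.
Hypothesis ctrl : controllable (Nm i) (P i).
Hypothesis obs : controllable (Nm i)^T (Q i)^T.
Hypothesis nf : normalisable (fun l => Q i *m Nm i ^+ l *m P i).
Hypothesis shift : forall j y,
  X (beta j y) = (t j - t i) *: beta j y + beta j (Nm j *m y) - alpha (Q j *m y).
Hypothesis deriv_alpha : forall v,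
  D (alpha v) = alpha (S *m v) + \sum_j beta j (P j *m v).

(** At a pole [t j] other than [t i] the operator [x - t j] is invertible on
[(x - t i)]-torsion, so [beta j] has no larger order than [alpha] and does not
interfere with the comparison of leading terms at [t i]. *)
Lemma other_pole j p l : j != i ->
  (forall v, iter p X (alpha v) = 0) ->
  (forall y, iter l X (beta j y) = 0) -> forall y, iter p X (beta j y) = 0.
Proof.
move=> ji killa killb; have t0 : t j - t i != 0.
  by rewrite subr_eq0; apply: contraNN ji => /eqP/t_inj ->.
suff main b : (forall y, iter (p + b) X (beta j y) = 0) ->
    forall y, iter p X (beta j y) = 0.
  by apply: (main l) => y; rewrite iterD killb iter_0.
elim: b => [|b IH]; first by rewrite addn0.
move=> kill; apply: IH => y; have [k Nk] := nilp j.
have main z : iter (p + b) X (beta j (Nm j *m z)) = 0 ->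
    iter (p + b) X (beta j z) = 0.
  move=> hz; apply: (scalerI t0); rewrite scaler0.
  have := kill z; rewrite addnS iterSr shift iter_add iter_opp.
  rewrite (iter_ge (leq_addr _ _) (killa _)) subr0.
  by rewrite iter_lin hz addr0.
have: iter (p + b) X (beta j (Nm j ^+ k *m y)) = 0.
  by rewrite Nk mul0mx linear0 iter_0.
elim: k {Nk} => [|k IH]; first by rewrite expr0 mul1mx.
by rewrite exprS -mulmxE -mulmxA => /main.
Qed.

Lemma poles_vanish p : (forall v, iter p X (alpha v) = 0) ->
  (forall j y, iter p X (beta j y) = 0) ->
  (forall v, alpha v = 0) /\ (forall j y, beta j y = 0).
Proof.
move=> killa killb; have shifti y :
    X (beta i y) = beta i (Nm i *m y) - alpha (Q i *m y).
  by rewrite shift subrr scale0r add0r.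
have der q : (forall v, iter q X (alpha v) = 0) ->
    forall v, iter q X (D (alpha v)) = iter q X (beta i (P i *m v)).
  move=> kill v; rewrite deriv_alpha iter_add kill add0r (bigD1 i) //=.
  rewrite iter_add iter_sum [X in _ + X]big1 ?addr0 // => j ji.
  exact: other_pole ji kill (killb j) _.
have a0 := one_pole_vanish commDX (controllable_observable obs) shifti der nf killa.
split=> // j; have [->|ji] := eqVneq j i; last first.
  exact: (@other_pole j 0 p ji a0 (killb j)).
have P0 v : beta i (P i *m v) = 0.
  by have /= <- := der 0%N a0 v; rewrite a0 linear0.
move=> y; have [K [v ->]] := ctrl y; rewrite linear_sum big1 // => a _.
elim: (nat_of_ord a) (v _) => [|b IH] u; first by rewrite expr0 mul1mx P0.
rewrite exprS -mulmxE -mulmxA.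
by have /eqP := shifti (Nm i ^+ b *m (P i *m u));
  rewrite IH linear0 a0 subr0 => /eqP <-.
Qed.

End Poles.

(** * Systems in block form *)

Section BlockSystem.
Variables (C : fieldType) (n m : nat) (w : 'I_m -> nat) (t : 'I_m -> C).
Variables (S : 'M[C]_n) (Nm : forall j, 'M[C]_(w j)).
Variables (P : forall j, 'M[C]_(w j, n)) (Q : forall j, 'M[C]_(n, w j)).
Local Notation W := (\sum_j w j)%N.

(** The inclusion of the block of index [j]; taking it from the identity matrix
avoids casts between the types of the blocks. *)
Definition emb (j : 'I_m) : 'M[C]_(W, w j) := submxrow 1%:M j.

Lemma mxrow_emb : \mxrow_j emb j = 1%:M.
Proof. exact: submxrowK. Qed.

Lemma mxdiag_emb (Dg : forall j, 'M[C]_(w j)) j : \mxdiag_j Dg j *m emb j = emb j *m Dg j.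
Proof.
rewrite mul_submxrow mulmx1 -[X in submxrow X]mul1mx -mxrow_emb mul_mxrow_mxdiag.
exact: mxrowK.
Qed.

Lemma mxrow_mul_emb (R : forall j, 'M[C]_(n, w j)) j : \mxrow_j R j *m emb j = R j.
Proof. by rewrite mul_submxrow mulmx1 mxrowK. Qed.

Lemma mxcol_emb (R : forall j, 'M[C]_(w j, n)) : \mxcol_j R j = \sum_j emb j *m R j.
Proof. by rewrite -[LHS]mul1mx -mxrow_emb mul_mxrow_mxcol. Qed.

Variables (N : lmodType C) (X D : {linear N -> N}).
Hypothesis commDX : forall z, D (X z) = X (D z) + z.
Variables (alpha : {linear 'cV[C]_n -> N}) (beta : {linear 'cV[C]_W -> N}).
Variable (i : 'I_m).
Hypothesis t_inj : injective t.
Hypothesis nilp : forall j, exists k, Nm j ^+ k = 0.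
Hypothesis ctrl : controllable (Nm i) (P i).
Hypothesis obs : controllable (Nm i)^T (Q i)^T.
Hypothesis nf : normalisable (fun l => Q i *m Nm i ^+ l *m P i).
Hypothesis shift : forall y, X (beta y) =
  beta (\mxdiag_j ((t j)%:M + Nm j) *m y) - t i *: beta y - alpha (\mxrow_j Q j *m y).
Hypothesis deriv_alpha : forall v, D (alpha v) = alpha (S *m v) + beta (\mxcol_j P j *m v).

Lemma system_vanish p : (forall v, iter p X (alpha v) = 0) ->
  (forall y, iter p X (beta y) = 0) -> (forall v, alpha v = 0) /\ (forall y, beta y = 0).
Proof.
move=> killa killb.
pose bj (j : 'I_m) : {linear 'cV[C]_(w j) -> N} := (beta \o mulmx (emb j))%FUN.
have sh j y : X (bj j y) = (t j - t i) *: bj j y + bj j (Nm j *m y) - alpha (Q j *m y).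
  rewrite /= shift !mulmxA mxdiag_emb mxrow_mul_emb mulmxDr mulmxDl linearD /=.
  rewrite mul_mx_scalar -scalemxAl linearZ /= scalerBl; congr (_ - _).
  by rewrite addrAC.
have der v : D (alpha v) = alpha (S *m v) + \sum_j bj j (P j *m v).
  rewrite deriv_alpha mxcol_emb mulmx_suml linear_sum; congr (_ + _).
  by apply: eq_bigr => j _; rewrite /= mulmxA.
have [a0 b0] := poles_vanish commDX t_inj nilp ctrl obs nf sh der killa (fun j y => killb _).
split=> // y; rewrite -[y]mul1mx -mxrow_emb -[y]submxcolK mul_mxrow_mxcol.
rewrite linear_sum big1 // => j _.
exact: b0.
Qed.

End BlockSystem.

(** * Truncated power series realise the polar part *)

Section TruncatedSpace.
Variables (C : fieldType) (n k : nat) (B : nat -> 'M[C]_n).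

Local Notation hA := (hatA k B).
Local Notation mulx := (mul_x C n k).

(** Multiplication by [x^l], from [V] to the truncated power series. *)
Definition incl_deg (l : nat) : 'M[C]_(\sum_(a < k) n, n) :=
  \mxcol_(a < k) (if a == l :> nat then 1%:M else 0 : 'M_n).
(** The coefficient of [x^(k-1-l)]. *)
Definition coef_deg (l : nat) : 'M[C]_(n, \sum_(a < k) n) :=
  \mxrow_(a < k) (if (a + l).+1 == k then 1%:M else 0 : 'M_n).

Lemma hatA_mul_x : hA *m mulx = mulx *m hA.
Proof.
rewrite !mul_mxblock; apply: eq_mxblock => a b.
transitivity (if (b < a)%N then B (k - (a - b.+1)) else 0).
  have [lt|ge] := ltnP b.+1 k.
    rewrite (bigD1 (Ordinal lt)) //= eqxx mulmx1 big1 ?addr0 // => c /negPf ne.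
    by case: eqP => [e|]; rewrite ?mulmx0 // -val_eqE /= e eqxx in ne *.
  rewrite big1 => [|c _]; last first.
    by rewrite ltn_eqF ?mulmx0 //; apply: leq_trans ge.
  by rewrite ltnNge -ltnS (leq_trans (ltn_ord a) ge).
case: a => -[|a] lt /=.
  by rewrite big1 // => c _; rewrite mul0mx.
have lt' : (a < k)%N by apply: ltnW.
rewrite (bigD1 (Ordinal lt')) //= eqxx mul1mx big1 ?addr0 => [|c /negPf ne].
  by rewrite ltnS subSS.
rewrite eqSS; case: eqP => [e|]; rewrite ?mul0mx //.
by rewrite -val_eqE /= e eqxx in ne.
Qed.

Lemma mul_x_incl_deg l : mulx *m incl_deg l = incl_deg l.+1.
Proof.
rewrite mul_mxblock_mxrow; apply: eq_mxcol => -[[|a] lt] /=.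
  by rewrite big1 // => c _; rewrite mul0mx.
have lt' : (a < k)%N by apply: ltnW.
rewrite (bigD1 (Ordinal lt')) //= eqxx mul1mx big1 ?addr0 => [|c /negPf ne].
  by rewrite eqSS.
rewrite eqSS; case: eqP => [e|]; rewrite ?mul0mx //.
by rewrite -val_eqE /= e eqxx in ne.
Qed.

Lemma mul_xX_incl_deg l : mulx ^+ l *m incl0 C n k = incl_deg l.
Proof.
elim: l => [|l IH]; first by rewrite expr0 mul1mx.
by rewrite exprS -mulmxE -mulmxA IH mul_x_incl_deg.
Qed.

Lemma coef_deg_mul_x l : coef_deg l *m mulx = coef_deg l.+1.
Proof.
rewrite mul_mxrow_mxblock; apply: eq_mxrow => b.
have [lt|ge] := ltnP b.+1 k.
  rewrite (bigD1 (Ordinal lt)) //= eqxx mulmx1 big1 ?addr0 => [|c /negPf ne].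
    by rewrite addSnnS.
  by rewrite -val_eqE /= in ne; rewrite ne mulmx0.
rewrite big1 => [|c _]; last first.
  by rewrite [_ == b.+1]ltn_eqF ?mulmx0 //; apply: leq_trans ge.
by rewrite gtn_eqF // addnS ltnS (leq_trans ge) // -addSn leq_addr.
Qed.

Lemma coef_deg_mul_xX l : coef_top C n k *m mulx ^+ l = coef_deg l.
Proof.
elim: l => [|l IH].
  by rewrite expr0 mulmx1; apply: eq_mxrow => a; rewrite addn0.
by rewrite exprSr -mulmxE mulmxA IH coef_deg_mul_x.
Qed.

Lemma incl_deg_decomp (p : 'M[C]_(\sum_(a < k) n, 1)) :
  p = \sum_(a < k) incl_deg a *m submxcol p a.
Proof.
rewrite -[LHS]submxcolK; apply: etrans (eq_bigr _ (fun a _ => esym (mxcol_mul _ _))).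
apply: etrans (mxcol_sum _ _); apply: eq_mxcol => a.
rewrite (bigD1 a) //= eqxx mul1mx big1 ?addr0 // => b /negPf ne.
by rewrite eq_sym val_eqE ne mul0mx.
Qed.

Lemma coef_deg_decomp (q : 'rV[C]_(\sum_(a < k) n)) :
  q = \sum_(a < k) submxrow q (rev_ord a) *m coef_deg a.
Proof.
rewrite -[LHS]submxrowK; apply: etrans (eq_bigr _ (fun a _ => esym (mul_mxrow _ _))).
apply: etrans (mxrow_sum _ _); apply: eq_mxrow => a.
have e (b : 'I_k) : ((a + b).+1 == k) = (a == rev_ord b).
  rewrite -val_eqE /=; apply/eqP/eqP => [ek|->].
    by have := congr1 (subn^~ b.+1) ek; rewrite -addnS addnK.
  by rewrite -addnS subnK //; apply: ltn_ord.
rewrite (bigD1 (rev_ord a)) //= -addSn subnKC ?ltn_ord // eqxx mulmx1.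
rewrite rev_ordK big1 ?addr0 // => b ne.
rewrite e; case: eqP => [ab|]; last by rewrite mulmx0.
by rewrite ab rev_ordK eqxx in ne.
Qed.

Section Factorisation.
Variables (r : nat).
Local Notation kn := (\sum_(a < k) n)%N.
Variables (cb prj' : 'M[C]_(kn, r)) (prj cb' : 'M[C]_(r, kn)).
Hypothesis hatA_factor : cb *m prj = hA.
Hypothesis prjK : prj *m prj' = 1%:M.
Hypothesis cbK : cb' *m cb = 1%:M.
Variable lN : 'M[C]_r.
Hypothesis lNE : lN = prj *m mulx *m prj'.
Local Notation lP := (prj *m incl0 C n k).
Local Notation lQ := (coef_top C n k *m cb).

Lemma factor_inj p (Y Z : 'M_(r, p)) : cb *m Y = cb *m Z -> Y = Z.
Proof. by move/(congr1 (mulmx cb')); rewrite !mulmxA cbK !mul1mx. Qed.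

Lemma factor_surj p (Y Z : 'M_(p, r)) : Y *m prj = Z *m prj -> Y = Z.
Proof. by move/(congr1 (mulmx^~ prj')); rewrite -!mulmxA prjK !mulmx1. Qed.

(** Multiplication by [x] preserves [Ker hatA] since it commutes with [hatA]. *)
Lemma shift_proj : lN *m prj = prj *m mulx.
Proof.
rewrite lNE -[RHS]mulmx1 -[LHS]mulmxA; apply/eqP; rewrite -subr_eq0 -mulmxBr; apply/eqP.
have ker : prj *m (prj' *m prj - 1%:M) = 0.
  by rewrite mulmxBr mulmxA prjK mul1mx mulmx1 subrr.
have kerh : hA *m (prj' *m prj - 1%:M) = 0.
  by have := congr1 (mulmx cb) ker; rewrite mulmxA hatA_factor mulmx0.
apply: factor_inj.
by rewrite mulmx0 !mulmxA hatA_factor hatA_mul_x -mulmxA kerh mulmx0.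
Qed.

Lemma shiftX_proj l : lN ^+ l *m prj = prj *m mulx ^+ l.
Proof.
elim: l => [|l IH]; first by rewrite !expr0 mul1mx mulmx1.
by rewrite !exprS -!mulmxE -mulmxA IH !mulmxA shift_proj.
Qed.

Lemma emb_shiftX l : cb *m lN ^+ l = mulx ^+ l *m cb.
Proof.
suff h : cb *m lN = mulx *m cb.
  elim: l => [|l IH]; first by rewrite !expr0 mul1mx mulmx1.
  by rewrite !exprSr -!mulmxE mulmxA IH -!mulmxA h.
apply: factor_surj.
by rewrite -!mulmxA hatA_factor -hatA_mul_x [lN *m _]shift_proj mulmxA hatA_factor.
Qed.

Lemma factor_nilp : lN ^+ k = 0.
Proof.
apply: factor_surj; rewrite mul0mx shiftX_proj.
suff -> : mulx ^+ k = 0 by rewrite mulmx0.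
apply/matrixP => a b; have h p : mulx ^+ k *m p = 0 :> 'cV_ _.
  rewrite (incl_deg_decomp p) mulmx_sumr; apply: big1 => c _.
  rewrite -mul_xX_incl_deg !mulmxA mulmxE -exprD mul_xX_incl_deg.
  rewrite [incl_deg _](_ : _ = 0) ?mul0mx //.
  rewrite -[RHS](mxcol0 _ (p_ := fun=> n)); apply: eq_mxcol => d.
  by rewrite ltn_eqF // (leq_trans (ltn_ord d)) ?leq_addr.
by have := h (delta_mx b 0); rewrite -colE => /colP/(_ a); rewrite !mxE.
Qed.

Lemma shiftX_P l : lN ^+ l *m lP = prj *m incl_deg l.
Proof. by rewrite mulmxA shiftX_proj -mulmxA mul_xX_incl_deg. Qed.

Lemma Q_shiftX l : lQ *m lN ^+ l = coef_deg l *m cb.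
Proof. by rewrite -mulmxA emb_shiftX mulmxA coef_deg_mul_xX. Qed.

(** [Q N^l P v] is the coefficient of [x^(k-1)] in [hatA (x^l v)]. *)
Lemma factor_moment l : lQ *m lN ^+ l *m lP =
  if (l < k)%N then B l.+1 else 0.
Proof.
rewrite -mulmxA shiftX_P mulmxA -(mulmxA _ cb) hatA_factor -mulmxA.
rewrite mul_mxblock_mxrow mul_mxrow_mxcol.
have [lt|ge] := ltnP l k; last first.
  rewrite big1 // => a _; rewrite big1 ?mulmx0 // => b _.
  by rewrite [_ == l]ltn_eqF ?mulmx0 // (leq_trans (ltn_ord b)).
have k0 : (k.-1 < k)%N by rewrite prednK //; apply: leq_ltn_trans lt.
rewrite (bigD1 (Ordinal k0)) //= prednK ?(leq_ltn_trans _ lt) // eqxx mul1mx.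
rewrite [X in _ + X]big1 ?addr0 => [|a /negPf ne]; last first.
  case: eqP => [e|]; last by rewrite mul0mx.
  by have /= ea := congr1 predn e; rewrite -val_eqE /= ea eqxx in ne.
rewrite (bigD1 (Ordinal lt)) //= eqxx mulmx1 big1 ?addr0 => [|a /negPf ne].
  have le : (l <= k.-1)%N by rewrite -ltnS prednK //; apply: leq_ltn_trans lt.
  rewrite le; congr B; apply/eqP; rewrite -(eqn_add2r (k.-1 - l)).
  rewrite subnK ?addSn ?subnKC //; first by rewrite prednK // (leq_ltn_trans _ lt).
  by rewrite (leq_trans (leq_subr _ _)) // leq_pred.
case: eqP => [e|]; last by rewrite mulmx0.
by rewrite -val_eqE /= e eqxx in ne.
Qed.

Lemma factor_controllable : controllable lN lP.
Proof.
move=> y; pose p := prj' *m y.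
exists k, (fun a => if insub a is Some a' then submxcol p a' else 0).
rewrite -[LHS]mul1mx -prjK -mulmxA -/p {1}(incl_deg_decomp p) mulmx_sumr.
by apply: eq_bigr => a _; rewrite valK /= [RHS]mulmxA shiftX_P [LHS]mulmxA.
Qed.

Lemma factor_observable : controllable lN^T lQ^T.
Proof.
move=> y; pose q := y^T *m cb'.
exists k, (fun a => if insub a is Some a' then (submxrow q (rev_ord a'))^T else 0).
apply: trmx_inj; rewrite -[LHS]mulmx1 -cbK mulmxA -/q.
rewrite {1}(coef_deg_decomp q) mulmx_suml linear_sum; apply: eq_bigr => a _.
by rewrite valK /= !trmx_mul -trmxX !trmxK -[RHS]mulmxA Q_shiftX mulmxA.
Qed.

End Factorisation.
End TruncatedSpace.

Section LocalModel.
Variables (C : fieldType) (n k : nat) (B : nat -> 'M[C]_n).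
Local Notation hA := (hatA k B).

Let hatA_factor : col_base hA *m locpi k B = hA.
Proof. exact: mulmx_base. Qed.
Let colK : pinvmx (col_base hA) *m col_base hA = 1%:M.
Proof. exact: (mulVpmx (col_base_full hA)). Qed.
Let NE : locN k B = locpi k B *m mul_x C n k *m pinvmx (locpi k B).
Proof. by []. Qed.
Let rowK := locpiK k B.

Lemma loc_nilp : locN k B ^+ k = 0.
Proof. exact: (factor_nilp hatA_factor rowK colK NE). Qed.

Lemma loc_moment l : locQ k B *m locN k B ^+ l *m locP k B = if (l < k)%N then B l.+1 else 0.
Proof. exact: (factor_moment hatA_factor rowK colK NE l). Qed.

Lemma loc_controllable : controllable (locN k B) (locP k B).
Proof. exact: (factor_controllable hatA_factor rowK colK NE). Qed.

Lemma loc_observable : controllable (locN k B)^T (locQ k B)^T.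
Proof. exact: (factor_observable hatA_factor rowK colK NE). Qed.

End LocalModel.

(** * Power series and Laurent expansions *)

Section Series.
Local Notation "p %:F" := (@FracField.tofrac _ p).
Variable C : fieldType.
Implicit Types f g : fps C.

Lemma fps_coefD f g n : fps_coef (f + g) n = fps_coef f n + fps_coef g n.
Proof. by []. Qed.

Lemma fps_coef0 n : fps_coef (0 : fps C) n = 0.
Proof. by rewrite /= mul0rn. Qed.

Lemma fps_coef1 n : fps_coef (1 : fps C) n = (n == 0)%:R.
Proof. by []. Qed.

Lemma fps_coefM f g n :
  fps_coef (f * g) n = \sum_(i < n.+1) fps_coef f i * fps_coef g (n - i).
Proof. by []. Qed.

Lemma fps_coef_constM c g n : fps_coef (fps_const c * g) n = c * fps_coef g n.
Proof.
rewrite fps_coefM big_ord_recl /= subn0 big1 ?addr0 // => i _.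
by rewrite mulr0n mul0r.
Qed.

Lemma fps_coefXM g n :
  fps_coef (fps_X C * g) n = if n is n'.+1 then fps_coef g n' else 0.
Proof.
rewrite fps_coefM big_ord_recl /= mul0r add0r.
case: n => [|n]; first by rewrite big_ord0.
rewrite big_ord_recl /= mul1r subSS subn0 big1 ?addr0 // => i _.
by rewrite mul0r.
Qed.

Lemma fps_coefXnM d g n :
  fps_coef (fps_X C ^+ d * g) n = if (n < d)%N then 0 else fps_coef g (n - d).
Proof.
elim: d n => [|d IH] n; first by rewrite expr0 mul1r subn0.
by rewrite exprS -mulrA fps_coefXM; case: n => [|n] //; rewrite IH ltnS subSS.
Qed.

Lemma fps_const_is_rmorphism : zmod_morphism (@fps_const C) * monoid_morphism (@fps_const C).
Proof.
split; first by move=> a b; apply: fpsP => n /=; rewrite mulrnBl.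
split=> // a b; apply: fpsP => n; rewrite fps_coef_constM /=.
by rewrite mulrnAr.
Qed.
HB.instance Definition _ := GRing.isZmodMorphism.Build C (fps C) (@fps_const C)
  fps_const_is_rmorphism.1.
HB.instance Definition _ := GRing.isMonoidMorphism.Build C (fps C) (@fps_const C)
  fps_const_is_rmorphism.2.

HB.instance Definition _ := GRing.RMorphism.copy (@laurent_const C)
  (@FracField.tofrac (fps C) \o @fps_const C).

Lemma fps_X_neq0 : fps_X C != 0.
Proof.
by apply/eqP => /(congr1 (fun f => fps_coef f 1)) /eqP; rewrite /= oner_eq0.
Qed.

Lemma fps_inv_shift (a : C) : a != 0 -> exists v : fps C, (fps_X C + fps_const a) * v = 1.
Proof.
move=> a0; exists (Fps (fun n => (- a^-1) ^+ n * a^-1)); apply: fpsP => n.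
rewrite mulrDl fps_coefD fps_coefXM fps_coef_constM fps_coef1.
case: n => [|n] /=; first by rewrite expr0 mul1r mulfV // add0r.
by rewrite exprS mulNr mulrA mulrN mulrA mulfV // mul1r mulNr subrr.
Qed.

Lemma taylor_is_rmorphism (c : C) : zmod_morphism (@taylor C c) * monoid_morphism (@taylor C c).
Proof.
split; first by move=> p q; apply: fpsP => n; rewrite /= comp_polyB coefB.
split=> [|p q]; apply: fpsP => n; first by rewrite /= comp_polyC coefC; case: n.
by rewrite /= comp_polyM coefM.
Qed.
HB.instance Definition _ c := GRing.isZmodMorphism.Build {poly C} (fps C) (@taylor C c)
  (taylor_is_rmorphism c).1.
HB.instance Definition _ c := GRing.isMonoidMorphism.Build {poly C} (fps C) (@taylor C c)
  (taylor_is_rmorphism c).2.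

Lemma taylor_inj c : injective (@taylor C c).
Proof.
apply: raddf_inj => p h; have h0 : p \Po ('X + c%:P) = 0.
  by apply/polyP => n; have := congr1 (fun f => fps_coef f n) h; rewrite coef0 fps_coef0.
have := congr1 (fun q => q \Po ('X - c%:P)) h0.
by rewrite comp_poly0 -comp_polyA comp_polyD comp_polyX comp_polyC subrK comp_polyXr.
Qed.

Lemma taylorC (c a : C) : taylor c a%:P = fps_const a.
Proof. by apply: fpsP => n; rewrite /= comp_polyC coefC; case: n. Qed.

Lemma taylor_XsubC (c a : C) : taylor c ('X - a%:P) = fps_X C + fps_const (c - a).
Proof.
apply: fpsP => n; rewrite /= comp_polyB comp_polyX comp_polyC coefB coefD.
by rewrite coefX !coefC; case: n => [|n] /=; rewrite ?add0r ?addr0 ?subr0.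
Qed.

(** The expansion is defined by means of a chosen representative of the fraction;
this frees it from the choice. *)
Lemma laurent_at_rel (c : C) (f : {fraction {poly C}}) n m : m != 0 ->
  f * m%:F = n%:F -> laurent_at c f * (taylor c m)%:F = (taylor c n)%:F.
Proof.
move=> m0 fm; rewrite /laurent_at; have fE := fracE f.
set a := \n__ in fE *; set b := \d__ in fE *.
have b0 : b != 0 by apply: denom_ratioP.
have tb0 : (taylor c b)%:F != 0.
  by rewrite tofrac_eq0 -(rmorph0 (@taylor C c)) (inj_eq (@taylor_inj c)).
have e : n * b = a * m.
  apply/eqP; rewrite -tofrac_eq !tofracM -fm fE mulrAC mulfVK //.
  by rewrite tofrac_eq0.
rewrite mulrAC; apply: (mulIf tb0); rewrite mulfVK //.
by rewrite -!tofracM -!rmorphM /= e.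
Qed.

Lemma laurent_at_is_rmorphism (c : C) :
  zmod_morphism (@laurent_at C c) * monoid_morphism (@laurent_at C c).
Proof.
have t0 m : m != 0 -> (taylor c m)%:F != 0.
  by move=> m0; rewrite tofrac_eq0 -(rmorph0 (@taylor C c)) (inj_eq (@taylor_inj c)).
split.
  move=> f g; have [a [b [b0 fb]]] := frac_repr f.
  have [x [y [y0 gy]]] := frac_repr g.
  have by0 : b * y != 0 by rewrite mulf_neq0.
  have e : (f - g) * (b * y)%:F = (a * y - x * b)%:F.
    rewrite tofracM tofracB !tofracM -fb -gy mulrBl mulrA; congr (_ - _).
    by rewrite [b%:F * _]mulrC mulrA.
  apply: (mulIf (t0 _ by0)); rewrite (laurent_at_rel c by0 e).
  rewrite rmorphM rmorphB !rmorphM /= !tofracB !tofracM.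
  rewrite -(laurent_at_rel c b0 fb) -(laurent_at_rel c y0 gy) mulrBl.
  by rewrite -!mulrA [(taylor c y)%:F * _]mulrC.
split.
  have := @laurent_at_rel c 1 1 1 (oner_neq0 _) (mulr1 _).
  by rewrite !rmorph1 mulr1.
move=> f g; have [a [b [b0 fb]]] := frac_repr f.
have [x [y [y0 gy]]] := frac_repr g.
have by0 : b * y != 0 by rewrite mulf_neq0.
have e : f * g * (b * y)%:F = (a * x)%:F by rewrite !tofracM mulrACA fb gy.
apply: (mulIf (t0 _ by0)); rewrite (laurent_at_rel c by0 e).
rewrite !rmorphM /= mulrACA.
by rewrite (laurent_at_rel c b0 fb) (laurent_at_rel c y0 gy).
Qed.
HB.instance Definition _ c := GRing.isZmodMorphism.Build _ _ (@laurent_at C c)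
  (laurent_at_is_rmorphism c).1.
HB.instance Definition _ c := GRing.isMonoidMorphism.Build _ _ (@laurent_at C c)
  (laurent_at_is_rmorphism c).2.

Lemma laurent_at_tofrac (c : C) p : laurent_at c p%:F = (taylor c p)%:F.
Proof.
have := @laurent_at_rel c p%:F p 1 (oner_neq0 _).
by rewrite !rmorph1 !mulr1 => ->.
Qed.

Lemma laurent_at_ratconst (c a : C) : laurent_at c (ratconst a) = laurent_const a.
Proof. by rewrite laurent_at_tofrac taylorC. Qed.

End Series.

(** * Polar parts of matrices of Laurent series *)

Section SeriesMatrices.
Variables (C : fieldType) (n : nat).

Definition mxcoef (a : nat) (M : 'M[fps C]_n) : 'M[C]_n :=
  map_mx (fun f => fps_coef f a) M.

Lemma mxcoefD a M M' : mxcoef a (M + M') = mxcoef a M + mxcoef a M'.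
Proof. by apply/matrixP => i j; rewrite !mxE. Qed.

Lemma mxcoef_sum a I (r : seq I) (F : I -> 'M[fps C]_n) :
  mxcoef a (\sum_(i <- r) F i) = \sum_(i <- r) mxcoef a (F i).
Proof.
apply: (big_morph (mxcoef a) (mxcoefD a)); apply/matrixP => i j.
by rewrite !mxE fps_coef0.
Qed.

Lemma fps_coef_sum a I (r : seq I) (F : I -> fps C) :
  fps_coef (\sum_(i <- r) F i) a = \sum_(i <- r) fps_coef (F i) a.
Proof.
by apply: (big_morph (fun f : fps C => fps_coef f a)) => //; rewrite fps_coef0.
Qed.

Lemma mxcoefM c M M' :
  mxcoef c (M *m M') = \sum_(a < c.+1) mxcoef a M *m mxcoef (c - a) M'.
Proof.
apply/matrixP => i j; rewrite !mxE summxE fps_coef_sum.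
under eq_bigr do rewrite fps_coefM.
rewrite exchange_big; apply: eq_bigr => a _ /=; rewrite !mxE.
by apply: eq_bigr => b _; rewrite !mxE.
Qed.

Lemma mxcoefMr c M M' :
  mxcoef c (M *m M') = \sum_(a < c.+1) mxcoef (c - a) M *m mxcoef a M'.
Proof.
rewrite mxcoefM (reindex_inj rev_ord_inj) /=; apply: eq_bigr => a _.
by rewrite subSS subKn // -ltnS.
Qed.

Lemma mxcoefXn c K M : (c < K)%N -> mxcoef c (fps_X C ^+ K *: M) = 0.
Proof. by move=> lt; apply/matrixP => i j; rewrite !mxE fps_coefXnM lt. Qed.

(** [x^K] times the polar part with coefficients [H]. *)
Definition pole_series K (H : nat -> 'M[C]_n) : 'M[fps C]_n :=
  \sum_(l < K) fps_X C ^+ (K - l.+1) *: map_mx (@fps_const C) (H l).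

Lemma mxcoef_pole_series K H c : (c < K)%N -> mxcoef c (pole_series K H) = H (K - c.+1)%N.
Proof.
move=> lt; rewrite mxcoef_sum (bigD1 (rev_ord (Ordinal lt))) //= big1 ?addr0.
  apply/matrixP => i j; rewrite !mxE fps_coefXnM /=.
  have -> : (K - (K - c.+1).+1 = c)%N by rewrite -subSn // subSS subKn // ltnW.
  by rewrite ltnn subnn.
move=> l ne; apply/matrixP => i j; rewrite !mxE fps_coefXnM /=.
case: ltnP => // ge; rewrite mulrb; case: eqP => // e; case/eqP: ne.
have ce : (c = K - l.+1)%N by apply/eqP; rewrite eqn_leq -subn_eq0 e eqxx ge.
by apply: val_inj; rewrite /= ce -subSn // subSS subKn // ltnW.
Qed.

(** Reading off the coefficients of [x^0], ..., [x^(K-1)], that is the polar parts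
after division by [x^K]. *)
Lemma series_moments K H T g Y :
  (forall l, (K <= l)%N -> H l = 0) -> (forall l, (K <= l)%N -> T l = 0) ->
  pole_series K H *m g = g *m pole_series K T + fps_X C ^+ K *: Y ->
  forall s, \sum_(a < K) H (s + a)%N *m mxcoef a g =
            \sum_(a < K) mxcoef a g *m T (s + a)%N.
Proof.
move=> H0 T0 e s; have [ge|lt] := leqP K s.
  rewrite !big1 // => a _; first by rewrite T0 ?mulmx0 // (leq_trans ge) ?leq_addr.
  by rewrite H0 ?mul0mx // (leq_trans ge) ?leq_addr.
have := congr1 (mxcoef (K - s.+1)) e; rewrite mxcoefD mxcoefXn ?addr0; last first.
  by rewrite ltn_subrL //=; apply: leq_ltn_trans lt.
have cE : (K - s.+1).+1 = (K - s)%N by rewrite -subSn // subSS.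
rewrite mxcoefMr mxcoefM cE => h.
have le : (K - s <= K)%N by apply: leq_subr.
have idx a : (a < K - s)%N -> (K - s.+1 - a < K)%N /\ (K - (K - s.+1 - a).+1 = s + a)%N.
  move=> las; have h1 : (s + a < K)%N by rewrite -ltn_subRL.
  split.
    by apply: leq_ltn_trans (leq_subr _ _) _; rewrite ltn_subrL /= (leq_ltn_trans _ lt).
  by rewrite -subnDA addSn -subSn // subSS subKn // ltnW.
transitivity (\sum_(a < K - s) H (s + a)%N *m mxcoef a g).
  rewrite (big_ord_widen K (fun a => H (s + a)%N *m mxcoef a g) le) [RHS]big_mkcond.
  apply: eq_bigr => a _; case: ltnP => // ge.
  by rewrite H0 ?mul0mx // -leq_subLR.
transitivity (\sum_(a < K - s) mxcoef a g *m T (s + a)%N); last first.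
  rewrite (big_ord_widen K (fun a => mxcoef a g *m T (s + a)%N) le) big_mkcond.
  apply: eq_bigr => a _; case: ltnP => // ge.
  by rewrite T0 ?mulmx0 // -leq_subLR.
transitivity (\sum_(a < K - s) mxcoef (K - s.+1 - a) (pole_series K H) *m mxcoef a g).
  by apply: eq_bigr => a _; have [h1 h2] := idx a (ltn_ord a); rewrite mxcoef_pole_series // h2.
rewrite h; apply: eq_bigr => a _.
by have [h1 h2] := idx a (ltn_ord a); rewrite mxcoef_pole_series // h2.
Qed.

Lemma tr_pole_series K H : (pole_series K H)^T = pole_series K (fun l => (H l)^T).
Proof.
rewrite /pole_series raddf_sum /=; apply: eq_bigr => l _.
by rewrite linearZ /= map_trmx.
Qed.

Lemma opp_pole_series K H : - pole_series K H = pole_series K (fun l => - H l).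
Proof.
rewrite /pole_series -sumrN; apply: eq_bigr => l _; rewrite -scalerN.
by rewrite map_mxN.
Qed.

Lemma mxcoef0_unit g : g \in unitmx -> mxcoef 0 g \in unitmx.
Proof.
move=> gu; have := congr1 (mxcoef 0) (mulmxV gu).
rewrite mxcoefM big_ord1 subn0 => e.
have e1 : mxcoef 0 1%:M = 1%:M by apply/matrixP => i j; rewrite !mxE; case: eqP.
by move: e; rewrite e1 => /mulmx1_unit [].
Qed.

End SeriesMatrices.

Section LaurentPoles.
Local Notation "p %:F" := (@FracField.tofrac _ p).
Variables (C : fieldType) (n : nat).
Local Notation y := ((laurent_x C)^-1).

Lemma laurent_x_neq0 : laurent_x C != 0.
Proof. by rewrite tofrac_eq0 fps_X_neq0. Qed.

Definition pole_part K (H : nat -> 'M[C]_n) : 'M[laurent C]_n :=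
  \sum_(l < K) y ^+ l.+1 *: map_mx (@laurent_const C) (H l).

Lemma pole_part_series K H :
  laurent_x C ^+ K *: pole_part K H = map_mx (@FracField.tofrac _) (pole_series K H).
Proof.
rewrite scaler_sumr [RHS]raddf_sum /=; apply: eq_bigr => l _.
rewrite scalerA -{1}(subnK (ltn_ord l)) exprD -mulrA exprVn mulfV ?mulr1; last first.
  by rewrite expf_neq0 // laurent_x_neq0.
by apply/matrixP => i j; rewrite !mxE tofracM tofracXn.
Qed.

Lemma frac_der_tofrac (K : idomainType) (d : derivation K) p : frac_der d p%:F = (d p)%:F.
Proof.
have := @frac_der_div K d p 1 (oner_neq0 _).
by rewrite der1 mulr0 subr0 mulr1 expr1n tofrac1 !divr1.
Qed.

Lemma laurent_der_const (c : C) : laurent_der C (laurent_const c) = 0.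
Proof.
rewrite frac_der_tofrac -(tofrac0 (fps C)); congr (_%:F); apply: fpsP => l.
by rewrite /= mul0rn mul0rn.
Qed.

Lemma laurent_der_x : laurent_der C (laurent_x C) = 1.
Proof.
rewrite frac_der_tofrac -(tofrac1 (fps C)); congr (_%:F); apply: fpsP => l /=.
by case: l => [|l] /=; rewrite ?mul0rn.
Qed.

Lemma laurent_der_yX l : laurent_der C (y ^+ l) = - (y ^+ l.+1 *+ l).
Proof.
have dy : laurent_der C y = - y ^+ 2.
  have := congr1 (laurent_der C) (mulVf laurent_x_neq0).
  rewrite derM laurent_der_x mulr1 der1 => /eqP; rewrite addr_eq0 => /eqP e.
  by apply: (mulIf laurent_x_neq0); rewrite e expr2 mulNr mulfVK // laurent_x_neq0.
elim: l => [|l IH]; first by rewrite expr0 der1 mulr0n oppr0.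
rewrite exprS derM IH dy mulrN mulrnAr -exprS mulNr -exprD add2n.
by rewrite -opprD -mulrS.
Qed.

End LaurentPoles.

(** * Consequences of nonresonance *)

Section Resolvent.
Variables (C : fieldType) (n : nat).
Hypothesis char0 : forall p, p.+1%:R != 0 :> C.

Lemma inj_unitmx (M : 'M[C]_n) : (forall v : 'cV_n, M *m v = 0 -> v = 0) -> M \in unitmx.
Proof.
move=> inj; rewrite -unitmx_tr -row_free_unit; apply: inj_row_free => v h.
by apply: trmx_inj; rewrite trmx0; apply: inj; apply: trmx_inj; rewrite trmx_mul trmxK trmx0.
Qed.

Variables (Lam : 'M[{poly C}]_n) (L : 'M[C]_n).
Hypothesis nfL : is_normal_form Lam L.
Hypothesis nonres : nonresonant Lam L.

(** The coefficients of [x^(-l-2)] in [dLam/dx]. *)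
Definition irr_coef (l : nat) : 'rV[C]_n := \row_j (- ((Lam j j)`_l.+1 *+ l.+1)).

Let zero_row : 'rV[C]_n := \row_j `[< forall l, irr_coef l 0 j = 0 >]%:R.
Let proj := diag_mx zero_row.

Let proj_tr : proj^T = proj. Proof. exact: tr_diag_mx. Qed.

Lemma irr_coef_eq0 j l : (irr_coef l 0 j == 0) = ((Lam j j)`_l.+1 == 0).
Proof.
by rewrite mxE oppr_eq0 -mulr_natr mulf_eq0 (negPf (char0 l)) orbF.
Qed.

Lemma proj_ker (v : 'cV[C]_n) : (forall l, diag_mx (irr_coef l) *m v = 0) <-> proj *m v = v.
Proof.
split=> [h|<- l]; apply/colP => j; rewrite !mul_diag_mx !mxE.
  case: asboolP => [_|no]; first by rewrite mul1r.
  rewrite mul0r; have [l nz] : exists l, irr_coef l 0 j != 0.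
    by apply: contrapT => all; apply: no => l; apply/eqP/negPn/negP => nz; apply: all; exists l.
  have := h l => /colP/(_ j); rewrite mul_diag_mx !mxE => /eqP.
  by rewrite mulf_eq0 => /orP[/eqP e|/eqP ->//]; rewrite mxE e eqxx in nz.
by case: asboolP => [/(_ l)|_]; rewrite ?mul0r ?mulr0 // mxE => ->; rewrite mul0r.
Qed.

(** As [L] commutes with [Lam], it has no entries between indices with different
diagonal entries of [Lam]. *)
Lemma proj_comm : L *m proj = proj *m L.
Proof.
case: nfL => diag Lam0 comm; apply/matrixP => i j.
rewrite mul_mx_diag mul_diag_mx !mxE.
have [->|nz] := eqVneq (L i j) 0; first by rewrite mul0r mulr0.
have := congr1 (fun M : 'M_n => M i j) comm; rewrite !mxE.
rewrite (bigD1 j) //= big1 ?addr0 => [|l lj]; last first.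
  by rewrite (is_diag_mxP diag) ?mulr0.
rewrite (bigD1 i) //= big1 ?addr0 => [|l li]; last first.
  by rewrite (is_diag_mxP diag) ?mul0r // eq_sym.
rewrite !mxE mulrC => /mulIf e; rewrite mulrC; congr (_ * _).
have eij : Lam j j = Lam i i by apply: e; rewrite polyC_eq0.
congr (nat_of_bool _)%:R; apply: asbool_equiv_eq; by split=> h l; have := h l; rewrite !mxE eij.
Qed.

(** [L proj] vanishes off [Ker Lam], so there the difference is the scalar [- c];
on [Ker Lam] an eigenvector of [L] for a nonzero integer would contradict
nonresonance. *)
Lemma shifted_unit (c : int) : c%:~R != 0 :> C ->
  L *m proj - c%:~R%:M \in unitmx.
Proof.
move=> cn0; apply: inj_unitmx => v /eqP; rewrite mulmxBl subr_eq0 mul_scalar_mx => /eqP Lv.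
have pp : proj *m proj = proj.
  apply/matrixP => i j; rewrite mul_diag_mx !mxE; case: asboolP => _; rewrite ?mul1r ?mul0r //.
  by rewrite mul0rn.
have pv : proj *m v = v.
  apply: (scalerI cn0); rewrite scalemxAr -Lv mulmxA (mulmxA proj) -proj_comm.
  by rewrite -(mulmxA L) pp.
have Lamv : Lam *m map_mx polyC v = 0.
  case: nfL => diag Lam0 _; apply/colP => i.
  rewrite !mxE (bigD1 i) //= big1 => [|j ji]; last first.
    by rewrite (is_diag_mxP diag) ?mul0r // eq_sym.
  rewrite addr0 !mxE; have /colP/(_ i) := pv; rewrite mul_diag_mx !mxE.
  case: asboolP => [h _|_]; last by rewrite mul0r => <-; rewrite polyC0 mulr0.
  suff -> : Lam i i = 0 by rewrite mul0r.
  apply/polyP => -[|l]; rewrite coef0 //; apply/eqP.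
  by rewrite -irr_coef_eq0 h.
have [h _] := nonres (- c) Lamv.
have Lv' : L *m v = c%:~R *: v by rewrite -Lv -mulmxA pv.
apply: (scalerI cn0); rewrite scaler0 -Lv'; apply: h.
by rewrite mulmxDl Lv' mul_scalar_mx -scalerDl rmorphN subrr scale0r mulmx0.
Qed.

Lemma resolvent (L' : 'M[C]_n) p : L' *m proj = proj *m L' ->
  L' *m proj - p.+1%:R%:M \in unitmx ->
  forall v, (forall l, diag_mx (irr_coef l) *m v = 0) ->
  exists2 u : 'cV_n, forall l, diag_mx (irr_coef l) *m u = 0 & v = L' *m u - p.+1%:R *: u.
Proof.
set M := _ - _ => comm Mu v /proj_ker pv.
have pM : proj *m M = M *m proj.
  by rewrite /M mulmxBr mulmxBl scalar_mxC mulmxA -comm.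
have pu : proj *m (invmx M *m v) = invmx M *m v.
  rewrite -{2}pv !mulmxA; congr (_ *m v).
  apply: (can_inj (mulKmx Mu)); rewrite !mulmxA -pM mulmxV // mul1mx -mulmxA.
  by rewrite mulmxV // mulmx1.
exists (invmx M *m v); first by apply/proj_ker.
by rewrite -[LHS](mulKVmx Mu) {1}/M mulmxBl -(mulmxA L') pu mul_scalar_mx.
Qed.

(** The two signs of the shift serve the connection and its dual, whose residue
is [- L^T]. *)
Lemma resolvents p :
  (forall v, (forall l, diag_mx (irr_coef l) *m v = 0) ->
  exists2 u : 'cV_n, forall l, diag_mx (irr_coef l) *m u = 0 & v = L *m u - p.+1%:R *: u) /\
  (forall v, (forall l, diag_mx (irr_coef l) *m v = 0) ->
  exists2 u : 'cV_n, forall l, diag_mx (irr_coef l) *m u = 0 & v = - L^T *m u - p.+1%:R *: u).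
Proof.
split; apply: resolvent.
- exact: proj_comm.
- by have := @shifted_unit p.+1 (char0 p).
- by rewrite mulNmx mulmxN -proj_tr -!trmx_mul proj_comm.
- have := @shifted_unit (- p.+1%:Z); rewrite rmorphN /= oppr_eq0 => /(_ (char0 p)).
  rewrite -unitmx_tr linearB /= trmx_mul tr_scalar_mx proj_tr.
  rewrite -(@unitmxZ _ _ (-1)) ?unitrN1 // scaleN1r opprB rmorphN /=.
  rewrite -[proj *m _](_ : L^T *m proj = _) ?mulNmx 1?addrC //.
  by rewrite -proj_tr -!trmx_mul proj_comm.
Qed.

End Resolvent.

(** * Polar parts under a gauge transformation *)

Lemma derD (K : comNzRingType) (d : derivation K) a b : d (a + b) = d a + d b.
Proof. exact: raddfD. Qed.

Lemma der_sum (K : comNzRingType) (d : derivation K) I (r : seq I) (F : I -> K) :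
  d (\sum_(i <- r) F i) = \sum_(i <- r) d (F i).
Proof. exact: raddf_sum. Qed.

Section PolarParts.
Local Notation "p %:F" := (@FracField.tofrac _ p).
Variables (C : fieldType) (n : nat).

Definition regular_at0 (M : 'M[laurent C]_n) : Prop :=
  exists R : 'M[fps C]_n, M = map_mx (@FracField.tofrac _) R.

Lemma regular_at0_sum I (r : seq I) (P : pred I) F :
  (forall i, P i -> regular_at0 (F i)) -> regular_at0 (\sum_(i <- r | P i) F i).
Proof.
move=> h; apply: big_ind => //; first by exists 0; rewrite raddf0.
by move=> _ _ [R ->] [S ->]; exists (R + S); rewrite raddfD.
Qed.

Section Poles.
Variables (m : nat) (t : 'I_m -> C) (k : 'I_m -> nat).
Variables (A0 : 'M[C]_n) (B : 'I_m -> nat -> 'M[C]_n).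
Hypothesis t_inj : injective t.

Definition moment (j : 'I_m) (l : nat) : 'M[C]_n := if (l < k j)%N then B j l.+1 else 0.

(** The terms at the other poles are regular since [x + t_i - t_j] is a unit. *)
Lemma laurent_partial_fractions i K : (k i <= K)%N -> exists R : 'M[fps C]_n,
  map_mx (laurent_at (t i)) (partial_fractions t k A0 B) =
  pole_part K (moment i) + map_mx (@FracField.tofrac _) R.
Proof.
move=> kK; have mc j M : map_mx (laurent_at (t j)) (map_mx (@ratconst C) M) =
    map_mx (@laurent_const C) M :> 'M_n.
  by apply/matrixP => a b; rewrite !mxE laurent_at_ratconst.
have mcF M : map_mx (@laurent_const C) M =
    map_mx (@FracField.tofrac _) (map_mx (@fps_const C) M) :> 'M_n.
  by apply/matrixP => a b; rewrite !mxE.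
have [j|R ER] := @regular_at0_sum _ (index_enum 'I_m) (fun j => j != i)
   (fun j => map_mx (laurent_at (t i)) (\sum_(1 <= l < (k j).+1)
    (('X - (t j)%:P)%:F ^- l) *: map_mx (@ratconst C) (B j l))).
  move=> ji; rewrite raddf_sum; apply: regular_at0_sum => l _ /=.
  have [|v vE] := @fps_inv_shift C (t i - t j).
    by rewrite subr_eq0; apply: contraNN ji => /eqP/t_inj ->.
  exists (v ^+ l *: map_mx (@fps_const C) (B j l)).
  rewrite !map_mxZ mc mcF; congr (_ *: _).
  rewrite fmorphV rmorphXn /= laurent_at_tofrac taylor_XsubC rmorphXn -exprVn.
  congr (_ ^+ _); apply: (@mulfI _ (fps_X C + fps_const (t i - t j))%:F).
    rewrite tofrac_eq0; apply/eqP => e; move/eqP: vE.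
    by rewrite e mul0r eq_sym oner_eq0.
  rewrite -tofracM vE mulfV ?tofrac1 // tofrac_eq0; apply/eqP => e; move/eqP: vE.
  by rewrite e mul0r eq_sym oner_eq0.
exists (map_mx (@fps_const C) A0 + R).
rewrite /partial_fractions raddfD /= mc mcF [in RHS]raddfD /= addrCA; congr (_ + _).
rewrite -ER raddf_sum (bigD1 i) //=; congr (_ + _).
rewrite big_add1 /= big_mkord raddf_sum /pole_part.
rewrite (big_ord_widen K (fun l => map_mx (laurent_at (t i)) (('X - (t i)%:P)%:F ^- l.+1 *:
  map_mx (@ratconst C) (B i l.+1)))) // big_mkcond /=.
apply: eq_bigr => l _; rewrite /moment; case: ifP => _; last first.
  rewrite [map_mx _ 0](_ : _ = 0) ?scaler0 //.
  by apply/matrixP => a b; rewrite !mxE; apply: rmorph0.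
rewrite map_mxZ mc; congr (_ *: _); rewrite fmorphV rmorphXn /= laurent_at_tofrac.
by rewrite taylor_XsubC subrr rmorph0 addr0 exprVn.
Qed.

End Poles.

Lemma normal_form_pole_part (Lam : 'M[{poly C}]_n) L K :
  is_normal_form Lam L -> (forall j, size (Lam j j) <= K.+1)%N ->
  normal_form_mx Lam L = pole_part K.+1 (polar_coef L (irr_coef Lam)).
Proof.
move=> [diag Lam0 _] sz; rewrite /normal_form_mx /pole_part big_ord_recl addrC /= expr1.
congr (_ + _); apply/matrixP => i j; rewrite !mxE summxE.
set y := _^-1.
have hE (p : {poly C}) : (size p <= K.+1)%N -> (map_poly (@laurent_const C) p).[y] =
    \sum_(l < K.+1) laurent_const p`_l * y ^+ l.
  move=> le; rewrite (@horner_coef_wide _ K.+1); last first.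
    by apply: leq_trans le; rewrite /map_poly; apply: size_poly.
  by apply: eq_bigr => l _; rewrite coef_map_id0 //; apply: rmorph0.
have szij : (size (Lam i j) <= K.+1)%N.
  have [->|ij] := eqVneq i j; first exact: sz.
  by rewrite (is_diag_mxP diag) // size_poly0.
have dE (c : nat -> C) : laurent_der C (\sum_(l < K.+1) laurent_const (c l) * y ^+ l) =
    \sum_(l < K) laurent_const (c l.+1) * - (y ^+ l.+2 *+ l.+1).
  rewrite big_ord_recl expr0 mulr1 derD laurent_der_const add0r der_sum.
  by apply: eq_bigr => l _; rewrite derM laurent_der_const mul0r add0r laurent_der_yX.
rewrite hE // -[X in X = _]/(laurent_der C _) dE.
apply: eq_bigr => l _; rewrite !mxE /bump leq0n add1n add0n.
rewrite [RHS]mulrC; have [->|ij] := eqVneq i j.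
  by rewrite mulr1n rmorphN rmorphMn /= mulNr mulrN mulrnAl mulrnAr.
by rewrite (is_diag_mxP diag) // coef0 mulr0n !rmorph0 !mul0r.
Qed.

End PolarParts.

Lemma gauge_matrix (E : fieldType) (d : derivation E) n (A G T : 'M[E]_n) :
  G \in unitmx ->
  (forall v, invmx G *m nabla d A (G *m v) = nabla d T v) ->
  A *m G = map_mx d G + G *m T.
Proof.
move=> Gu h; apply/matrixP => a j.
have := congr1 (mulmx G) (h (delta_mx j 0)); rewrite mulKVmx //.
have d0 : map_mx d (delta_mx j 0) = 0 :> 'cV_n.
  by apply/colP => b; rewrite !mxE; case: (b == j); rewrite /= ?der1 ?raddf0.
rewrite /nabla d0 sub0r mulmxN !mulmxA -!colE => /colP/(_ a).
rewrite !mxE => /eqP; rewrite subr_eq => /eqP ->.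
by rewrite addrAC addNr add0r.
Qed.

Section Gauge.
Variables (C : fieldType) (n : nat).
Hypothesis char0 : forall p, p.+1%:R != 0 :> C.
Variables (m : nat) (t : 'I_m -> C) (k : 'I_m -> nat).
Variables (A0 : 'M[C]_n) (B : 'I_m -> nat -> 'M[C]_n).
Hypothesis t_inj : injective t.
Variables (i : 'I_m) (g : 'M[fps C]_n) (Lam : 'M[{poly C}]_n) (L : 'M[C]_n).
Hypothesis g_unit : g \in unitmx.
Hypothesis nfL : is_normal_form Lam L.
Hypothesis gauge : exists F, gauge_eq (t i) (partial_fractions t k A0 B) g Lam L F.
Local Notation H := (moment k B i).
Local Notation T := (polar_coef L (irr_coef Lam)).
Local Notation tf := (map_mx (@FracField.tofrac (fps C))).

(** The terms [dg/dx], [g F] and the part of [A] regular at [t_i] only contribute to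
the regular remainder [Y]. *)
Lemma gauge_series K : (k i <= K.+1)%N -> (forall j, size (Lam j j) <= K.+1)%N ->
  exists Y, pole_series K.+1 H *m g = g *m pole_series K.+1 T + fps_X C ^+ K.+1 *: Y.
Proof.
move=> kK sz; have [F gF] := gauge.
have Gu : tf g \in unitmx.
  have : tf g *m tf (invmx g) = 1%:M by rewrite -map_mxM mulmxV // map_mx1.
  by move=> /mulmx1_unit[Gu _]; exact: Gu.
have := gauge_matrix Gu gF.
have [R ->] := @laurent_partial_fractions C n m t k A0 B t_inj i _ kK.
rewrite (normal_form_pole_part nfL sz) => e.
have dtf : map_mx (laurent_der C) (tf g) = tf (map_mx (fps_der C) g).
  by apply/matrixP => a b; rewrite !mxE; apply: frac_der_tofrac.
exists (map_mx (fps_der C) g - g *m F - R *m g).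
have tf_inj : injective (fun M : 'M[fps C]_n => tf M).
  move=> M M' /matrixP eM; apply/matrixP => a b; have /eqP := eM a b.
  by rewrite !mxE tofrac_eq => /eqP.
apply: tf_inj; rewrite map_mxM [in RHS]map_mxD map_mxM -!pole_part_series.
have -> : map_mx (@FracField.tofrac _)
      (fps_X C ^+ K.+1 *: (map_mx (fps_der C) g - g *m F - R *m g)) =
   laurent_x C ^+ K.+1 *: (tf (map_mx (fps_der C) g) - tf g *m tf F - tf R *m tf g).
  by rewrite map_mxZ /= tofracXn !map_mxB !map_mxM.
move: e; rewrite dtf mulmxBr mulmxDl => /(canRL (addrK _)) e.
rewrite -scalemxAl -scalemxAr -scalerDr e; congr (_ *: _).
by rewrite [X in X - _]addrCA -addrA.
Qed.

(** The dual statement follows by multiplying the identity of [gauge_series] by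
the inverse of [g] on both sides and transposing. *)
Lemma moment_normalisable : nonresonant Lam L ->
  normalisable H /\ normalisable (fun l => - (H l)^T).
Proof.
move=> nonres.
(* Any bound for all pole orders involved will do. *)
pose K := maxn (k i) (\max_j size (Lam j j)).
have kK : (k i <= K)%N by apply: leq_maxl.
have szK j : (size (Lam j j) <= K)%N.
  by apply: leq_trans (leq_maxr _ _); apply: (leq_bigmax j).
have H0 l : (K.+1 <= l)%N -> H l = 0.
  by move=> Kl; rewrite /moment ltnNge (leq_trans kK) // ltnW.
have mu0 l : (K <= l)%N -> irr_coef Lam l = 0.
  move=> Kl; apply/rowP => j; rewrite !mxE nth_default ?mul0rn ?oppr0 //.
  by rewrite (leq_trans (szK j)) // leqW.
have T0 l : (K.+1 <= l)%N -> T l = 0.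
  by case: l => // l Kl /=; rewrite mu0 // raddf0.
have [Y e] := gauge_series (leqW kK) (fun j => leqW (szK j)).
have res p := resolvents char0 nfL nonres p.
split.
  exists K, (fun a => mxcoef a g), L, (irr_coef Lam); split=> //.
  - exact: mxcoef0_unit.
  - exact: (series_moments H0 T0 e).
  - by move=> p; have [] := res p.
pose h := invmx g.
have e' : pole_series K.+1 (fun l => - (H l)^T) *m h^T =
    h^T *m pole_series K.+1 (fun l => - (T l)^T) + fps_X C ^+ K.+1 *: - (h *m Y *m h)^T.
  have E1 : h *m pole_series K.+1 H =
      pole_series K.+1 T *m h + fps_X C ^+ K.+1 *: (h *m Y *m h).
    have := congr1 (fun M => h *m M *m h) e.
    rewrite /= mulmxDr mulmxDl -scalemxAr -scalemxAl !mulmxA.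
    by rewrite mulVmx // mul1mx -mulmxA mulmxV // mulmx1.
  rewrite -!opp_pole_series -!tr_pole_series mulNmx mulmxN -!trmx_mul E1.
  by rewrite linearD linearZ /= opprD scalerN.
exists K, (fun a => mxcoef a h^T), (- L^T), (fun l => - irr_coef Lam l); split.
- by apply: mxcoef0_unit; rewrite unitmx_tr unitmx_inv.
- by move=> l Kl; rewrite mu0 ?oppr0.
- have TE l : - (T l)^T = polar_coef (- L^T) (fun l => - irr_coef Lam l) l.
    by case: l => [|l] //=; rewrite tr_diag_mx raddfN.
  have H0' l : (K.+1 <= l)%N -> - (H l)^T = 0 by move=> Kl; rewrite H0 // trmx0 oppr0.
  have T0' l : (K.+1 <= l)%N -> - (T l)^T = 0 by move=> Kl; rewrite T0 // trmx0 oppr0.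
  by move=> s; rewrite (series_moments H0' T0' e'); apply: eq_bigr => a _; rewrite TE.
- move=> p v v0; have [_] := res p; case/(_ v) => [l|u u0 ->].
    by have := v0 l; rewrite raddfN mulNmx => /eqP; rewrite oppr_eq0 => /eqP.
  by exists u => // l; rewrite raddfN mulNmx u0 oppr0.
Qed.

End Gauge.

(** * Ore extensions and the Weyl algebra *)

Section Ore.
Variables (K : comNzRingType) (d : derivation K).
Implicit Types (P Q : diffop d) (a b : K).

Lemma dop_fun_mul a P : dop_fun d a * P = (a *: (P : {poly K}) : {poly K}).
Proof.
rewrite [LHS](@dact_widen _ _ (dleft d) 1) ?size_polyC_leq1 // big_ord1 /=.
by rewrite coefC.
Qed.

Lemma dop_fun_is_rmorphism : zmod_morphism (dop_fun d) * monoid_morphism (dop_fun d).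
Proof.
split; first by move=> a b; apply: polyCB.
by split=> // a b; rewrite [RHS]dop_fun_mul -mul_polyC -polyCM.
Qed.
HB.instance Definition _ := GRing.isZmodMorphism.Build K (diffop d) (dop_fun d)
  dop_fun_is_rmorphism.1.
HB.instance Definition _ := GRing.isMonoidMorphism.Build K (diffop d) (dop_fun d)
  dop_fun_is_rmorphism.2.

Lemma dop_der_mul P : dop_der d * P = dleft d P.
Proof.
rewrite [LHS](@dact_widen _ _ (dleft d) 2) ?size_polyX // big_ord_recr big_ord1 /=.
by rewrite !coefX /= scale0r add0r scale1r.
Qed.

Lemma dop_der_fun a : dop_der d * dop_fun d a = dop_fun d a * dop_der d + dop_fun d (d a).
Proof.
rewrite dop_der_mul dop_fun_mul /dleft -mul_polyC; congr (_ + _).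
by apply/polyP => i; rewrite coef_map !coefC; case: eqP => _ //=; rewrite raddf0.
Qed.

Lemma dop_derX i : dop_der d ^+ i = 'X^i :> {poly K}.
Proof.
elim: i => [|i IH]; first by rewrite !expr0.
rewrite exprS dop_der_mul IH /dleft -exprSr [map_poly _ _](_ : _ = 0) ?addr0 //.
by apply/polyP => l; rewrite coef_map coefXn coef0; case: eqP => _ /=; rewrite ?der1 ?raddf0.
Qed.

Lemma diffop_expand P :
  P = \sum_(i < size (P : {poly K})) dop_fun d (P : {poly K})`_i * dop_der d ^+ i.
Proof.
rewrite -[LHS](@coefK K) poly_def; apply: eq_bigr => i _.
by rewrite dop_fun_mul dop_derX.
Qed.

Lemma diffop_ind (S : diffop d -> Prop) :
  (forall P Q, S P -> S Q -> S (P + Q)) ->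
  (forall a, S (dop_fun d a)) -> (forall a i, S (dop_fun d a * dop_der d ^+ i)) ->
  forall P, S P.
Proof.
move=> SD Sa Si P; rewrite (diffop_expand P); apply: big_ind => //.
by have := Sa 0; rewrite raddf0.
Qed.

Lemma connmod_fun n (A : 'M[K]_n) a (v : connmod d A) :
  dop_fun d a *: v = a *: (v : 'cV[K]_n) :> 'cV[K]_n.
Proof.
rewrite [LHS](@dact_widen _ _ (nabla d A) 1) ?size_polyC_leq1 // big_ord1 /=.
by rewrite coefC.
Qed.

Lemma connmod_der n (A : 'M[K]_n) (v : connmod d A) :
  dop_der d *: v = nabla d A v :> 'cV[K]_n.
Proof.
rewrite [LHS](@dact_widen _ _ (nabla d A) 2) ?size_polyX // big_ord_recr big_ord1 /=.
by rewrite !coefX /= scale0r add0r scale1r.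
Qed.

End Ore.

Section Weyl.
Variable C : fieldType.
Local Notation pf := (dop_fun (poly_der C)).
Local Notation x := (weyl_x C).
Local Notation dd := (weyl_d C).
Local Notation cst := (@weyl_const C).

Lemma weyl_const_is_rmorphism : zmod_morphism cst * monoid_morphism cst.
Proof.
split; first by move=> a b; rewrite /weyl_const !raddfB.
by split=> [|a b]; rewrite /weyl_const ?rmorph1 // !rmorphM.
Qed.
HB.instance Definition _ := GRing.isZmodMorphism.Build C (weyl C) cst
  weyl_const_is_rmorphism.1.
HB.instance Definition _ := GRing.isMonoidMorphism.Build C (weyl C) cst
  weyl_const_is_rmorphism.2.

Lemma weyl_comm : dd * x = x * dd + 1.
Proof. by rewrite dop_der_fun /= derivX rmorph1. Qed.

Lemma weyl_const_comm c P : cst c * P = P * cst c.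
Proof.
have cd : dd * cst c = cst c * dd by rewrite dop_der_fun /= derivC raddf0 addr0.
have cp p : pf p * cst c = cst c * pf p by rewrite /weyl_const -!rmorphM mulrC.
have cX i : dd ^+ i * cst c = cst c * dd ^+ i.
  elim: i => [|i IH]; first by rewrite expr0 mul1r mulr1.
  by rewrite exprS -mulrA IH !mulrA cd.
elim/diffop_ind: P => [P Q hP hQ|a|a i].
- by rewrite mulrDl mulrDr hP hQ.
- by rewrite cp.
- by rewrite -mulrA cX !mulrA cp.
Qed.

Lemma weyl_derX_x i : dd ^+ i * x = x * dd ^+ i + dd ^+ i.-1 *+ i.
Proof.
elim: i => [|i IH]; first by rewrite !expr0 mul1r mulr1 mulr0n addr0.
have e : dd * (x * dd ^+ i) = x * dd ^+ i.+1 + dd ^+ i.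
  by rewrite mulrA weyl_comm mulrDl mul1r -mulrA -exprS.
rewrite exprS -mulrA IH mulrDr e -addrA mulrnAr -exprS mulrS.
by congr (_ + (_ + _)); case: i {IH e} => [|i] //=; rewrite -exprS.
Qed.

Lemma weyl_fun_cancel p P Q : p != 0 -> pf p * P = pf p * Q -> P = Q.
Proof.
move=> p0; rewrite !dop_fun_mul => /polyP e; apply/polyP => i.
by have := e i; rewrite !coefZ => /(mulfI p0).
Qed.

(** The class of [P] modulo the right ideal generated by [x - c], as a polynomial in
the derivation.  On it the derivation acts from the right by multiplication and
[x] acts by [c] plus differentiation ([symbol_der], [symbol_x]). *)
Definition symbol_at (c : C) (P : weyl C) : {poly C} :=
  map_poly (fun p : {poly C} => p.[c]) P.

Section Symbol.
Variable c : C.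
Local Notation rho := (symbol_at c).

Lemma coef_symbol P i : (rho P)`_i = ((P : {poly {poly C}})`_i).[c].
Proof. by rewrite coef_map_id0 // horner0. Qed.

Lemma symbolD P Q : rho (P + Q) = rho P + rho Q.
Proof. by apply/polyP => i; rewrite coefD !coef_symbol coefD hornerD. Qed.

Lemma symbolN P : rho (- P) = - rho P.
Proof. by apply/polyP => i; rewrite coefN !coef_symbol coefN hornerN. Qed.

Lemma symbol0 : rho 0 = 0.
Proof. by apply/polyP => i; rewrite coef_symbol !coef0 horner0. Qed.

Lemma symbol_sum I (r : seq I) (F : I -> weyl C) :
  rho (\sum_(i <- r) F i) = \sum_(i <- r) rho (F i).
Proof. exact: (big_morph rho symbolD symbol0). Qed.

Lemma symbol_term p i : rho (pf p * dd ^+ i) = p.[c] *: 'X^i.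
Proof.
apply/polyP => l; rewrite coef_symbol dop_fun_mul dop_derX !coefZ !coefXn.
by case: eqP => _; rewrite ?mulr1 ?mulr0 ?horner0.
Qed.

Lemma symbol_der P : rho (P * dd) = rho P * 'X.
Proof.
elim/diffop_ind: P => [P Q hP hQ|a|a i]; first by rewrite mulrDl !symbolD mulrDl hP hQ.
  have := symbol_term a 0; have := symbol_term a 1.
  by rewrite !expr1 !expr0 mulr1 => -> ->; rewrite -scalerAl mul1r.
by rewrite -mulrA -exprSr !symbol_term exprSr scalerAl.
Qed.

Lemma symbol_const a P : rho (P * cst a) = a *: rho P.
Proof.
rewrite -weyl_const_comm dop_fun_mul; apply/polyP => i.
by rewrite coefZ !coef_symbol coefZ hornerM hornerC.
Qed.

Lemma symbol_x P : rho (P * x) = c *: rho P + (rho P)^`().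
Proof.
have main a i : rho (pf a * dd ^+ i * x) =
    c *: rho (pf a * dd ^+ i) + (rho (pf a * dd ^+ i))^`().
  rewrite -mulrA weyl_derX_x mulrDr mulrA -rmorphM symbolD mulrnAr -mulrnAl -rmorphMn.
  rewrite !symbol_term hornerMn hornerM hornerX derivZ derivXn.
  by rewrite -scalerMnl -scalerMnr scalerA [c * _]mulrC.
elim/diffop_ind: P => [P Q hP hQ|a|a i]; last exact: main.
  by rewrite mulrDl !symbolD derivD scalerDr addrACA hP hQ.
by have := main a 0%N; rewrite expr0 mulr1.
Qed.

Lemma symbol_factor P : rho P = 0 -> exists Q, P = pf ('X - c%:P) * Q.
Proof.
move=> h; exists (map_poly (fun p : {poly C} => p %/ ('X - c%:P)) P).
rewrite dop_fun_mul; apply/polyP => i; rewrite coefZ coef_map_id0 ?div0p // mulrC divpK //.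
by rewrite dvdp_XsubCl /root -coef_symbol h coef0.
Qed.

Lemma symbol_XsubC P : rho (pf ('X - c%:P) * P) = 0.
Proof.
apply/polyP => i; rewrite coef_symbol dop_fun_mul coefZ hornerM.
by rewrite hornerXsubC subrr mul0r coef0.
Qed.

End Symbol.

Section Restriction.
Variable s : seq C.

Lemma reg_poly_is_rmorphism :
  zmod_morphism (@reg_poly C s) * monoid_morphism (@reg_poly C s).
Proof.
split; first by move=> p q; apply: val_inj; rewrite /= rmorphB.
split; first by apply: val_inj; rewrite /= rmorph1.
by move=> p q; apply: val_inj; rewrite /= rmorphM.
Qed.
HB.instance Definition _ := GRing.isZmodMorphism.Build {poly C} (regular s)
  (@reg_poly C s) reg_poly_is_rmorphism.1.
HB.instance Definition _ := GRing.isMonoidMorphism.Build {poly C} (regular s)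
  (@reg_poly C s) reg_poly_is_rmorphism.2.

Lemma reg_poly_inj : injective (@reg_poly C s).
Proof. by move=> p q /(congr1 val) /= /eqP; rewrite tofrac_eq => /eqP. Qed.

Lemma reg_poly_der p : reg_der_fun (reg_poly s p) = reg_poly s p^`().
Proof.
apply: val_inj; rewrite /=.
have := @frac_der_rel _ (poly_der C) (@FracField.tofrac _ p) p 1 (oner_neq0 _).
by rewrite rmorph1 !mulr1 der1 rmorph0 mulr0 subr0 => ->.
Qed.

Lemma weyl_res_is_rmorphism : zmod_morphism (@weyl_res C s) * monoid_morphism (@weyl_res C s).
Proof.
split; first by move=> P Q; apply: raddfB.
split; first exact: (rmorph1 (map_poly (@reg_poly C s))).
move=> P Q; have szP : (size (map_poly (reg_poly s) P) <= size (P : {poly {poly C}}))%N.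
  exact: size_poly.
rewrite [RHS](dact_widen _ _ szP) [LHS](raddf_sum (map_poly (reg_poly s))).
apply: eq_bigr => i _; apply: etrans (map_polyZ _ _ _) _; rewrite coef_map; congr (_ *: _).
elim: (nat_of_ord i) => //= j <-; rewrite /dleft rmorphD rmorphM /= map_polyX.
congr (_ + _); apply/polyP => l; rewrite !coef_map /=.
by rewrite coef_map_id0 ?coef_map /= ?reg_poly_der //; apply: (raddf0 (reg_der s)).
Qed.
HB.instance Definition _ := GRing.isZmodMorphism.Build (weyl C) (diffop (reg_der s))
  (@weyl_res C s) weyl_res_is_rmorphism.1.
HB.instance Definition _ := GRing.isMonoidMorphism.Build (weyl C) (diffop (reg_der s))
  (@weyl_res C s) weyl_res_is_rmorphism.2.

Lemma weyl_res_fun p : weyl_res s (pf p) = dop_fun (reg_der s) (reg_poly s p).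
Proof. exact: map_polyC. Qed.

Lemma weyl_res_der : weyl_res s dd = dop_der (reg_der s).
Proof. exact: map_polyX. Qed.

End Restriction.
End Weyl.

(** * The generators of the module *)

Section OverC.
Variables (C : fieldType) (M : lmodType (weyl C)).

Definition overC : Type := M.
HB.instance Definition _ := GRing.Zmodule.on overC.

Definition overC_scale (a : C) (z : overC) : overC := weyl_const a *: (z : M).

Lemma overC_scaleA a b z : overC_scale a (overC_scale b z) = overC_scale (a * b) z.
Proof. by rewrite /overC_scale scalerA rmorphM. Qed.
Lemma overC_scale1 : left_id 1 overC_scale.
Proof. by move=> z; rewrite /overC_scale rmorph1 scale1r. Qed.
Lemma overC_scaleDr : right_distributive overC_scale +%R.
Proof. by move=> a y z; apply: scalerDr. Qed.
Lemma overC_scaleDl z : {morph overC_scale^~ z : a b / a + b}.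
Proof. by move=> a b; rewrite /overC_scale raddfD /= scalerDl. Qed.
HB.instance Definition _ := GRing.Zmodule_isLmodule.Build C overC
  overC_scaleA overC_scale1 overC_scaleDr overC_scaleDl.

Lemma overC_scaleE (a : C) (z : overC) : a *: z = weyl_const a *: (z : M).
Proof. by []. Qed.

Definition weyl_act (P : weyl C) (z : overC) : overC := P *: (z : M).

Lemma weyl_act_linear P : linear (weyl_act P).
Proof.
move=> a y z; rewrite /weyl_act scalerDr !overC_scaleE !scalerA.
by rewrite weyl_const_comm.
Qed.
HB.instance Definition _ P := GRing.isLinear.Build C overC overC _ (weyl_act P)
  (weyl_act_linear P).

End OverC.

Section Generators.
Variables (C : fieldType) (n w : nat).
Variables (S : 'M[C]_n) (Q : 'M[C]_(n, w)) (P : 'M[C]_(w, n)) (T : 'M[C]_w).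
Local Notation V := (Vgamma (block_mx S Q P T)).
Local Notation cpi := (coker_pi (phi_gamma (block_mx S Q P T))).
Local Notation cst := (@weyl_const C).
Local Notation pf := (dop_fun (poly_der C)).
Local Notation x := (weyl_x C).
Local Notation dd := (weyl_d C).

Definition gen (y : 'cV[C]_(n + w)) : V := cpi (map_mx cst y^T).
Definition genV (v : 'cV[C]_n) : V := gen (col_mx v 0).
Definition genW (y : 'cV[C]_w) : V := gen (col_mx 0 y).

Lemma gen_linear a y z : gen (a *: y + z) = cst a *: gen y + gen z.
Proof.
rewrite /gen -linearP /=; apply: (congr1 cpi); apply/rowP => j; rewrite !mxE.
by rewrite rmorphD rmorphM.
Qed.

Lemma genV_linear a v u : genV (a *: v + u) = cst a *: genV v + genV u.
Proof. by rewrite -gen_linear scale_col_mx add_col_mx scaler0 addr0. Qed.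

Lemma genW_linear a v u : genW (a *: v + u) = cst a *: genW v + genW u.
Proof. by rewrite -gen_linear scale_col_mx add_col_mx scaler0 addr0. Qed.

Lemma gen_split v y : gen (col_mx v y) = genV v + genW y.
Proof.
by rewrite -[genV v]scale1r -(rmorph1 cst) -gen_linear scale1r add_col_mx addr0 add0r.
Qed.

Lemma gen_span (f : 'rV[weyl C]_(n + w)) :
  cpi f = \sum_j f 0 j *: gen (delta_mx j 0).
Proof.
rewrite {1}[f]row_sum_delta linear_sum; apply: eq_bigr => j _.
rewrite linearZ /=; congr (_ *: _); apply: (congr1 cpi); apply/rowP => l; rewrite !mxE.
by rewrite !eqxx andbT; case: (l == j); rewrite ?rmorph1 ?rmorph0.
Qed.

Lemma row_mul_scalar p (u : 'rV[C]_p) (D : weyl C) :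
  map_mx cst u *m D%:M = D *: map_mx cst u.
Proof.
apply/rowP => j; rewrite !mxE (bigD1 j) //= big1 ?addr0 => [|l /negPf lj].
  by rewrite !mxE eqxx mulr1n weyl_const_comm.
by rewrite !mxE lj mulr0.
Qed.

(** Constant rows suffice to know the relations: they generate the free module. *)
Lemma phi_row v y : phi_gamma (block_mx S Q P T) (map_mx cst (col_mx v y)^T) =
  row_mx (dd *: map_mx cst v^T + map_mx cst (S *m v)^T + map_mx cst (Q *m y)^T)
    (- map_mx cst (P *m v)^T + (x *: map_mx cst y^T - map_mx cst (T *m y)^T)).
Proof.
rewrite /phi_gamma /= /phi_mx block_mxKul block_mxKur block_mxKdl block_mxKdr.
rewrite tr_block_mx tr_col_mx map_row_mx mul_row_block !linearD /= !linearN /= !tr_scalar_mx.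
by rewrite !mulmxDr !mulmxN !row_mul_scalar !map_trmx -!map_mxM /= -!trmx_mul.
Qed.

Lemma gen_relation v y :
  dd *: genV v + genV (S *m v) + genV (Q *m y) - genW (P *m v)
    + x *: genW y - genW (T *m y) = 0.
Proof.
transitivity (cpi
   (phi_gamma (block_mx S Q P T) (map_mx cst (col_mx v y)^T))); last first.
  rewrite -[RHS](linear0 (cpi)).
  by apply/eqP/coker_piP; exists (map_mx cst (col_mx v y)^T); rewrite subr0.
rewrite phi_row; transitivity (cpi (
    dd *: map_mx cst (col_mx v 0)^T + map_mx cst (col_mx (S *m v) 0)^T +
    map_mx cst (col_mx (Q *m y) 0)^T - map_mx cst (col_mx 0 (P *m v))^T +
    x *: map_mx cst (col_mx 0 y)^T - map_mx cst (col_mx 0 (T *m y))^T)).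
  by rewrite linearB linearD linearB linearD linearD !linearZ.
apply: (congr1 cpi).
rewrite !tr_col_mx !trmx0 !map_row_mx !map_mx0 !scale_row_mx !scaler0.
rewrite !opp_row_mx !add_row_mx !oppr0 !addr0 !add0r; congr row_mx.
by rewrite addrA.
Qed.

Lemma genV0 : genV 0 = 0.
Proof.
by have := genV_linear (-1) 0 0; rewrite !scaler0 rmorphN rmorph1 scaleN1r addr0 addNr.
Qed.

Lemma genW0 : genW 0 = 0.
Proof.
by have := genW_linear (-1) 0 0; rewrite !scaler0 rmorphN rmorph1 scaleN1r addr0 addNr.
Qed.

Lemma genVN v : genV (- v) = - genV v.
Proof.
have := genV_linear (-1) v 0.
by rewrite rmorphN rmorph1 !scaleN1r !addr0 genV0 addr0.
Qed.

Lemma gen_der v : dd *: genV v = genW (P *m v) - genV (S *m v).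
Proof.
have := gen_relation v 0; rewrite !mulmx0 genV0 genW0 scaler0 !addr0 subr0.
by move/eqP; rewrite subr_eq0 => /eqP <-; rewrite addrK.
Qed.

Lemma gen_x y : x *: genW y = genW (T *m y) - genV (Q *m y).
Proof.
have := gen_relation 0 y; rewrite !mulmx0 genV0 genW0 scaler0 !add0r subr0.
by move/eqP; rewrite subr_eq0 => /eqP <-; rewrite addrAC subrr add0r.
Qed.

End Generators.

(** * Absence of torsion *)

Section PolynomialSystem.
Variables (C : fieldType).

(** With differentiation as multiplication by [x], this operator plays the role of
the derivation in a module of delta functions. *)
Definition neg_mulX (p : {poly C}) : {poly C} := - (p * 'X).
Lemma neg_mulX_linear : linear neg_mulX.
Proof. by move=> a p q; rewrite /neg_mulX mulrDl opprD -scalerAl scalerN. Qed.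
HB.instance Definition _ := GRing.isLinear.Build C {poly C} {poly C} _ neg_mulX
  neg_mulX_linear.

Lemma neg_mulX_deriv p : neg_mulX (deriv p) = deriv (neg_mulX p) + p.
Proof. by rewrite /neg_mulX derivN derivM derivX mulr1 opprD subrK. Qed.

Definition lincomb n (a : 'I_n -> {poly C}) (v : 'cV[C]_n) : {poly C} :=
  \sum_l v l 0 *: a l.
Lemma lincomb_linear n a : linear (@lincomb n a).
Proof.
move=> c u v; rewrite /lincomb scaler_sumr -big_split /=; apply: eq_bigr => l _.
by rewrite !mxE scalerDl scalerA.
Qed.
HB.instance Definition _ n a := GRing.isLinear.Build C 'cV[C]_n {poly C} _ (@lincomb n a)
  (lincomb_linear a).

Lemma lincomb_delta n (a : 'I_n -> {poly C}) j : lincomb a (delta_mx j 0) = a j.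
Proof.
rewrite /lincomb (bigD1 j) //= mxE !eqxx scale1r big1 ?addr0 // => l /negPf lj.
by rewrite mxE lj scale0r.
Qed.

Lemma lincomb_mul n p (a : 'I_n -> {poly C}) (M : 'M[C]_(n, p)) v :
  lincomb a (M *m v) = \sum_j v j 0 *: \sum_l M l j *: a l.
Proof.
rewrite /lincomb; under eq_bigr do rewrite mxE scaler_suml.
rewrite exchange_big; apply: eq_bigr => j _ /=; rewrite scaler_sumr.
by apply: eq_bigr => l _; rewrite scalerA mulrC.
Qed.

Lemma lincomb_mul_tr n p (a : 'I_n -> {poly C}) (M : 'M[C]_(p, n)) v :
  lincomb a (M^T *m v) = \sum_j v j 0 *: \sum_l M j l *: a l.
Proof.
rewrite lincomb_mul; apply: eq_bigr => j _; congr (_ *: _).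
by apply: eq_bigr => l _; rewrite mxE.
Qed.

Lemma lincomb_size n (a : 'I_n -> {poly C}) v : (size (lincomb a v) <= \max_l size (a l))%N.
Proof.
apply: leq_trans (size_sum _ _ _) _; apply/bigmax_leqP => l _.
by apply: leq_trans (size_scale_leq _ _) _; apply: (leq_bigmax l).
Qed.

End PolynomialSystem.

Section Torsion.
Variables (C : fieldType) (n m : nat) (w : 'I_m -> nat) (t : 'I_m -> C).
Variables (S : 'M[C]_n) (Nm : forall j, 'M[C]_(w j)).
Variables (P : forall j, 'M[C]_(w j, n)) (Q : forall j, 'M[C]_(n, w j)).
Local Notation W := (\sum_j w j)%N.
Local Notation Tm := (\mxdiag_j ((t j)%:M + Nm j)).
Local Notation gamma := (block_mx S (\mxrow_j Q j) (\mxcol_j P j) Tm).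
Local Notation pf := (dop_fun (poly_der C)).
Local Notation cst := (@weyl_const C).
Hypothesis t_inj : injective t.
Hypothesis nilp : forall j, exists k, Nm j ^+ k = 0.
Hypothesis ctrl : forall j, controllable (Nm j) (P j).
Hypothesis obs : forall j, controllable (Nm j)^T (Q j)^T.
Hypothesis nf' : forall i, normalisable (fun l => - (Q i *m Nm i ^+ l *m P i)^T).

Lemma symbol_row r p c (y : 'rV[weyl C]_r) (M : 'M[C]_(p, r)) j :
  symbol_at c ((y *m (map_mx cst M)^T) 0 j) = \sum_l M j l *: symbol_at c (y 0 l).
Proof.
rewrite mxE symbol_sum; apply: eq_bigr => l _.
by rewrite !mxE symbol_const.
Qed.

Lemma row_scalar r (y : 'rV[weyl C]_r) (D : weyl C) j : (y *m D%:M) 0 j = y 0 j * D.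
Proof.
rewrite mxE (bigD1 j) //= mxE eqxx mulr1n big1 ?addr0 // => l /negPf lj.
by rewrite mxE lj mulr0.
Qed.

Lemma rowD r (y z : 'rV[weyl C]_r) j : (y + z) 0 j = y 0 j + z 0 j.
Proof. by rewrite mxE. Qed.

Lemma rowN r (y : 'rV[weyl C]_r) j : (- y) 0 j = - y 0 j.
Proof. by rewrite mxE. Qed.

(** Symbols of a relation vector whose image is divisible by [x - t_i] solve the
transposed system, and differentiation is locally nilpotent on polynomials. *)
Lemma symbol_vanish i (y : 'rV[weyl C]_(n + W)) :
  (forall j, symbol_at (t i) (phi_gamma gamma y 0 j) = 0) ->
  forall j, symbol_at (t i) (y 0 j) = 0.
Proof.
set rho := symbol_at (t i); move=> h.
pose yl := lsubmx y; pose yr := rsubmx y.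
have yE : y = row_mx yl yr by rewrite hsubmxK.
have phiE : phi_gamma gamma y =
  row_mx (yl *m (weyl_d C)%:M + yl *m (map_mx cst S)^T + yr *m (map_mx cst (\mxrow_j Q j))^T)
   (- (yl *m (map_mx cst (\mxcol_j P j))^T) + (yr *m (weyl_x C)%:M - yr *m (map_mx cst Tm)^T)).
  rewrite yE /phi_gamma /= /phi_mx block_mxKul block_mxKur block_mxKdl block_mxKdr.
  rewrite tr_block_mx mul_row_block !linearD /= !linearN /= !tr_scalar_mx.
  by rewrite !mulmxDr !mulmxN.
pose a j := rho (yl 0 j); pose c j := rho (yr 0 j).
(* The two halves of the relation, read at [t i]. *)
have ha j : a j * 'X + \sum_l S j l *: a l + \sum_l (\mxrow_j Q j) j l *: c l = 0.
  have := h (lshift W j); rewrite phiE row_mxEl.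
  by rewrite !rowD /rho !symbolD row_scalar symbol_der !symbol_row.
have hc j : (c j)^`() = \sum_l Tm j l *: c l - t i *: c j + \sum_l (\mxcol_j P j) j l *: a l.
  have := h (rshift n j); rewrite phiE row_mxEr !(rowD, rowN).
  rewrite /rho !(symbolD, symbolN) row_scalar symbol_x !symbol_row -/rho.
  rewrite -/(c j); set A := \sum_l _; set B := \sum_l _.
  rewrite addrC => /eqP; rewrite subr_eq0 => /eqP e.
  by rewrite -e !addrA subrK addrAC subrr add0r.
have S' v : neg_mulX (lincomb a v) = lincomb a (S^T *m v) + lincomb c (\mxcol_j (Q j)^T *m v).
  rewrite -tr_mxrow !lincomb_mul_tr /neg_mulX /lincomb mulr_suml -sumrN -big_split /=.
  apply: eq_bigr => j _; rewrite -scalerAl -scalerN -scalerDr; congr (_ *: _).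
  by apply/eqP; rewrite eq_sym -subr_eq0 opprK -[X in _ == X](ha j) addrC addrA.
have T' y0 : deriv (lincomb c y0) = lincomb c (\mxdiag_j ((t j)%:M + (Nm j)^T) *m y0) -
    t i *: lincomb c y0 - lincomb a (\mxrow_j (- (P j)^T) *m y0).
  have -> : \mxrow_j (- (P j)^T) = - (\mxcol_j P j)^T by rewrite mxrowN tr_mxcol.
  have -> : \mxdiag_j ((t j)%:M + (Nm j)^T) = Tm^T.
    by rewrite tr_mxdiag; apply: eq_mxdiag => j; rewrite linearD /= tr_scalar_mx.
  rewrite mulNmx linearN opprK /= !lincomb_mul_tr /lincomb raddf_sum scaler_sumr.
  rewrite -sumrB -big_split /=.
  by apply: eq_bigr => j _; rewrite derivZ hc !scalerDr scalerN !scalerA [t i * _]mulrC.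
have ctrl' : controllable (Nm i)^T (Q i)^T := @obs i.
have obs' : controllable ((Nm i)^T)^T (- (P i)^T)^T.
  move=> y0; have [K [v ->]] := @ctrl i y0; exists K, (fun b => - v b).
  have PE : (- (P i)^T)^T = - P i by rewrite linearN /= trmxK.
  by apply: eq_bigr => b _; rewrite PE trmxK mulNmx !mulmxN opprK.
have nilp' j : exists k, (Nm j)^T ^+ k = 0.
  by have [k Nk] := nilp j; exists k; rewrite -trmxX Nk trmx0.
have nf : normalisable (fun l => - (P i)^T *m (Nm i)^T ^+ l *m (Q i)^T).
  suff -> : (fun l => - (P i)^T *m (Nm i)^T ^+ l *m (Q i)^T) =
    (fun l => - (Q i *m Nm i ^+ l *m P i)^T) by [].
  by apply/funext => l; rewrite !trmx_mul -trmxX !mulNmx mulmxA.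
pose d := maxn (\max_l size (a l)) (\max_l size (c l)).
have killa v : iter d (@deriv C) (lincomb a v) = 0.
  exact: derivn_poly0 (leq_trans (lincomb_size a v) (leq_maxl _ _)).
have killc v : iter d (@deriv C) (lincomb c v) = 0.
  exact: derivn_poly0 (leq_trans (lincomb_size c v) (leq_maxr _ _)).
have [a0 c0] := @system_vanish C n m (fun j => w j) t S^T (fun j => (Nm j)^T)
  (fun j => (Q j)^T) (fun j => - (P j)^T) {poly C} (@deriv C) (@neg_mulX C)
  (@neg_mulX_deriv C) (lincomb a) (lincomb c) i t_inj nilp' ctrl' obs' nf T' S' d
  killa killc.
move=> j; rewrite yE; case: (split_ordP j) => l ->.
  by rewrite row_mxEl; have /= := a0 (delta_mx l 0); rewrite lincomb_delta.
by rewrite row_mxEr; have /= := c0 (delta_mx l 0); rewrite lincomb_delta.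
Qed.

(** Write [(x - t_i) z = phi y].  By [symbol_vanish] also [y] is divisible by
[x - t_i], and cancelling that factor shows that [z] is in the image of [phi]. *)
Lemma Vgamma_torsion_free1 i (z : Vgamma gamma) : pf ('X - (t i)%:P) *: z = 0 -> z = 0.
Proof.
elim/coker_piW: z => z h.
have [y e] : exists y, pf ('X - (t i)%:P) *: z = phi_gamma gamma y.
  have /eqP/coker_piP[y] : coker_pi (phi_gamma gamma) (pf ('X - (t i)%:P) *: z) =
      coker_pi (phi_gamma gamma) 0 by rewrite linearZ linear0 -h.
  by rewrite subr0 => e; exists y.
have [j|q qE] := @choice _ _ (fun j q => y 0 j = pf ('X - (t i)%:P) * q).
  apply: (symbol_factor (c := t i)); apply: symbol_vanish => l.
  by rewrite -e mxE symbol_XsubC.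
have yE : y = pf ('X - (t i)%:P) *: \row_j q j.
  by apply/rowP => j; rewrite qE !mxE.
have ze : z = phi_gamma gamma (\row_j q j).
  apply/rowP => j; apply: (@weyl_fun_cancel _ ('X - (t i)%:P)); first by rewrite polyXsubC_eq0.
  have : pf ('X - (t i)%:P) *: z = pf ('X - (t i)%:P) *: phi_gamma gamma (\row_j q j).
    by rewrite e {1}yE linearZ.
  by move/rowP/(_ j); rewrite !mxE.
rewrite -[RHS](linear0 (coker_pi (phi_gamma gamma))).
by apply/eqP/coker_piP; exists (\row_j q j); rewrite subr0.
Qed.

Lemma Vgamma_torsion_free N (z : Vgamma gamma) : pf (hpoly (codom t) ^+ N) *: z = 0 -> z = 0.
Proof.
elim: N => [|N IH]; first by rewrite expr0 rmorph1 scale1r.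
rewrite exprS rmorphM -scalerA => h; apply: IH; move: (pf (_ ^+ N) *: z) h => y.
rewrite /hpoly /codom /image_mem big_map; elim: (enum 'I_m) => [|j r IH].
  by rewrite big_nil rmorph1 scale1r.
by rewrite big_cons rmorphM -scalerA => /Vgamma_torsion_free1/IH.
Qed.

End Torsion.

(** * Absence of torsion quotients *)

Section Quotient.
Variables (C : fieldType) (n m : nat) (w : 'I_m -> nat) (t : 'I_m -> C).
Variables (S : 'M[C]_n) (Nm : forall j, 'M[C]_(w j)).
Variables (P : forall j, 'M[C]_(w j, n)) (Q : forall j, 'M[C]_(n, w j)).
Local Notation W := (\sum_j w j)%N.
Local Notation Tm := (\mxdiag_j ((t j)%:M + Nm j)).
Local Notation gamma := (block_mx S (\mxrow_j Q j) (\mxcol_j P j) Tm).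
Local Notation pf := (dop_fun (poly_der C)).
Local Notation cst := (@weyl_const C).
Local Notation genV := (@genV C n W S (\mxrow_j Q j) (\mxcol_j P j) Tm).
Local Notation genW := (@genW C n W S (\mxrow_j Q j) (\mxcol_j P j) Tm).
Local Notation gen := (@gen C n W S (\mxrow_j Q j) (\mxcol_j P j) Tm).
Hypothesis t_inj : injective t.
Hypothesis nilp : forall j, exists k, Nm j ^+ k = 0.
Hypothesis ctrl : forall j, controllable (Nm j) (P j).
Hypothesis obs : forall j, controllable (Nm j)^T (Q j)^T.
Hypothesis nf : forall i, normalisable (fun l => Q i *m Nm i ^+ l *m P i).
Variables (N : lmodType (weyl C)) (f : {linear Vgamma gamma -> N}).

Lemma weyl_act_iter (q : {poly C}) p (z : overC N) :
  iter p (weyl_act (pf q)) z = pf (q ^+ p) *: (z : N).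
Proof.
elim: p => [|p IH]; first by rewrite expr0 rmorph1 scale1r.
by rewrite /= IH exprS rmorphM -scalerA.
Qed.

Lemma pf_comm p q : pf p * pf q = pf q * pf p.
Proof. by rewrite -!rmorphM mulrC. Qed.

Section Twist.
Variable e : {poly C}.
Definition twistV (v : 'cV[C]_n) : overC N := pf e *: f (genV v).
Definition twistW (y : 'cV[C]_W) : overC N := pf e *: f (genW y).
Lemma twistV_linear : linear twistV.
Proof.
move=> a u v; rewrite /twistV genV_linear linearP scalerDr overC_scaleE !scalerA.
by rewrite weyl_const_comm.
Qed.
Lemma twistW_linear : linear twistW.
Proof.
move=> a u v; rewrite /twistW genW_linear linearP scalerDr overC_scaleE !scalerA.
by rewrite weyl_const_comm.
Qed.
HB.instance Definition _ := GRing.isLinear.Build C 'cV[C]_n (overC N) _ twistV twistV_linear.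
HB.instance Definition _ := GRing.isLinear.Build C 'cV[C]_W (overC N) _ twistW twistW_linear.
End Twist.

(** When the derivative of [e] kills the image of the generators, [v |-> e f(v)] and
[w |-> e f(w)] satisfy the same relations as [f] does; when [e] moreover maps
that image into [(x - t_i)]-torsion, only the pole [t_i] is left. *)
Lemma quotient_local i e p :
  (forall y, pf (('X - (t i)%:P) ^+ p * e) *: f (gen y) = 0) ->
  (forall y, pf e^`() *: f (gen y) = 0) ->
  forall y, pf e *: f (gen y) = 0.
Proof.
move=> kill killd.
pose X := (@weyl_act _ N (pf ('X - (t i)%:P)) : {linear overC N -> overC N}).
pose D := (@weyl_act _ N (weyl_d C) : {linear overC N -> overC N}).
have cDX z : D (X z) = X (D z) + z.
  rewrite /D /X /= /weyl_act !scalerA dop_der_fun /= derivXsubC rmorph1.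
  by rewrite scalerDl scale1r.
have sh y : X (twistW e y) =
    twistW e (Tm *m y) - t i *: twistW e y - twistV e (\mxrow_j Q j *m y).
  rewrite /X /= /weyl_act /twistW /twistV scalerA pf_comm -scalerA rmorphB scalerBl.
  have fx : weyl_x C *: f (genW y) = f (genW (Tm *m y)) - f (genV (\mxrow_j Q j *m y)).
    by rewrite -linearB -gen_x linearZ.
  rewrite /= -[pf 'X]/(weyl_x C) -[pf _%:P]/(cst (t i)) fx !scalerBr overC_scaleE.
  by rewrite addrAC !scalerA weyl_const_comm.
have der v : D (twistV e v) = twistV e (- S *m v) + twistW e (\mxcol_j P j *m v).
  have fd : weyl_d C *: f (genV v) = f (genV (- S *m v)) + f (genW (\mxcol_j P j *m v)).
    rewrite -linearZ gen_der linearB addrC; congr (_ + _).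
    by rewrite mulNmx genVN linearN.
  rewrite /D /= /weyl_act /twistV /twistW scalerA dop_der_fun /= scalerDl killd addr0.
  by rewrite -scalerA fd scalerDr.
have nilX y : iter p X (pf e *: f (gen y) : overC N) = 0.
  by rewrite weyl_act_iter scalerA -rmorphM kill.
have [a0 b0] := @system_vanish C n m w t (- S) Nm P Q (overC N) X D cDX
  (twistV e) (twistW e) i t_inj nilp (@ctrl i) (@obs i) (@nf i) sh der p
  (fun v => nilX (col_mx v 0)) (fun y => nilX (col_mx 0 y)).
move=> y; rewrite -[y]vsubmxK gen_split linearD scalerDr.
have /= := a0 (usubmx y); have /= := b0 (dsubmx y); rewrite /twistV /twistW => -> ->.
by rewrite addr0.
Qed.

Lemma kill_dvd p q (z : N) : p %| q -> pf p *: z = 0 -> pf q *: z = 0.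
Proof.
by move=> /dvdpP[r ->] h; rewrite rmorphM -scalerA h scaler0.
Qed.

(** The poles are removed one at a time, by means of a polynomial [e] that is [1]
modulo a power of [x - t_i] and [0] modulo a power of the other factors. *)
Lemma quotient_vanish_on (r : seq 'I_m) L : uniq r ->
  (forall y, pf ((\prod_(j <- r) ('X - (t j)%:P)) ^+ L) *: f (gen y) = 0) ->
  forall y, f (gen y) = 0.
Proof.
elim: r L => [|i r IH] L /=.
  by move=> _ kill y; have := kill y; rewrite big_nil expr1n rmorph1 scale1r.
case/andP => ir ur kill.
set H := \prod_(j <- r) ('X - (t j)%:P); set h := 'X - (t i)%:P.
have cop : coprimep h H.
  rewrite coprimep_sym coprimep_XsubC /root horner_prod prodf_seq_neq0; apply/allP => j jr /=.
  rewrite hornerXsubC subr_eq0; apply: contraNN ir => /eqP/t_inj -> //.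
have kill' y : pf (h ^+ L * H ^+ L) *: f (gen y) = 0.
  by have := kill y; rewrite big_cons exprMn.
have [[u v] /= uv] : exists uv, uv.1 * h ^+ L.+1 + uv.2 * H ^+ L.+1 = 1.
  exact/Bezout_eq1_coprimepP/coprimep_expl/coprimep_expr.
(* The exponent is [L + 1] so that the derivative of [e] is still divisible by
   the [L]-th powers. *)
pose e := v * H ^+ L.+1.
have eE : e = 1 - u * h ^+ L.+1 by rewrite -uv addrAC subrr add0r.
have dvd_der (a b : {poly C}) : b ^+ L %| (a * b ^+ L.+1)^`().
  rewrite derivM deriv_exp /=; apply: dvdp_add; first by rewrite dvdp_mull // exprS dvdp_mull.
  by rewrite -mulrnAl mulrA dvdp_mull.
have killd y : pf e^`() *: f (gen y) = 0.
  apply: kill_dvd (kill' y); rewrite Gauss_dvdp ?coprimep_expl ?coprimep_expr //.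
  apply/andP; split; last exact: dvd_der.
  by rewrite eE derivB -polyC1 derivC sub0r dvdpNr dvd_der.
have kille y : pf e *: f (gen y) = 0.
  apply: (@quotient_local i e L) => // z; apply: kill_dvd (kill' z).
  by rewrite dvdp_mul // dvdp_mull ?dvdp_exp2l.
apply: (IH L.+1) => // y.
have -> : H ^+ L.+1 = H ^+ L.+1 * (u * h ^+ L.+1) + H ^+ L.+1 * e.
  by rewrite -mulrDr eE addrC subrK mulr1.
rewrite raddfD /= scalerDl [pf (_ * e)]rmorphM -scalerA kille scaler0 addr0.
apply: kill_dvd (kill' y); rewrite mulrC dvdp_mul ?dvdp_exp2l //.
by rewrite dvdp_mull ?dvdp_exp2l.
Qed.

Lemma uniform_kill (s : seq C) :
  supported_on s N -> exists L, forall y, pf (hpoly s ^+ L) *: f (gen y) = 0.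
Proof.
move=> sup; have [L HL] := choice (fun j : 'I_(n + W) => sup (f (gen (delta_mx j 0)))).
exists (\sum_j L j)%N => y.
have -> : gen y = \sum_j cst (y j 0) *: gen (delta_mx j 0).
  by rewrite [LHS]gen_span; apply: eq_bigr => j _; rewrite !mxE.
rewrite linear_sum scaler_sumr big1 // => j _.
rewrite linearZ /= scalerA -weyl_const_comm -scalerA (bigD1 j) //= exprD mulrC rmorphM.
by rewrite -[(_ * _) *: f _]scalerA HL !scaler0.
Qed.

Lemma quotient_vanish : supported_on (codom t) N -> forall z, f z = 0.
Proof.
move=> /uniform_kill[L kill].
have genf y : f (gen y) = 0.
  apply: (@quotient_vanish_on (enum 'I_m) L); first exact: enum_uniq.
  by move=> z; have := kill z; rewrite /hpoly /codom /image_mem big_map.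
elim/coker_piW => z; rewrite gen_span linear_sum big1 // => j _.
by rewrite linearZ /= genf scaler0.
Qed.

End Quotient.

(** * Holonomicity *)

Section Holonomic.
Variables (C : fieldType) (n w : nat).
Variables (S : 'M[C]_n) (Q : 'M[C]_(n, w)) (P : 'M[C]_(w, n)) (T : 'M[C]_w).
Local Notation V := (Vgamma (block_mx S Q P T)).
Local Notation cst := (@weyl_const C).
Local Notation x := (weyl_x C).
Local Notation dd := (weyl_d C).
Local Notation cpi := (coker_pi (phi_gamma (block_mx S Q P T))).
Local Notation gen := (@gen C n w S Q P T).
Local Notation genV := (@genV C n w S Q P T).
Local Notation genW := (@genW C n w S Q P T).

Definition monom (j : 'I_(n + w)) (a : nat) : V :=
  (if split j is inl _ then x ^+ a else dd ^+ a) *: gen (delta_mx j 0).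

(** Normal forms have no mixed monomials: only [(n + w)(p + 1)] elements are needed
to span the [p]-th step of the Bernstein filtration. *)
Definition in_filt (p : nat) (z : V) : Prop := exists c : 'I_(n + w) -> nat -> C,
  z = \sum_j \sum_(a < p.+1) cst (c j a) *: monom j a.

Lemma filtD p y z : in_filt p y -> in_filt p z -> in_filt p (y + z).
Proof.
move=> [c ->] [d ->]; exists (fun j a => c j a + d j a).
rewrite -big_split; apply: eq_bigr => j _; rewrite -big_split; apply: eq_bigr => a _ /=.
by rewrite raddfD /= scalerDl.
Qed.

Lemma filtZ p a z : in_filt p z -> in_filt p (cst a *: z).
Proof.
move=> [c ->]; exists (fun j l => a * c j l).
rewrite scaler_sumr; apply: eq_bigr => j _; rewrite scaler_sumr; apply: eq_bigr => l _.
by rewrite scalerA rmorphM.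
Qed.

Lemma filt0 p : in_filt p 0.
Proof.
exists (fun _ _ => 0); rewrite big1 // => j _; rewrite big1 // => a _.
by rewrite rmorph0 scale0r.
Qed.

Lemma filtN p z : in_filt p z -> in_filt p (- z).
Proof. by move=> /(filtZ (-1)); rewrite rmorphN rmorph1 scaleN1r. Qed.

Lemma filtMn p z k : in_filt p z -> in_filt p (z *+ k).
Proof.
by move=> /(filtZ k%:R); rewrite rmorph_nat scaler_nat.
Qed.

Lemma filt_sum p I (r : seq I) (F : I -> V) :
  (forall i, in_filt p (F i)) -> in_filt p (\sum_(i <- r) F i).
Proof. by move=> h; apply: big_ind => //; [apply: filt0 | apply: filtD]. Qed.

Lemma filtW p q z : (p <= q)%N -> in_filt p z -> in_filt q z.
Proof.
move=> pq [c ->]; exists (fun j a => if (a < p.+1)%N then c j a else 0).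
apply: eq_bigr => j _.
rewrite (big_ord_widen q.+1 (fun a => cst (c j a) *: monom j a)) // big_mkcond.
by apply: eq_bigr => a _ /=; case: ifP; rewrite ?rmorph0 ?scale0r.
Qed.

Lemma filt_monom p j a : (a <= p)%N -> in_filt p (monom j a).
Proof.
move=> ap; exists (fun j' a' => ((j' == j) && (a' == a))%:R).
rewrite (bigD1 j) //= [X in _ + X]big1 ?addr0 => [|l /negPf lj]; last first.
  by rewrite big1 // => b _; rewrite lj rmorph0 scale0r.
have lt : (a < p.+1)%N by [].
rewrite (bigD1 (Ordinal lt)) //= !eqxx rmorph1 scale1r big1 ?addr0 // => b /negPf ba.
by rewrite -val_eqE /= in ba; rewrite ba rmorph0 scale0r.
Qed.

Lemma filt_gen y : in_filt 0 (gen y).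
Proof.
rewrite [gen y]gen_span; apply: filt_sum => j; rewrite !mxE; apply: filtZ.
have -> : gen (delta_mx j 0) = monom j 0.
  by rewrite /monom; case: (split j) => _; rewrite scale1r.
exact: filt_monom.
Qed.

Lemma gen_lshift i : gen (delta_mx (lshift w i) 0) = genV (delta_mx i 0).
Proof.
congr (cpi (map_mx cst _^T)); apply/colP => j; rewrite !mxE; case: (split_ordP j) => l ->.
  by rewrite !mxE eq_lshift.
by rewrite !mxE eq_rlshift.
Qed.

Lemma gen_rshift i : gen (delta_mx (rshift n i) 0) = genW (delta_mx i 0).
Proof.
congr (cpi (map_mx cst _^T)); apply/colP => j; rewrite !mxE; case: (split_ordP j) => l ->.
  by rewrite !mxE eq_lrshift.
by rewrite !mxE eq_rshift.
Qed.

Lemma monom_lshift i a : monom (lshift w i) a = x ^+ a *: genV (delta_mx i 0).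
Proof. by rewrite /monom -[lshift w i]/(unsplit (inl i)) unsplitK gen_lshift. Qed.

Lemma monom_rshift i a : monom (rshift n i) a = dd ^+ a *: genW (delta_mx i 0).
Proof. by rewrite /monom -[rshift n i]/(unsplit (inr i)) unsplitK gen_rshift. Qed.

(** The induction is joint, since rewriting [d x^p v] needs that [x^p w] is in the
[p]-th step, and rewriting [x d^p w] needs the same of [d^p v]. *)
Lemma filt_step p : (forall z, in_filt p z -> in_filt p.+1 (x *: z)) /\
  (forall z, in_filt p z -> in_filt p.+1 (dd *: z)).
Proof.
elim/ltn_ind: p => p IH.
have pow (y : 'cV[C]_(n + w)) q : (q <= p)%N ->
    in_filt q (x ^+ q *: gen y) /\ in_filt q (dd ^+ q *: gen y).
  elim: q => [_|q IHq lt]; first by rewrite !expr0 scale1r; split; apply: filt_gen.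
  have [h1 h2] := IHq (ltnW lt); have [s1 s2] := IH q lt.
  by rewrite !exprS -!scalerA; split; [apply: s1 | apply: s2].
have comm a : dd * x ^+ a = x ^+ a * dd + x ^+ a.-1 *+ a.
  elim: a => [|a IHa]; first by rewrite !expr0 mul1r mulr1 mulr0n addr0.
  rewrite exprS mulrA weyl_comm mulrDl mul1r -mulrA IHa mulrDr mulrA -addrA; congr (_ + _).
  rewrite mulrnAr mulrS addrC; congr (_ + _).
  by case: a {IHa} => [|a] //=; rewrite -exprS.
suff main j a : (a <= p)%N -> in_filt p.+1 (x *: monom j a) /\ in_filt p.+1 (dd *: monom j a).
  split=> z [c ->]; rewrite scaler_sumr; apply: filt_sum => j; rewrite scaler_sumr;
    apply: filt_sum => a; rewrite scalerA -weyl_const_comm -scalerA; apply: filtZ;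
    by have [] := main j a (leq_ord a).
rewrite leq_eqVlt => /orP[/eqP ->|lt]; last first.
  have [h1 h2] := IH a lt; have := filt_monom j (leqnn a) => Fa.
  by split; apply: (@filtW a.+1); rewrite ?leqW //; [apply: h1 | apply: h2].
have mon := filt_monom j (leqnn p.+1).
have mon' := filtMn p (filtW (leq_pred p) (filt_monom j (leqnn p.-1))).
case: (split_ordP j) mon mon' => l ->.
  rewrite !monom_lshift => mon mon'; split; first by rewrite scalerA -exprS.
  rewrite scalerA comm scalerDl -scalerA gen_der scalerBr -scalerMnl.
  apply: (filtW (leqnSn p)); apply: filtD => //.
  by apply: filtD; [|apply: filtN]; apply: (pow _ p (leqnn p)).1.
rewrite !monom_rshift => mon mon'; split; last by rewrite scalerA -exprS.
have e : x * dd ^+ p = dd ^+ p * x - dd ^+ p.-1 *+ p by rewrite weyl_derX_x addrK.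
rewrite scalerA e scalerBl -scalerA gen_x scalerBr -scalerMnl.
apply: (filtW (leqnSn p)); apply: filtD; last exact: filtN.
by apply: filtD; [|apply: filtN]; apply: (pow _ p (leqnn p)).2.
Qed.

Lemma Vgamma_holonomic : holonomic V.
Proof.
exists (n + w)%N, (fun j => gen (delta_mx j 0)); split.
  elim/coker_piW => f; by exists (fun j => f 0 j); apply: gen_span.
exists (n + w)%N => p.
have [g gK Kg] := @curry_mxvec_bij (n + w) p.+1.
have {}gK jl : g (uncurry (@mxvec_index (n + w) p.+1) jl) = jl by apply: gK.
have {}Kg l : uncurry (@mxvec_index (n + w) p.+1) (g l) = l by apply: Kg.
exists (fun l => monom (g l).1 (g l).2) => a b j ab.
have main q i : in_filt q (dd ^+ q *: gen (delta_mx i 0)).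
  elim: q => [|q IH]; first by rewrite expr0 scale1r; apply: filt_gen.
  by rewrite exprS -scalerA; apply: (filt_step q).2.
have {}main q : in_filt (b + q) (x ^+ q *: (dd ^+ b *: gen (delta_mx j 0))).
  elim: q => [|q IH]; first by rewrite expr0 scale1r addn0.
  by rewrite addnS exprS -scalerA; apply: (filt_step _).1.
have [c] := filtW (leq_trans (eq_leq (addnC b a)) ab) (main a).
rewrite scalerA => ->; exists (fun l => c (g l).1 (g l).2).
rewrite pair_bigA /= (reindex g) /=; first by apply: eq_bigr.
by exists (uncurry (@mxvec_index (n + w) p.+1)) => l _; [apply: Kg | apply: gK].
Qed.

End Holonomic.

(** * Restriction to the complement of the poles *)

Section Localisation.
Variables (C : fieldType) (n w : nat) (s : seq C).
Variables (S : 'M[C]_n) (Q : 'M[C]_(n, w)) (P : 'M[C]_(w, n)) (T : 'M[C]_w).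
Local Notation V := (Vgamma (block_mx S Q P T)).
Local Notation pf := (dop_fun (poly_der C)).
Local Notation cst := (@weyl_const C).
Local Notation x := (weyl_x C).
Local Notation dd := (weyl_d C).
Local Notation gen := (@gen C n w S Q P T).
Local Notation genV := (@genV C n w S Q P T).
Local Notation genW := (@genW C n w S Q P T).
Local Notation cpi := (coker_pi (phi_gamma (block_mx S Q P T))).
Local Notation h := (hpoly s).

Definition combV (p : 'I_n -> {poly C}) : V :=
  \sum_i pf (p i) *: genV (delta_mx i 0).

(** After inverting [h] the module is generated over functions by [V] alone; hence
a relation between sections of [V] in the localisation is a torsion relation. *)
Definition generated_after_localisation (z : V) : Prop :=
  exists N p, pf (h ^+ N) *: z = combV p.
Local Notation sat := generated_after_localisation.

Lemma combVD p q : combV p + combV q = combV (fun i => p i + q i).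
Proof.
rewrite /combV -big_split; apply: eq_bigr => i _ /=.
by rewrite raddfD /= scalerDl.
Qed.

Lemma combVZ a p : pf a *: combV p = combV (fun i => a * p i).
Proof.
rewrite /combV scaler_sumr; apply: eq_bigr => i _.
by rewrite scalerA -rmorphM.
Qed.

Lemma satD y z : sat y -> sat z -> sat (y + z).
Proof.
move=> [N [p yE]] [M [q zE]]; exists (N + M)%N, (fun i => h ^+ M * p i + h ^+ N * q i).
rewrite -combVD -!combVZ -yE -zE !scalerA -!rmorphM -!exprD scalerDr.
by rewrite (addnC M N).
Qed.

Lemma satZ a z : sat z -> sat (pf a *: z).
Proof.
move=> [N [p zE]]; exists N, (fun i => a * p i).
by rewrite -combVZ -zE !scalerA -!rmorphM mulrC.
Qed.

Lemma satN z : sat z -> sat (- z).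
Proof. by move=> /(satZ (-1)); rewrite rmorphN rmorph1 scaleN1r. Qed.

Lemma sat0 : sat 0.
Proof.
exists 0%N, (fun _ => 0); rewrite scaler0 /combV big1 // => i _.
by rewrite rmorph0 scale0r.
Qed.

Lemma sat_sum I (r : seq I) (F : I -> V) :
  (forall i, sat (F i)) -> sat (\sum_(i <- r) F i).
Proof. by move=> H; apply: big_ind => //; [apply: sat0 | apply: satD]. Qed.

Lemma sat_div N z : sat (pf (h ^+ N) *: z) -> sat z.
Proof.
move=> [M [p zE]]; exists (M + N)%N, p.
by rewrite exprD rmorphM -scalerA.
Qed.

Lemma sat_genV v : sat (genV v).
Proof.
exists 0%N, (fun i => (v i 0)%:P); rewrite expr0 rmorph1 scale1r.
have lin a u y := @genV_linear C n w S Q P T a u y.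
have -> : v = \sum_i v i 0 *: delta_mx i 0.
  by rewrite [LHS]matrix_sum_delta; apply: eq_bigr => j _; rewrite big_ord1.
rewrite /combV (big_morph genV (id1 := 0) (op1 := +%R)) ?genV0 // => [|u y]; last first.
  by have := lin 1 u y; rewrite !scale1r.
apply: eq_bigr => i _; have := lin (v i 0) (delta_mx i 0) 0; rewrite !addr0 genV0 addr0 => ->.
rewrite summxE (bigD1 i) //= big1 ?addr0 => [|l /negPf li]; rewrite !mxE ?eqxx ?mulr1 //.
by rewrite eq_sym li mulr0.
Qed.

Hypothesis sat_genW : forall y, sat (genW y).

Lemma sat_der z : sat z -> sat (dd *: z).
Proof.
move=> sz; have [N [p zE]] := sz; apply: (@sat_div N).
have -> : pf (h ^+ N) *: (dd *: z) = dd *: combV p - pf (h ^+ N)^`() *: z.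
  by rewrite -zE !scalerA dop_der_fun /= scalerDl addrK.
apply: satD; last by apply: satN; apply: satZ.
rewrite /combV scaler_sumr; apply: sat_sum => i.
rewrite scalerA dop_der_fun scalerDl -scalerA gen_der; apply: satD; apply: satZ.
  by apply: satD => //; apply: satN; apply: sat_genV.
exact: sat_genV.
Qed.

Lemma sat_all z : sat z.
Proof.
elim/coker_piW: z => f; rewrite gen_span; apply: sat_sum => j.
have sg : sat (gen (delta_mx j 0)).
  by rewrite -[delta_mx j 0]vsubmxK gen_split; apply: satD => //; apply: sat_genV.
elim/diffop_ind: (f 0 j) => [A B hA hB|a|a i].
- by rewrite scalerDl; apply: satD.
- exact: satZ.
rewrite -scalerA; apply: satZ; elim: i => [|i IH]; first by rewrite expr0 scale1r.
by rewrite exprS -scalerA; apply: sat_der.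
Qed.

Local Notation rc := (reg_poly s \o @polyC C)%FUN.
Variable R : 'M[regular s]_w.
Hypothesis RK : R *m ((reg_poly s 'X)%:M - map_mx rc T) = 1%:M.

(** With [R] the inverse of [x - T], this is the expression of [A] by [kappa]. *)
Definition reg_conn : 'M[regular s]_n := map_mx rc S + map_mx rc Q *m R *m map_mx rc P.
Local Notation M := (connmod (reg_der s) reg_conn).
Local Notation res := (@weyl_res C s).

(** The relation [x w = T w - Q w] leaves no choice for the image of [w]. *)
Definition loc_mx : 'M[regular s]_(n, n + w) := row_mx 1%:M (- (map_mx rc Q *m R)).
Definition loc_row (f : 'rV[weyl C]_(n + w)) : M := \sum_j res (f 0 j) *: (col j loc_mx : M).

Lemma loc_row_semilinear A f g : loc_row (A *: f + g) = res A *: loc_row f + loc_row g.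
Proof.
rewrite /loc_row scaler_sumr -big_split /=; apply: eq_bigr => j _.
by rewrite !mxE rmorphD rmorphM scalerDl scalerA.
Qed.

Lemma loc_row_const y : loc_row (map_mx cst y^T) = loc_mx *m map_mx rc y :> 'cV_n.
Proof.
rewrite /loc_row; have -> : loc_mx *m map_mx rc y = \sum_j rc (y j 0) *: col j loc_mx.
  apply/colP => i; rewrite mxE summxE; apply: eq_bigr => j _.
  by rewrite !mxE mulrC.
by apply: eq_bigr => j _; rewrite !mxE weyl_res_fun connmod_fun.
Qed.

Lemma loc_row_blocks v y : loc_row (map_mx cst (col_mx v y)^T) =
  map_mx rc v - map_mx rc Q *m R *m map_mx rc y :> 'cV_n.
Proof. by rewrite loc_row_const map_col_mx mul_row_col mul1mx mulNmx. Qed.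

Lemma loc_row_phi_const v y :
  loc_row (phi_gamma (block_mx S Q P T) (map_mx cst (col_mx v y)^T)) = 0.
Proof.
have -> : phi_gamma (block_mx S Q P T) (map_mx cst (col_mx v y)^T) =
    dd *: map_mx cst (col_mx v 0)^T + (x *: map_mx cst (col_mx 0 y)^T +
      map_mx cst (col_mx (S *m v + Q *m y) (- (P *m v) - T *m y))^T).
  rewrite phi_row !tr_col_mx !trmx0 !map_row_mx !map_mx0 !scale_row_mx !scaler0.
  rewrite !add_row_mx !add0r !linearD /= !linearN /= !map_mxD !map_mxN; congr row_mx.
    by rewrite addrA.
  by rewrite addrCA.
rewrite !loc_row_semilinear weyl_res_der weyl_res_fun.
have e1 : dop_der (reg_der s) *: loc_row (map_mx cst (col_mx v 0)^T) =
    - (reg_conn *m map_mx rc v) :> 'cV_n.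
  rewrite connmod_der loc_row_blocks map_mx0 mulmx0 subr0 /nabla [map_mx _ _](_ : _ = 0) ?sub0r //.
  apply/colP => j; rewrite !mxE /=; have := reg_poly_der s (v j 0)%:P.
  by rewrite derivC rmorph0.
have e2 : dop_fun (reg_der s) (reg_poly s 'X) *: loc_row (map_mx cst (col_mx 0 y)^T) =
    - (map_mx rc Q *m R *m (reg_poly s 'X *: map_mx rc y)) :> 'cV_n.
  by rewrite connmod_fun loc_row_blocks map_mx0 sub0r scalerN scalemxAr.
have e3 := loc_row_blocks (S *m v + Q *m y) (- (P *m v) - T *m y).
transitivity (- (reg_conn *m map_mx rc v) +
  (- (map_mx rc Q *m R *m (reg_poly s 'X *: map_mx rc y)) +
   (map_mx rc (S *m v + Q *m y) - map_mx rc Q *m R *m map_mx rc (- (P *m v) - T *m y)))).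
  exact: (congr2 (@GRing.add 'cV[regular s]_n) e1 (congr2 (@GRing.add 'cV[regular s]_n) e2 e3)).
have RKy : R *m (reg_poly s 'X *: map_mx rc y) =
    map_mx rc y + R *m (map_mx rc T *m map_mx rc y).
  rewrite -[X in X + _]mul1mx -RK mulmxBr mulmxBl -!mulmxA mul_scalar_mx.
  by rewrite subrK.
rewrite -(mulmxA _ R (_ *: _)) RKy /reg_conn map_mxB map_mxN !map_mxD !map_mxM.
rewrite !mulmxDl !mulmxBr.
rewrite !mulmxN !mulmxDr !mulmxA.
set a := _ *m map_mx rc v; set b := _ *m map_mx rc v; set c := _ *m map_mx rc y.
set e := _ *m map_mx rc y.
by rewrite !opprD !opprK !addrA -!opprD -!addrA [c + (b + e)]addrCA addNr.
Qed.

Lemma loc_row0 : loc_row 0 = 0.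
Proof. by rewrite /loc_row big1 // => j _; rewrite mxE rmorph0 scale0r. Qed.

Lemma loc_rowZ A f : loc_row (A *: f) = res A *: loc_row f.
Proof. by rewrite -[A *: f]addr0 loc_row_semilinear loc_row0 addr0. Qed.

Lemma loc_row_phi f : loc_row (phi_gamma (block_mx S Q P T) f) = 0.
Proof.
have -> : f = \sum_j f 0 j *: map_mx cst (delta_mx j 0)^T.
  rewrite [LHS]row_sum_delta; apply: eq_bigr => j _; congr (_ *: _).
  by apply/rowP => l; rewrite !mxE !eqxx andbT; case: (l == j); rewrite ?rmorph1 ?rmorph0.
rewrite linear_sum; apply: (big_ind (fun z => loc_row z = 0)) => [|y z hy hz|j _].
- exact: loc_row0.
- by rewrite -[y]scale1r loc_row_semilinear hy hz scaler0 addr0.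
rewrite linearZ [loc_row _]loc_rowZ.
by rewrite -[delta_mx j 0]vsubmxK loc_row_phi_const scaler0.
Qed.

(** The representative does not matter by [loc_row_phi]. *)
Definition loc_map (z : V) : M := loc_row (repr z).

Lemma loc_mapE f : loc_map (cpi f) = loc_row f.
Proof.
have [g e] := coker_repr (phi_gamma (block_mx S Q P T)) f.
rewrite /loc_map -[repr _](subrK f) e -[phi_gamma _ _]scale1r loc_row_semilinear loc_row_phi.
by rewrite scaler0 add0r.
Qed.

Lemma loc_map_semilinear A y z : loc_map (A *: y + z) = res A *: loc_map y + loc_map z.
Proof.
elim/coker_piW: y => y; elim/coker_piW: z => z.
by rewrite -linearP !loc_mapE loc_row_semilinear.
Qed.

Lemma loc_map_genV v : loc_map (genV v) = map_mx rc v :> 'cV_n.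
Proof. by rewrite loc_mapE loc_row_blocks map_mx0 mulmx0 subr0. Qed.

Lemma loc_map_combV p : loc_map (combV p) = \col_i reg_poly s (p i) :> 'cV_n.
Proof.
have -> : \col_i reg_poly s (p i) = \sum_i reg_poly s (p i) *: delta_mx i 0 :> 'cV_n.
  rewrite [LHS]matrix_sum_delta; apply: eq_bigr => i _; rewrite big_ord1.
  by rewrite mxE.
have uD y z : loc_map (y + z) = loc_map y + loc_map z.
  by rewrite -[y]scale1r loc_map_semilinear rmorph1 !scale1r.
have u_0 : loc_map 0 = 0 by rewrite -(linear0 cpi) loc_mapE loc_row0.
rewrite /combV (big_morph loc_map uD u_0).
apply: eq_bigr => i _; rewrite -[_ *: _]addr0 loc_map_semilinear u_0 addr0.
rewrite weyl_res_fun connmod_fun loc_map_genV; congr (_ *: _).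
apply/colP => j; rewrite !mxE; case: (_ && _); first exact: (rmorph1 rc).
exact: (rmorph0 rc).
Qed.

(** The kernel is torsion since, by [sat_all], a multiple of any element is a
combination of the generators [v], which are independent in the connection. *)
Lemma Vgamma_restricts : restricts_to V M.
Proof.
exists loc_map; split; first exact: loc_map_semilinear.
  move=> z uz; have [N [p e]] := sat_all z; exists N; rewrite e.
  have : loc_map (combV p) = 0.
    rewrite -e -[_ *: z]addr0 loc_map_semilinear uz scaler0 add0r.
    by rewrite -(linear0 cpi) loc_mapE loc_row0.
  have -> : loc_map (combV p) = (\col_i reg_poly s (p i) : 'cV_n) by exact: loc_map_combV.
  move=> /colP p0; rewrite /combV big1 // => i _.
  have := p0 i; rewrite !mxE -(rmorph0 (@reg_poly C s)) => /reg_poly_inj ->.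
  by rewrite rmorph0 scale0r.
move=> v.
have ex i : exists Nq : nat * {poly C},
    (v : 'cV_n) i 0 * reg_poly s (h ^+ Nq.1) = reg_poly s Nq.2.
  case: ((v : 'cV_n) i 0) => r /= rP; have /asboolP[p [N e]] := rP.
  exists (N, p); apply: val_inj; rewrite /= e mulfVK //.
  by rewrite tofrac_eq0 hpolyX_neq0.
have [Nq NqE] := choice ex.
exists (\sum_i (Nq i).1)%N, (combV (fun i => (Nq i).2 * h ^+ (\sum_(j | j != i) (Nq j).1))).
rewrite weyl_res_fun; apply: etrans (connmod_fun _ _) _; apply: etrans (esym (loc_map_combV _)).
apply/colP => i; rewrite !mxE [in RHS]rmorphM /= -NqE -mulrA -rmorphM -exprD.
by rewrite mulrC (bigD1 i).
Qed.

End Localisation.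

HB.instance Definition _ (C : fieldType) (s : seq C) :=
  GRing.RMorphism.copy (@regval C s) (val : regular s -> {fraction {poly C}}).

Section BlockLocalisation.
Variables (C : fieldType) (n m : nat) (w : 'I_m -> nat) (t : 'I_m -> C).
Variables (S : 'M[C]_n) (Nm : forall j, 'M[C]_(w j)).
Variables (P : forall j, 'M[C]_(w j, n)) (Q : forall j, 'M[C]_(n, w j)).
Local Notation W := (\sum_j w j)%N.
Local Notation Tm := (\mxdiag_j ((t j)%:M + Nm j)).
Local Notation Qm := (\mxrow_j Q j).
Local Notation Pm := (\mxcol_j P j).
Local Notation pf := (dop_fun (poly_der C)).
Local Notation cst := (@weyl_const C).
Local Notation genV := (@genV C n W S Qm Pm Tm).
Local Notation genW := (@genW C n W S Qm Pm Tm).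
Local Notation em := (emb C w).
Variable k : 'I_m -> nat.
Hypothesis nilp : forall j, Nm j ^+ k j = 0.
Local Notation s := (codom t).
Local Notation h := (hpoly s).
Local Notation sat := (@generated_after_localisation C n W s S Qm Pm Tm).

Lemma hpoly_factor j : exists q, h = q * ('X - (t j)%:P).
Proof.
rewrite /hpoly /codom /image_mem big_map (bigD1_seq j) ?mem_enum ?enum_uniq //=.
by eexists; rewrite mulrC.
Qed.

Lemma sat_genW y : sat (genW y).
Proof.
have lin u z : genW (u + z) = genW u + genW z.
  by have := @genW_linear C n W S Qm Pm Tm 1 u z; rewrite !scale1r.
have linZ a u : genW (a *: u) = cst a *: genW u.
  by have := @genW_linear C n W S Qm Pm Tm a u 0; rewrite genW0 !addr0.
rewrite -[y]mul1mx -mxrow_emb -[y]submxcolK mul_mxrow_mxcol.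
rewrite (big_morph genW lin (genW0 _ _ _ _)); apply: sat_sum => j.
move: (submxcol y j) => z.
have main a : sat (genW (em j *m (Nm j ^+ (k j - a) *m z))).
  elim: a => [|a IH]; first by rewrite subn0 nilp mul0mx mulmx0 genW0; apply: sat0.
  have [le|lt] := leqP (k j) a.
    have e : (k j - a = 0)%N by apply/eqP; rewrite subn_eq0.
    have e' : (k j - a.+1 = 0)%N by apply/eqP; rewrite subn_eq0 leqW.
    by move: IH; rewrite e e'.
  set b := (k j - a.+1)%N; have eb : (k j - a)%N = b.+1 by rewrite /b subnSK.
  rewrite eb exprS -mulmxE -mulmxA in IH.
  (* [(x - t_j) w = N w - Q w], and [N] is nilpotent. *)
  have [q hq] := hpoly_factor j; apply: (@sat_div _ _ _ _ _ _ _ _ 1).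
  rewrite expr1 hq rmorphM -scalerA.
  apply: satZ; rewrite rmorphB scalerBl /= -[pf 'X]/(weyl_x C) gen_x.
  rewrite -[pf _%:P]/(cst (t j)) mulmxA mxdiag_emb -mulmxA mulmxDl mulmxDr lin.
  rewrite mul_scalar_mx -scalemxAr linZ addrAC [_ + genW _]addrC addrK.
  by apply: satD => //; apply: satN; apply: sat_genV.
by have := main (k j); rewrite subnn expr0 mul1mx.
Qed.

Local Notation rc := (reg_poly s \o @polyC C)%FUN.

Lemma inv_ex j : exists r : regular s, regval r = (@FracField.tofrac _ ('X - (t j)%:P))^-1.
Proof.
have [q hq] := hpoly_factor j.
have rP : (@FracField.tofrac _ ('X - (t j)%:P))^-1 \in regfun s.
  apply/asboolP; exists q, 1%N; rewrite expr1 hq rmorphM invfM mulrA mulfV ?mul1r //.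
  rewrite tofrac_eq0; apply: contraTneq (hpolyX_neq0 s 1) => q0.
  by rewrite expr1 hq q0 mul0r eqxx.
by exists (Regular rP).
Qed.

Definition inv_shift (j : 'I_m) : regular s := projT1 (cid (inv_ex j)).

Lemma inv_shiftE j : regval (inv_shift j) = (@FracField.tofrac _ ('X - (t j)%:P))^-1.
Proof. exact: (projT2 (cid (inv_ex j))). Qed.

Lemma inv_shiftK j : inv_shift j * reg_poly s ('X - (t j)%:P) = 1.
Proof.
by apply: val_inj; rewrite /= inv_shiftE mulVf // tofrac_eq0 polyXsubC_eq0.
Qed.

(** [(x - t_j - N_j)^-1], as a geometric series in the nilpotent [N_j]. *)
Definition res_block (j : 'I_m) : 'M[regular s]_(w j) :=
  \sum_(a < k j) inv_shift j ^+ a.+1 *: map_mx rc (Nm j ^+ a).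

Lemma res_blockK j :
  res_block j *m ((reg_poly s ('X - (t j)%:P))%:M - map_mx rc (Nm j)) = 1%:M.
Proof.
pose F a := inv_shift j ^+ a *: map_mx rc (Nm j ^+ a).
transitivity (F 0%N - F (k j)); last first.
  by rewrite /F nilp map_mx0 scaler0 subr0 !expr0 scale1r map_mx1.
rewrite /res_block mulmx_suml.
transitivity (\sum_(a < k j) (F a - F a.+1)).
  apply: eq_bigr => a _; rewrite /F mulmxBr -!scalemxAl mul_mx_scalar -map_mxM mulmxE -exprSr.
  by rewrite scalerA exprSr -mulrA inv_shiftK mulr1.
by elim: (k j) => [|b IH]; [rewrite big_ord0 subrr | rewrite big_ord_recr /= IH addrA subrK].
Qed.

Definition inv_x_sub_T : 'M[regular s]_W :=
  \sum_j map_mx rc (em j) *m res_block j *m map_mx rc (em j)^T.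

Lemma tr_emb_mxdiag j : (em j)^T *m Tm = ((t j)%:M + Nm j) *m (em j)^T.
Proof.
apply: trmx_inj; rewrite !trmx_mul trmxK tr_mxdiag mxdiag_emb //.
Qed.

Lemma sum_emb : \sum_j em j *m (em j)^T = 1%:M :> 'M[C]_W.
Proof.
rewrite -mul_mxrow_mxcol mxrow_emb mul1mx -[RHS]trmx1 -mxrow_emb tr_mxrow //.
Qed.

Lemma inv_x_sub_TK : inv_x_sub_T *m ((reg_poly s 'X)%:M - map_mx rc Tm) = 1%:M.
Proof.
rewrite mulmx_suml -(map_mx1 rc) -sum_emb raddf_sum /=; apply: eq_bigr => j _.
rewrite map_mxM -!mulmxA; congr (_ *m _).
have -> : map_mx rc (em j)^T *m ((reg_poly s 'X)%:M - map_mx rc Tm) =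
   ((reg_poly s ('X - (t j)%:P))%:M - map_mx rc (Nm j)) *m map_mx rc (em j)^T.
  rewrite mulmxBr -map_mxM tr_emb_mxdiag map_mxM map_mxD map_scalar_mx mulmxBl mulmxDl.
  by rewrite mul_mx_scalar !mul_scalar_mx rmorphB scalerBl opprD addrA.
by rewrite mulmxA res_blockK mul1mx.
Qed.

Lemma regval_conn (B : 'I_m -> nat -> 'M[C]_n) :
  (forall j l, Q j *m Nm j ^+ l *m P j = moment k B j l) ->
  map_mx (@regval C s) (reg_conn S Qm Pm inv_x_sub_T) = partial_fractions t k S B.
Proof.
move=> mom; have vc p q (M : 'M_(p, q)) :
    map_mx (@regval C s) (map_mx rc M) = map_mx (@ratconst C) M.
  by apply/matrixP => a b; rewrite !mxE.
rewrite /reg_conn map_mxD vc; congr (_ + _).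
rewrite /inv_x_sub_T mulmx_sumr mulmx_suml raddf_sum; apply: eq_bigr => j _ /=.
rewrite !mulmxA -map_mxM mxrow_mul_emb -!mulmxA -map_mxM.
have -> : (em j)^T *m Pm = P j.
  by apply: trmx_inj; rewrite trmx_mul trmxK tr_mxcol mxrow_mul_emb.
rewrite big_add1 /= big_mkord /res_block mulmx_suml mulmx_sumr raddf_sum.
apply: eq_bigr => a _ /=.
rewrite -scalemxAl -scalemxAr map_mxZ rmorphXn /= inv_shiftE exprVn; congr (_ *: _).
rewrite -!map_mxM mulmxA mom /moment ltn_ord; exact: vc.
Qed.

End BlockLocalisation.

(** * Uniqueness of minimal extensions *)

Section Submodule.
Variables (R : nzRingType) (M : lmodType R) (S : M -> Prop).
(** Submodules given by arbitrary predicates, so that kernels and images of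
semilinear maps become modules. *)
Definition submodule_prop : Prop := S 0 /\ forall a x y, S x -> S y -> S (a *: x + y).
Hypothesis S_sub : submodule_prop.

Definition submodule_pred of submodule_prop : {pred M} := fun x => `[< S x >].
Local Notation sp := (submodule_pred S_sub).

Lemma submodule_closed : subsemimod_closed sp.
Proof.
case: S_sub => S0 SL; split; last first.
  by move=> a x /asboolP hx; apply/asboolP; rewrite -[_ *: _]addr0; apply: SL.
split; first exact/asboolP.
by move=> x y /asboolP hx /asboolP hy; apply/asboolP; rewrite -[x]scale1r; apply: SL.
Qed.
HB.instance Definition _ := GRing.isSubmodClosed.Build R M sp submodule_closed.

Record submodule := Submodule { submodule_val : M; _ : submodule_val \in sp }.
HB.instance Definition _ := [isSub for submodule_val].
HB.instance Definition _ := [Choice of submodule by <:].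
HB.instance Definition _ := [SubChoice_isSubLmodule of submodule by <:].

Lemma submodule_val_linear : linear submodule_val.
Proof. by move=> a x y; rewrite -[submodule_val]/(val : submodule -> M) linearP. Qed.
HB.instance Definition _ := GRing.isLinear.Build R submodule M _ submodule_val
  submodule_val_linear.

Lemma submodule_valP (x : submodule) : S (submodule_val x).
Proof. exact/asboolP/(valP x). Qed.

Lemma submodule_val_inj : injective submodule_val.
Proof. exact: val_inj. Qed.

Lemma mem_submodule x : S x -> exists y : submodule, submodule_val y = x.
Proof. by move=> /asboolP hx; exists (Submodule hx). Qed.

End Submodule.

Lemma dmod_iso_inv (C : fieldType) (M N : lmodType (weyl C)) : dmod_iso M N ->
  exists (f : {linear M -> N}) (g : {linear N -> M}), cancel f g /\ cancel g f.
Proof.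
case=> f [g fK gK]; have gl := can2_linear fK gK.
pose gL : {linear N -> M} := HB.pack g (GRing.isLinear.Build _ _ _ _ g gl).
by exists f, gL.
Qed.

Section Minimal.
Variables (C : fieldType) (s : seq C) (n : nat) (A : 'M[{fraction {poly C}}]_n).
Local Notation pf := (dop_fun (poly_der C)).

Lemma minimal_extension_iso (M N : lmodType (weyl C)) :
  minimal_extension s A M -> dmod_iso M N -> minimal_extension s A N.
Proof.
move=> [hol [AU [AUE [u [uL uk us]]]] sub quo] /dmod_iso_inv [f [g [fK gK]]]; split.
- case: hol => r [e [gen [c bnd]]]; exists r, (f \o e); split.
    move=> y; have [P PE] := gen (g y); exists P.
    rewrite -[y]gK PE linear_sum; apply: eq_bigr => i _; exact: linearZ.
  exists c => p; have [b bE] := bnd p; exists (f \o b) => a1 a2 i le.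
  have [z zE] := bE a1 a2 i le; exists z; rewrite /= -linearZ zE linear_sum.
  by apply: eq_bigr => l _; apply: linearZ.
- exists AU; split=> //; exists (u \o g); split=> /= [P y z|y|v].
  + by rewrite linearP uL.
  + by move=> /uk[L h]; exists L; rewrite -[y]gK -linearZ h linear0.
  + by have [L [y e]] := us v; exists L, (f y); rewrite fK.
- move=> K q qi Ks; apply: (sub K (g \o q)%FUN) => // x y /= /(can_inj gK).
  exact: qi.
- move=> K q qs Ks; apply: (quo K (q \o f)%FUN) => // y.
  by have [x <-] := qs y; exists (g x); rewrite /= gK.
Qed.

Section Comparison.
Variables (M1 M2 : lmodType (weyl C)) (AU : 'M[regular s]_n).
Local Notation V := (connmod (reg_der s) AU).
Variables (u1 : M1 -> V) (u2 : M2 -> V).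
Hypothesis lin1 : forall P y z, u1 (P *: y + z) = weyl_res s P *: u1 y + u1 z.
Hypothesis lin2 : forall P y z, u2 (P *: y + z) = weyl_res s P *: u2 y + u2 z.
Hypothesis sur2 : forall v, exists N m, weyl_res s (pf (hpoly s ^+ N)) *: v = u2 m.
Hypothesis quo1 : forall (N : lmodType (weyl C)) (f : {linear M1 -> N}),
  (forall y, exists m, f m = y) -> supported_on s N -> forall y : N, y = 0.

(** The elements of [M1] that [u1] sends into the image of [u2] form a submodule,
and the quotient by it is torsion because [M2] generates the localisation. *)
Lemma lattice_sub x : exists y, u1 x = u2 y.
Proof.
have u0 (M : lmodType (weyl C)) (u : M -> V) :
    (forall P y z, u (P *: y + z) = weyl_res s P *: u y + u z) -> u 0 = 0.
  move=> lin; have := lin (-1) 0 0; rewrite scaler0 addr0 rmorphN rmorph1 scaleN1r.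
  by rewrite addNr.
have Ksub : submodule_prop (fun x => exists y, u1 x = u2 y).
  split; first by exists 0; rewrite !u0.
  by move=> P y z [y' ey] [z' ez]; exists (P *: y' + z'); rewrite lin1 lin2 ey ez.
pose iK := (submodule_val (S_sub := Ksub) : {linear submodule Ksub -> M1}).
have kill : forall y : coker iK, y = 0.
  apply: (quo1 (f := coker_pi iK)); first by elim/coker_piW => y; exists y.
  elim/coker_piW => y; have [N [m e]] := sur2 (u1 y); exists N.
  have [z ez] : exists z : submodule Ksub, submodule_val z = pf (hpoly s ^+ N) *: y.
    apply: mem_submodule; exists m; rewrite -e -[_ *: y]addr0 lin1.
    by rewrite (u0 _ _ lin1) addr0.
  rewrite -linearZ -[RHS](linear0 (coker_pi iK)); apply/eqP/coker_piP.
  by exists z; rewrite subr0; apply: esym.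
have /eqP := kill (coker_pi iK x); rewrite -(linear0 (coker_pi iK)) => /coker_piP[z].
by rewrite subr0 => ->; exact: (submodule_valP z).
Qed.

End Comparison.

(** The kernel of the map to the localisation is a torsion submodule. *)
Lemma minimal_injective (M : lmodType (weyl C)) (AU : 'M[regular s]_n)
    (u : M -> connmod (reg_der s) AU) :
  (forall P y z, u (P *: y + z) = weyl_res s P *: u y + u z) ->
  (forall m, u m = 0 -> exists N, pf (hpoly s ^+ N) *: m = 0) ->
  (forall (N : lmodType (weyl C)) (f : {linear N -> M}),
        injective f -> supported_on s N -> forall y : N, y = 0) ->
  injective u.
Proof.
move=> lin ker sub.
have u0 : u 0 = 0.
  by have := lin (-1) 0 0; rewrite scaler0 addr0 rmorphN rmorph1 scaleN1r addNr.
have Ksub : submodule_prop (fun x => u x = 0).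
  by split=> // P y z uy uz; rewrite lin uy uz scaler0 addr0.
have K0 (y : submodule Ksub) : y = 0.
  apply: (sub _ (submodule_val (S_sub := Ksub) : {linear submodule Ksub -> M})).
    exact: submodule_val_inj.
  move=> z; have [N h] := ker _ (submodule_valP z); exists N.
  by apply: submodule_val_inj; rewrite linearZ /= h.
move=> x y uxy; apply/eqP; rewrite -subr_eq0; apply/eqP.
have [z <-] : exists z : submodule Ksub, submodule_val z = x - y.
  apply: mem_submodule; rewrite addrC -scaleN1r lin rmorphN rmorph1 scaleN1r uxy.
  by rewrite addNr.
by rewrite (K0 z).
Qed.

Lemma minimal_extension_unique (M N : lmodType (weyl C)) :
  minimal_extension s A M -> minimal_extension s A N -> dmod_iso M N.
Proof.
move=> [_ [AU [AUE [u [uL uk us]]]] subM quoM] [_ [AU' [AUE' [u' [uL' uk' us']]]] subN quoN].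
have eAU : AU' = AU.
  apply/matrixP => i j; apply: val_inj.
  by have := congr1 (fun X : 'M_n => X i j) (etrans AUE' (esym AUE)); rewrite !mxE.
subst AU'.
have iu := minimal_injective uL uk subM; have iu' := minimal_injective uL' uk' subN.
have [f fE] := choice (lattice_sub uL uL' us' quoM).
have [g gE] := choice (lattice_sub uL' uL us quoN).
have fl : linear f.
  by move=> a x y; apply: iu'; rewrite -fE uL uL' !fE.
pose fL : {linear M -> N} := HB.pack f (GRing.isLinear.Build _ _ _ _ f fl).
exists fL; exists g => x /=; first by apply: iu; rewrite -gE -fE.
by apply: iu'; rewrite -fE -gE.
Qed.

End Minimal.

(** * Assembly *)

Section Main.
Variables (C : fieldType) (n m : nat).
Hypothesis char0 : forall p, p.+1%:R != 0 :> C.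
Variables (A : 'M[{fraction {poly C}}]_n) (t : 'I_m -> C) (k : 'I_m -> nat).
Variables (A0 : 'M[C]_n) (B : 'I_m -> nat -> 'M[C]_n).
Hypothesis t_inj : injective t.
Hypothesis A_expand : A = partial_fractions t k A0 B.
Hypothesis normal_forms : forall i : 'I_m,
  exists (g : 'M[fps C]_n) (Lam : 'M[{poly C}]_n) (L : 'M[C]_n),
    [/\ g \in unitmx, is_normal_form Lam L,
        exists F : 'M[fps C]_n, gauge_eq (t i) A g Lam L F & nonresonant Lam L].

Lemma kappa_minimal : minimal_extension (codom t) A (Vgamma (kappa A0 t k B)).
Proof.
pose w j := locW (k j) (B j).
pose Nm (j : 'I_m) : 'M[C]_(w j) := locN (k j) (B j).
pose P (j : 'I_m) : 'M[C]_(w j, n) := locP (k j) (B j).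
pose Q (j : 'I_m) : 'M[C]_(n, w j) := locQ (k j) (B j).
have nilp j : Nm j ^+ k j = 0 by exact: loc_nilp.
have nilp' j : exists l, Nm j ^+ l = 0 by exists (k j).
have ctrl j : controllable (Nm j) (P j) by exact: loc_controllable.
have obs j : controllable (Nm j)^T (Q j)^T by exact: loc_observable.
have mom j l : Q j *m Nm j ^+ l *m P j = moment k B j l by exact: loc_moment.
have nf i : normalisable (fun l => Q i *m Nm i ^+ l *m P i) /\
    normalisable (fun l => - (Q i *m Nm i ^+ l *m P i)^T).
  have [g [Lam [L [gu nfL gauge nonres]]]] := normal_forms i.
  rewrite A_expand in gauge.
  have -> : (fun l => Q i *m Nm i ^+ l *m P i) = moment k B i by apply/funext => l; rewrite mom.
  have -> : (fun l => - (Q i *m Nm i ^+ l *m P i)^T) = (fun l => - (moment k B i l)^T).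
    by apply/funext => l; rewrite mom.
  exact: (moment_normalisable char0 t_inj gu nfL gauge nonres).
split.
- exact: Vgamma_holonomic.
- exists (reg_conn A0 (\mxrow_j Q j) (\mxcol_j P j) (inv_x_sub_T t Nm k)); split.
    by rewrite A_expand; apply: regval_conn.
  apply: Vgamma_restricts; first by move=> y; apply: (@sat_genW C n m w t A0 Nm P Q k nilp).
  exact: (@inv_x_sub_TK C m w t Nm k nilp).
- move=> N f fi sup y; have [L h] := sup y; apply: fi; rewrite linear0.
  apply: (@Vgamma_torsion_free C n m w t A0 Nm P Q t_inj nilp' ctrl obs (fun i => (nf i).2) L).
  by rewrite -linearZ h linear0.
- move=> N f fs sup y; have [z <-] := fs y.
  exact: (@quotient_vanish C n m w t A0 Nm P Q t_inj nilp' ctrl obs (fun i => (nf i).1) N f sup z).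
Qed.

Lemma minimal_extensionP M :
  minimal_extension (codom t) A M <-> dmod_iso (Vgamma (kappa A0 t k B)) M.
Proof.
split; first exact: minimal_extension_unique kappa_minimal.
exact: minimal_extension_iso kappa_minimal.
Qed.

End Main.

Theorem theorem2p16 (R : realType) (n m : nat)
  (A : 'M[{fraction {poly R[i]%C}}]_n)
  (t : 'I_m -> R[i]%C) (k : 'I_m -> nat)
  (A0 : 'M[R[i]%C]_n) (B : 'I_m -> nat -> 'M[R[i]%C]_n)
  (pole_infty : pole_infty_le2 A)
  (t_inj : injective t) (k_gt0 : forall i, (0 < k i)%N)
  (pole_order : forall i, B i (k i) <> 0)
  (A_expand : A = partial_fractions t k A0 B)
  (normal_forms : forall i : 'I_m,
     exists (g : 'M[fps R[i]%C]_n) (Lam : 'M[{poly R[i]%C}]_n)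
            (L : 'M[R[i]%C]_n),
       [/\ g \in unitmx,
           is_normal_form Lam L,
           exists F : 'M[fps R[i]%C]_n, gauge_eq (t i) A g Lam L F
         & nonresonant Lam L]) :
  forall M : lmodType (weyl R[i]%C),
    minimal_extension (codom t) A M <-> dmod_iso (Vgamma (kappa A0 t k B)) M.
Proof.
move=> M; apply: minimal_extensionP => // p.
by rewrite Num.Theory.pnatr_eq0.
Qed.
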